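(* For $\tau_1,\tau_2>-d$ such that $\tau_1+\tau_2>-d$ one has $$0\le V(W)-\frac{\operatorname{Cov}(L_t^{(\tau_1)},L_t^{(\tau_2)})}{\sigma^{(1)}_{\tau_1\tau_2}\,t^2\,\delta_t^{\tau_1+\tau_2+d}+\sigma^{(2)}_{\tau_1\tau_2}\,t^3\,\delta_t^{\tau_1+\tau_2+2d}}\le\delta_t\,S(W).$$ In particular, for $\tau_1>-d/2$, $$\operatorname{Var}L_t^{(\tau_1)}=\Big(\sigma^{(1)}_{\tau_1\tau_1}t^2\delta_t^{2\tau_1+d}+\sigma^{(2)}_{\tau_1\tau_1}t^3\delta_t^{2\tau_1+2d}\Big)V(W)\,(1+O(\delta_t))\quad\text{as } t\to\infty.$$ Moreover, for $m\in\mathbb{N}$ and $\tau_1,\dots,\tau_m>-d/2$ let $$\widetilde L_t^{(\tau_i)}=\frac{L_t^{(\tau_i)}-\mathbb{E}L_t^{(\tau_i)}}{\max\{t\,\delta_t^{\tau_i+d/2},\,t^{3/2}\,\delta_t^{\tau_i+d}\}},\qquad i=1,\dots,m.$$ Then the random vector $(\widetilde L_t^{(\tau_1)},\dots,\widetilde L_t^{(\tau_m)})$ has asymptotic covariance matrix (i.e. its covariance matrix converges, as $t\to\infty$, to) $$\Sigma=\begin{cases}\Sigma^{(1)}&:\ \lim_{t\to\infty}t\delta_t^d=0\\ \Sigma^{(1)}+c\,\Sigma^{(2)}&:\ \lim_{t\to\infty}t\delta_t^d=c\in(0,1]\\ \frac1c\Sigma^{(1)}+\Sigma^{(2)}&:\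 \lim_{t\to\infty}t\delta_t^d=c\in(1,\infty)\\ \Sigma^{(2)}&:\ \lim_{t\to\infty}t\delta_t^d=\infty,\end{cases}$$ where $\Sigma^{(1)}:=V(W)\big(\sigma^{(1)}_{\tau_i\tau_j}\big)_{i,j=1}^m$ and $\Sigma^{(2)}:=V(W)\big(\sigma^{(2)}_{\tau_i\tau_j}\big)_{i,j=1}^m$.
   Context: Fix an integer $d\ge 1$. $W\subset\mathbb{R}^d$ is a compact convex set with volume (Lebesgue measure) $V(W)>0$ and surface area $S(W)$. For $t>0$, $\eta_t$ is a homogeneous Poisson point process in $W$ with intensity $t$ (identified with the random finite set of its points), and $(\delta_t:t>0)$ is a family of positive real numbers with $\delta_t\to0$ as $t\to\infty$. $\eta^2_{t,\neq}$ is the set of ordered pairs of distinct points of $\eta_t$, and $$L^{(\tau)}_t:=\frac12\sum_{(x,y)\in\eta^2_{t,\neq}}\mathbf{1}(\|x-y\|\le\delta_t)\,\|x-y\|^\tau .$$ $\kappa_d$ is the volume of the $d$-dimensional unit ball. For $\tau_i,\tau_j>-d$, $$\sigma^{(1)}_{\tau_i\tau_j}:=\begin{cases}\frac{d\kappa_d}{2|\tau_i+\tau_j+d|}&:\tau_i+\tau_j\ne-d\\ \frac{d\kappa_d}{2}&:\tau_i+\tau_j=-d\end{cases}\qquad\text{and}\qquad \sigma^{(2)}_{\tau_i\tau_j}:=\frac{d^2\kappa_d^2}{(\tau_i+d)(\tau_j+d)}.$$ *)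

(* Defs.v *)
From mathcomp Require Import all_boot all_order all_algebra finmap.
From mathcomp Require Import all_classical all_reals all_analysis.

Set Implicit Arguments.
Unset Strict Implicit.
Unset Printing Implicit Defensive.

Import Order.TTheory GRing.Theory Num.Theory.
Import numFieldNormedType.Exports.

Local Open Scope classical_set_scope.
Local Open Scope ring_scope.

(* The library norm on 'rV[R]_d is the sup norm; its topology is the Euclidean
   one, so [compact] and [open] can be used as they are. *)
Definition enorm (R : realType) (d : nat) (x : 'rV[R]_d) : R :=
  Num.sqrt (\sum_(i < d) x 0 i ^+ 2).

(* d-dimensional Lebesgue measure by Fubini. It is meant to be applied to
   Borel sets only: on other sets the iterated integral carries no meaning. *)
Fixpoint vol (R : realType) (d : nat) : set 'rV[R]_d -> \bar R :=
  match d return set 'rV[R]_d -> \bar R with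
  | 0 => fun A => (\1_A (0 : 'rV[R]_0))%:E
  | d'.+1 => fun A =>
      (\int[@lebesgue_measure R]_x
         vol [set y : 'rV[R]_d' | A (row_mx (x%:M : 'rV[R]_1) y)])%E
  end.

Definition borel (R : realType) (d : nat) (A : set 'rV[R]_d) : Prop :=
  <<s @open 'rV[R]_d >> A.

Definition volume (R : realType) (d : nat) (A : set 'rV[R]_d) : R :=
  fine (vol A).

Definition kappa (R : realType) (d : nat) : R :=
  volume [set x : 'rV[R]_d | enorm x <= 1].

(* Minkowski sum of A and the closed Euclidean ball of radius e *)
Definition parallel_set (R : realType) (d : nat) (A : set 'rV[R]_d) (e : R) :
    set 'rV[R]_d :=
  [set x | exists2 a, A a & enorm (x - a) <= e].

(* Minkowski's definition of the surface area of a convex body: the one-sided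
   derivative at 0 of the volume of its parallel bodies. For d = 1 it gives 2,
   the number of endpoints of the interval. *)
Definition surface_area (R : realType) (d : nat) (A : set 'rV[R]_d) : \bar R :=
  lim (((vol (parallel_set A e) - vol A) * (e^-1)%:E)%E @[e --> 0^'+]).

Definition npoints (R : realType) (d : nat) (X : {fset 'rV[R]_d})
    (A : set 'rV[R]_d) : nat :=
  #|` [fset x in X | x \in A]%fset|.

(* Homogeneous Poisson point process in W of intensity t, as a random finite
   set. The second argument of [poisson_prob] is a dummy; for the rate 0 it is
   the Dirac mass at 0. *)
Definition poisson_process (R : realType) (disp : measure_display)
    (Omega : measurableType disp) (P : probability Omega R) (d : nat)
    (W : set 'rV[R]_d) (t : R) (eta : Omega -> {fset 'rV[R]_d}) : Prop :=
  [/\ forall w x, x \in eta w -> W x,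
      forall A, borel A -> A `<=` W ->
        measurable_fun [set: Omega] (fun w => npoints (eta w) A),
      forall A, borel A -> A `<=` W -> forall U : set nat,
        P [set w | U (npoints (eta w) A)]
        = poisson_prob (t * volume A) 0 U
    & forall (n : nat) (A : 'I_n -> set 'rV[R]_d),
        (forall i, borel (A i) /\ A i `<=` W) ->
        (forall i j, i != j -> A i `&` A j = set0) ->
        forall U : 'I_n -> set nat,
          P [set w | forall i, U i (npoints (eta w) (A i))]
          = (\prod_(i < n) P [set w | U i (npoints (eta w) (A i))])%E].

Definition length_power (R : realType) (d : nat) (delta tau : R)
    (X : {fset 'rV[R]_d}) : R :=
  2^-1 * \sum_(x <- X) \sum_(y <- X | x != y)
           (enorm (x - y) <= delta)%R%:R * enorm (x - y) `^ tau.

Definition sigma1 (R : realType) (d : nat) (tau1 tau2 : R) : R :=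
  if tau1 + tau2 == - d%:R then d%:R * kappa R d / 2
  else d%:R * kappa R d / (2 * `|tau1 + tau2 + d%:R|).

Definition sigma2 (R : realType) (d : nat) (tau1 tau2 : R) : R :=
  (d%:R ^+ 2 * kappa R d ^+ 2) / ((tau1 + d%:R) * (tau2 + d%:R)).

Definition cov_scale (R : realType) (d : nat) (t delta tau1 tau2 : R) : R :=
  sigma1 d tau1 tau2 * t ^+ 2 * delta `^ (tau1 + tau2 + d%:R)
  + sigma2 d tau1 tau2 * t ^+ 3 * delta `^ (tau1 + tau2 + 2 * d%:R).

Definition norm_const (R : realType) (d : nat) (t delta tau : R) : R :=
  Num.max (t * delta `^ (tau + d%:R / 2))
          (t `^ (3 / 2) * delta `^ (tau + d%:R)).

Definition Sigma1 (R : realType) (d : nat) (W : set 'rV[R]_d) (m : nat)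
    (tau : 'I_m -> R) : 'M[R]_m :=
  volume W *: \matrix_(i < m, j < m) sigma1 d (tau i) (tau j).

Definition Sigma2 (R : realType) (d : nat) (W : set 'rV[R]_d) (m : nat)
    (tau : 'I_m -> R) : 'M[R]_m :=
  volume W *: \matrix_(i < m, j < m) sigma2 d (tau i) (tau j).

Definition asymptotic_cov_mx (R : realType) (disp : measure_display)
    (Omega : measurableType disp) (P : probability Omega R) (m : nat)
    (X : R -> 'I_m -> Omega -> R) (S : 'M[R]_m) : Prop :=
  forall i j : 'I_m,
    covariance P (X t i) (X t j) @[t --> +oo%R] --> (S i j)%:E.

(* Main.v *)
Require Import Defs.
From HB Require Import structures.
From mathcomp Require Import all_boot all_order all_algebra finmap.
From mathcomp Require Import all_classical all_reals all_analysis.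
From mathcomp Require Import measurable_realfun.
From mathcomp Require Import ring lra zify.

Set Implicit Arguments.
Unset Strict Implicit.
Unset Printing Implicit Defensive.

Import Order.TTheory GRing.Theory Num.Theory.
Import numFieldNormedType.Exports.

Local Open Scope classical_set_scope.
Local Open Scope ring_scope.

(** The length functional is half the sum, over ordered pairs of distinct points,
    of the kernel [|x - y| `^ tau] truncated at distance [delta]. For a Poisson
    process of intensity [t] two pairs of points contribute to the covariance
    when they share one or two points, so that ([covariance_length_at])

      Cov = t^3 * int_W m1 * m2 + t^2 / 2 * int_W m12,

    where [m1], [m2], [m12] are the integrals over [W] of the kernels with
    exponents [tau1], [tau2], [tau1 + tau2] centred at a point of [W].

    If these kernels were integrated over the whole space, the three functions
    would be constants [d * kappa / (tau + d) * delta `^ (tau + d)]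
    ([ker_intE]), and the covariance would be exactly the volume of [W] times
    the scale of the theorem ([cov_scaleE]). Hence the lower bound 0. The error
    is due to the mass that a kernel centred at [x] in [W] has outside [W]. By
    Tonelli its integral over [x] is the integral over [u] of the kernel at [u]
    times the volume of [exits W u], the set of points of [W] that leave [W]
    under the translation by [u] ([integral_deficit]). If these volumes are at
    most [beta] for [|u| < delta], the relative error of the covariance is at
    most [2 * beta / volume W] ([covariance_bounds]).

    Two bounds on the volume of [exits W u] are used. The first,
    [2 * mes (exits W u) <= |u| * surface_area W] ([exits_surface]), gives the
    inequality of the theorem: the translates of [W] by [v] and by [- v] leave
    [W] in disjoint sets within distance [|v|] of [W] ([two_exits_le]), and
    cutting [u] into many small steps turns this into the derivative of the
    parallel volume, which is the surface area. That this derivative exists, in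
    [[0, +oo]], follows from the log-concavity of the volume
    ([volume_log_concave]), proved by induction on the dimension from the
    one-dimensional Prekopa-Leindler inequality. The second bound,
    [mes (exits W u) <= C * |u|] ([mes_exits_lipschitz]), follows by packing
    disjoint translates of [exits W u] and gives the rate [O(delta)].

    The moments of the Poisson process are obtained by discretisation. With the
    open ball in place of the closed one, which changes the functional only on
    a null set ([cpair_ae]), the kernel is lower semicontinuous, hence an
    increasing limit of kernels that are constant on the products of the cells
    of finer and finer finite partitions. For these the functional is a
    quadratic form in independent Poisson counts, with an explicit second moment
    ([expectation_quadM]), and monotone convergence gives the general formula
    ([expectation_pairsumM]).

    Finally, the scale divided by the two normalising constants is the function
    [(sigma1 + sigma2 * s) / max 1 s] of [s = t * delta ^+ d]
    ([cov_scale_norm]), whose limits are the four cases of the covariance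
    matrix. *)

(** * Monotone convergence *)

(** The limit function is given instead of being the pointwise [limn], which is
    how all the limits below present themselves. *)
Lemma monotone_convergence_cvg d (T : measurableType d) (R : realType)
    (mu : {measure set T -> \bar R}) (D : set T) (g : nat -> T -> \bar R)
    (f : T -> \bar R) : measurable D ->
  (forall n, measurable_fun D (g n)) -> (forall n x, D x -> (0 <= g n x)%E) ->
  (forall x, D x -> {homo g^~ x : n m / (n <= m)%N >-> (n <= m)%E}) ->
  (forall x, D x -> g n x @[n --> \oo] --> f x) ->
  (\int[mu]_(x in D) g n x)%E @[n --> \oo] --> (\int[mu]_(x in D) f x)%E.
Proof.
move=> mD mg g0 ndg gf.
rewrite (_ : (\int[mu]_(x in D) f x)%E = (\int[mu]_(x in D) limn (g^~ x))%E).
  exact: cvg_monotone_convergence.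
by apply: eq_integral => x /[!inE] Dx; apply/esym/cvg_lim => //; exact: gf.
Qed.

(** * Borel sets and Lebesgue measure on row vectors *)

(** Row vectors with their Borel sets as measurable sets, so that the general
    theory of measures and integrals applies to them. *)
Notation mrV R d := (g_sigma_algebraType (@open 'rV[R]_d)).

Lemma measurable_borel (R : realType) d (A : set 'rV[R]_d) :
  borel A = measurable (A : set (mrV R d)).
Proof. by []. Qed.

Lemma open_borel (R : realType) d (A : set 'rV[R]_d) : open A -> borel A.
Proof. exact: sub_sigma_algebra. Qed.

(** Balls with rational centres and radii [1 / (n + 1)]. *)
Lemma rV_countable_base (R : realType) d :
  exists U : nat -> set 'rV[R]_d, (forall n, open (U n)) /\
    forall O x, open O -> O x -> exists2 n, U n x & U n `<=` O.
Proof.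
pose f (k : nat) := if choice.unpickle k is Some (q, n) then
  (ball (map_mx ratr q : 'rV[R]_d) (n.+1%:R^-1 : R))
  else set0.
exists f; split=> [n|O x Oo Ox].
  rewrite /f; case: choice.unpickle => [[q m]|]; last exact: open0.
  exact: ball_open.
have /nbhs_ballP[e /= e0 eO] : nbhs x O by exact: open_nbhs_nbhs.
have [n nE] : exists n : nat, (n.+1%:R^-1 : R) < e / 2.
  have e20 : 0 < e / 2 by rewrite divr_gt0.
  have [N _ NE] := near_infty_natSinv_lt (PosNum e20).
  by exists N; apply: NE => /=.
have n0 : (0 : R) < n.+1%:R^-1 by rewrite invr_gt0.
set v := n.+1%:R^-1 in nE n0.
have qE (i : 'I_d) : exists q : rat, `|ratr q - x 0 i| < v.
  have [|q] := @rat_in_itvoo R (x 0 i - v) (x 0 i + v).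
    by lra.
  rewrite in_itv /= => /andP[q1 q2]; exists q.
  by rewrite ltr_norml; apply/andP; split; lra.
pose q := \row_i (xchoose (qE i)).
have qB : ball (map_mx ratr q : 'rV[R]_d) v x.
  split=> // i j; rewrite !mxE ord1 /ball /=.
  exact: (xchooseP (qE j)).
exists (choice.pickle (q, n)); rewrite /f choice.pickleK//.
move=> y qy; apply: eO.
apply: (@le_ball _ _ _ (v + v)); first lra.
exact: ball_triangle (ball_sym qB) qy.
Qed.

Lemma real_countable_base (R : realType) :
  exists V : nat -> set R, (forall n, open (V n)) /\
    forall O x, open O -> O x -> exists2 n, V n x & V n `<=` O.
Proof.
have [U [Uo UB]] := rV_countable_base R 1.
exists (fun n => [set r : R | U n (r%:M)]); split=> [n|O x Oo Ox].
  have : open ((fun r : R => (r%:M : 'rV[R]_1)) @^-1` U n); last by [].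
  apply: open_comp => // r _.
  move=> A /nbhs_ballP[e /= e0 eA]; apply/nbhs_ballP; exists e => // s rs.
  by apply: eA; split => // i j; rewrite !ord1 !mxE eqxx !mulr1n.
have [||n Un UO] := UB ((fun y : 'rV[R]_1 => y 0 0) @^-1` O) x%:M.
- by apply: open_comp => // y _; exact: coord_continuous.
- by rewrite /= mxE eqxx mulr1n.
exists n => // r /UO /=; by rewrite mxE eqxx mulr1n.
Qed.

(** Both factors are second countable, so a set that contains a rectangle of
    basic sets around each of its points is a countable union of them. *)
Lemma measurable_rectangle_cover d1 d2 (T1 : measurableType d1)
    (T2 : measurableType d2) (U : nat -> set T1) (V : nat -> set T2)
    (A : set (T1 * T2)) :
  (forall n, measurable (U n)) -> (forall n, measurable (V n)) ->
  (forall x y, A (x, y) -> exists n m, [/\ U n x, V m y & U n `*` V m `<=` A]) ->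
  measurable A.
Proof.
move=> mU mV AUV.
rewrite (_ : A = \bigcup_n \bigcup_(m in [set m | U n `*` V m `<=` A])
   (U n `*` V m)); last first.
  apply/seteqP; split=> [[x y] /AUV[n [m [Un Vm UVA]]]|z [n _ [m nmA]]].
    by exists n => //; exists m.
  exact: nmA.
by apply: bigcupT_measurable => n; apply: bigcup_measurable => m _;
  exact: measurableX.
Qed.

Definition cons_rV (R : realType) d (z : R * 'rV[R]_d) : 'rV[R]_d.+1 :=
  row_mx (z.1%:M : 'rV[R]_1) z.2.

Lemma cons_rV_split (R : realType) d (x : 'rV[R]_d.+1) :
  exists a y, x = cons_rV (a, y).
Proof.
exists (x 0 0), (\row_i x 0 (lift 0 i)); apply/rowP => i.
rewrite /cons_rV mxE; case: splitP => [j|k] ik; rewrite !mxE.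
  by rewrite ord1 eqxx mulr1n; congr (x 0 _); apply/val_inj; rewrite /= ik ord1.
by congr (x 0 _); apply/val_inj.
Qed.

Lemma cons_rV0 (R : realType) d (z : R * 'rV[R]_d) : cons_rV z 0 0 = z.1.
Proof.
have -> : (0 : 'I_d.+1) = lshift d (0 : 'I_1) by apply/val_inj.
by rewrite /cons_rV (@row_mxEl _ 1 1 d) mxE eqxx mulr1n.
Qed.

Lemma cons_rVS (R : realType) d (z : R * 'rV[R]_d) i :
  cons_rV z 0 (lift 0 i) = z.2 0 i.
Proof.
have -> : lift 0 i = rshift 1 i by apply/val_inj.
by rewrite /cons_rV (@row_mxEr _ 1 1 d).
Qed.

Lemma ball_cons_rV (R : realType) d (z w : R * 'rV[R]_d) (e : R) : 0 < e ->
  ball z.1 e w.1 -> ball z.2 e w.2 -> ball (cons_rV z) e (cons_rV w).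
Proof.
move=> e0 b1 [_ b2]; split=> // i j; rewrite ord1.
have [k|] := unliftP 0 j.
  by move=> ->; rewrite !cons_rVS; exact: b2.
by move=> ->; rewrite !cons_rV0.
Qed.

(** Being Borel in the product is a matter of rectangles, which a countable base
    provides. *)
Lemma measurable_cons_rV (R : realType) d :
  measurable_fun setT (@cons_rV R d : measurableTypeR R * mrV R d -> mrV R d.+1).
Proof.
apply: (@measurability _ _ _ (mrV R d.+1) _ _ (@open 'rV[R]_d.+1)) => //.
move=> _ [Q Oo <-]; rewrite setTI.
have [U [Uo UB]] := rV_countable_base R d.
have [V [Vo VB]] := real_countable_base R.
apply: (@measurable_rectangle_cover _ _ (measurableTypeR R) (mrV R d) V U) => [n|n|x y /= Oxy].
- exact: open_measurable.
- exact: (@open_borel R d _ (Uo n)).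
have /nbhs_ballP[e /= e0 eO] : nbhs (cons_rV (x, y)) Q by exact: open_nbhs_nbhs.
have [n Vx VBx] := VB _ _ (@ball_open _ _ (x : R^o) e) (ballxx (x : R) e0).
have [m Uy UBy] := UB _ _ (@ball_open _ _ (y : 'rV[R]_d) e) (ballxx (y : 'rV[R]_d) e0).
exists n, m; split=> // -[a b] [/= /VBx xa /UBy yb].
apply: eO; exact: (@ball_cons_rV R d (x, y) (a, b)).
Qed.

Definition cube (R : realType) d (r : R) : set 'rV[R]_d :=
  [set x | forall i, `|x 0 i| < r].
Arguments cube {R} d r.

Lemma cube_ball (R : realType) d (r : R) : 0 < r -> cube d r = ball 0 r.
Proof.
move=> r0; apply/seteqP; split=> x.
  by move=> xr; split => // i j; rewrite ord1 mxE /ball /= sub0r normrN; exact: xr.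
by move=> [_ xr] i; have := xr 0 i; rewrite mxE /ball /= sub0r normrN.
Qed.

Lemma borel_cube (R : realType) d (r : R) : 0 < r -> borel (cube d r).
Proof. by move=> r0; apply: open_borel; rewrite cube_ball//; exact: ball_open. Qed.

Lemma preimage_cons_cube (R : realType) d (r : R) :
  @cons_rV R d @^-1` cube d.+1 r = `]-r, r[%classic `*` cube d r.
Proof.
apply/seteqP; split=> -[a y] /=.
  move=> h; split; first by have := h 0; rewrite cons_rV0 ltr_norml in_itv.
  by move=> i; have := h (lift 0 i); rewrite cons_rVS.
move=> [ar yr] i; have [k ->|->] := unliftP 0 i; first by rewrite cons_rVS; exact: yr.
by move: ar; rewrite cons_rV0 ltr_norml in_itv.
Qed.

Lemma bigcup_cube (R : realType) d : \bigcup_n cube d (n.+1%:R : R) = setT.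
Proof.
apply/seteqP; split=> // x _.
have [n xn] : exists n : nat, `|x| < n%:R.
  by exists (Num.bound `|x|); exact: archi_boundP.
exists n => //; rewrite cube_ball ?ltr0Sn//.
rewrite -ball_normE /= sub0r normrN (lt_le_trans xn)//.
by rewrite ler_nat.
Qed.

Lemma sigma_finite_cube (R : realType) d (m : set (mrV R d) -> \bar R) :
  (forall r, 0 < r -> (m (cube d r) < +oo)%E) -> sigma_finite setT m.
Proof.
move=> mfin; exists (fun n => cube d n.+1%:R); first by rewrite bigcup_cube.
by move=> n; split; [exact: borel_cube|exact: mfin].
Qed.

(** A copy of a measure that carries a proof of its sigma-finiteness, on which
    the corresponding structure can be declared. *)
Definition sigma_finite_copy d (T : measurableType d) (R : realType)
    (m : {measure set T -> \bar R}) of sigma_finite setT m :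
  set T -> \bar R := m.

Section sigma_finite_copy.
Context d (T : measurableType d) (R : realType).
Variables (m : {measure set T -> \bar R}) (sf : sigma_finite setT m).

HB.instance Definition _ := isMeasure.Build _ _ _ (sigma_finite_copy sf)
  (measure0 m) (measure_ge0 m) (@measure_semi_sigma_additive _ _ _ m).
HB.instance Definition _ := Measure_isSigmaFinite.Build _ _ _
  (sigma_finite_copy sf) sf.

End sigma_finite_copy.

(** Induction on the dimension: the image under [cons_rV] of the product of the
    Lebesgue measure of the line and of the measure in dimension [d] is, on
    Borel sets, the iterated integral that defines [vol]. The product requires
    sigma-finiteness, which the finite volumes of the cubes provide. *)
Lemma vol_measure (R : realType) d :
  exists m : {sigma_finite_measure set (mrV R d) -> \bar R},
    (forall A, measurable A -> m A = vol (A : set 'rV[R]_d)) /\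
    (forall r, 0 < r -> (m (cube d r) < +oo)%E).
Proof.
elim: d => [|d [m [mE mfin]]].
  have fin r : 0 < r -> ((@dirac _ (mrV R 0) (0%R : 'rV[R]_0) R) (cube 0%N r) < +oo)%E.
    by rewrite diracE ltry.
  pose s := Measure_isSigmaFinite.Build _ _ _ (@dirac _ (mrV R 0) (0 : 'rV[R]_0) R)
    (sigma_finite_cube fin).
  pose m : {sigma_finite_measure set (mrV R 0) -> \bar R} :=
    HB.pack (@dirac _ (mrV R 0) (0 : 'rV[R]_0) R) s.
  by exists m; split => // A mA; rewrite /= diracE indicE.
pose p := (lebesgue_measure : {sigma_finite_measure set (measurableTypeR R) -> \bar R}).
pose pf := pushforward (p \x m)%E (@cons_rV R d : measurableTypeR R * mrV R d -> mrV R d.+1).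
pose pfm : {measure set (mrV R d.+1) -> \bar R} :=
  measure_function_pushforward__canonical__measure_function_Measure (p \x m)%E (@measurable_cons_rV R d).
have fin r : 0 < r -> (pfm (cube d.+1 r) < +oo)%E.
  move=> r0; rewrite /pfm /= /pushforward preimage_cons_cube.
  rewrite product_measure1E//; last exact: borel_cube.
  rewrite lte_mul_pinfty//; last exact: mfin.
  by rewrite /p/= lebesgue_measure_itv/=; case: ifP => _; rewrite -?EFinD.
have sfin := sigma_finite_cube fin.
exists (sigma_finite_copy sfin); split => //= A mA.
apply: eq_integral => x _ /=.
rewrite mE //.
  congr (vol _); apply/seteqP; split => y; first by move=> /xsectionP.
  by move=> h; apply/xsectionP.
apply: measurable_xsection.
rewrite -[X in measurable X]setTI; exact: measurable_cons_rV.
Qed.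

(** * Lebesgue measure under affine maps *)

(** Lebesgue measure, as a measure on Borel sets. *)
Definition vm (R : realType) d : {sigma_finite_measure set (mrV R d) -> \bar R} :=
  sval (cid (vol_measure R d)).
Arguments vm R d : clear implicits.

Lemma vmE (R : realType) d (A : set 'rV[R]_d) : borel A -> vm R d A = vol A.
Proof. by rewrite /vm; case: cid => m /= [mE _] /mE. Qed.

Lemma vm_cube_lty (R : realType) d (r : R) : 0 < r -> (vm R d (cube d r) < +oo)%E.
Proof. by rewrite /vm; case: cid => m /= [_]; exact. Qed.

Lemma borel_preimage (R : realType) d1 d2 (f : 'rV[R]_d1 -> 'rV[R]_d2) A :
  continuous f -> borel A -> borel (f @^-1` A).
Proof.
move=> cf bA.
have mf : measurable_fun setT (f : mrV R d1 -> mrV R d2).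
  apply: (@measurability _ _ _ (mrV R d2) _ _ (@open 'rV[R]_d2)) => //.
  move=> _ [Q Qo <-]; rewrite setTI; apply: open_borel.
  by apply: open_comp => // x _; exact: cf.
by rewrite measurable_borel -[X in measurable X]setTI; exact: mf.
Qed.

(** The open half-lines generate the Borel sets of the line. The kernels below
    are lower semicontinuous but not continuous. *)
Lemma measurable_fun_open (R : realType) d (D : set 'rV[R]_d) (f : 'rV[R]_d -> R) :
  (forall a, open [set x | a < f x]) ->
  measurable_fun (D : set (mrV R d)) (f : mrV R d -> R).
Proof.
move=> fo; apply: measurable_funS measurableT (@subsetT _ _) _.
apply: (measurability _ (RGenOInfty.measurableE R)).
move=> _ [_ [a ->] <-]; rewrite setTI; apply: open_borel.
by rewrite (_ : _ @^-1` _ = [set x | a < f x])//;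
  apply/seteqP; split=> x; rewrite /= in_itv/= andbT.
Qed.

(** The image of the Lebesgue measure under the affine map is a multiple of it:
    both agree on intervals. *)
Lemma ge0_integral_affine (R : realType) (c b : R) (f : R -> \bar R) : 0 < c ->
  measurable_fun setT (f : measurableTypeR R -> \bar R) ->
  (forall x, (0 <= f x)%E) ->
  (\int[@lebesgue_measure R]_x f (c * x + b)%R
     = c^-1%:E * \int[@lebesgue_measure R]_x f x)%E.
Proof.
move=> c0 mf f0.
pose g : measurableTypeR R -> measurableTypeR R := fun x => c * x + b.
have mg : measurable_fun setT g.
  by apply: measurable_funD => //; apply: measurable_funM.
have ci : 0 <= c^-1 by rewrite invr_ge0 ltW.
pose mu1 := mscale (NngNum ci) (@lebesgue_measure R).
pose mu2 : {measure set (measurableTypeR R) -> \bar R} :=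
  measure_function_pushforward__canonical__measure_function_Measure
    (@lebesgue_measure R) mg.
have E A : measurable A -> mu2 A = mu1 A.
  pose mu3 := mscale (NngNum (ltW c0)) mu2.
  have E3 : lebesgue_measure A = mu3 A -> mu2 A = mu1 A.
    rewrite /mu1 /mu3 /mscale/= => ->; rewrite muleA -EFinM mulVf ?gt_eqF//.
    by rewrite mul1e.
  move=> mA; apply: E3; apply: lebesgue_measure_unique mA => X /ocitvP[->|].
    by rewrite !measure0.
  move=> [[p q] /= pq ->]; rewrite /mu3 /mscale /mu2 /= /pushforward.
  rewrite (_ : g @^-1` _ = `](p - b) / c, (q - b) / c]%classic); last first.
    apply/seteqP; split=> x; rewrite /= !in_itv/= /g ltr_pdivrMr// ler_pdivlMr//;
    by rewrite mulrC ltrBlDr lerBrDr.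
  rewrite !lebesgue_measure_itv/= !lte_fin pq.
  rewrite ltr_pM2r ?invr_gt0// ltrD2r pq -EFinD -EFinD -EFinM; congr (_%:E).
  by field; rewrite gt_eqF.
transitivity (\int[mu2]_x f x)%E.
  by rewrite ge0_integral_pushforward.
transitivity (\int[mu1]_x f x)%E; first by apply: eq_measure_integral => A /E.
by rewrite ge0_integral_mscale.
Qed.

Lemma affine_continuous (R : realType) d (c : R) (u : 'rV[R]_d) :
  continuous (fun x : 'rV[R]_d => c *: x + u).
Proof.
move=> x; apply: (@continuousD _ _ _ (fun x => c *: x) (fun=> u)).
  exact: scaler_continuous.
exact: cst_continuous.
Qed.

Lemma cons_rV_affine (R : realType) d (c x a : R) (y v : 'rV[R]_d) :
  c *: cons_rV (x, y) + cons_rV (a, v) = cons_rV (c * x + a, c *: y + v).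
Proof.
rewrite /cons_rV /= (@scale_row_mx _ 1 1 d) (@add_row_mx _ 1 1 d).
by rewrite scale_scalar_mx -raddfD.
Qed.

Section slices.
Context (R : realType) (d : nat).
Implicit Types (A : set 'rV[R]_d.+1) (x : R).

Definition slice A x : set 'rV[R]_d := [set y | A (cons_rV (x, y))].

Lemma borel_slice A x : borel A -> borel (slice A x).
Proof.
move=> bA; have := @measurable_cons_rV R d measurableT A bA.
rewrite setTI => /(@measurable_xsection _ _ (measurableTypeR R) (mrV R d) _ x).
rewrite measurable_borel; congr measurable; apply/seteqP; split=> y.
  by move=> /xsectionP.
by move=> h; apply/xsectionP.
Qed.

Lemma measurable_vol_slice A : borel A ->
  measurable_fun setT (fun x : measurableTypeR R => vol (slice A x)).
Proof.
move=> bA; have := @measurable_cons_rV R d measurableT A bA; rewrite setTI.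
move=> /(measurable_fun_xsection (vm R d)).
apply: eq_measurable_fun => x _ /=; rewrite -vmE//; last exact: borel_slice.
congr (vm R d _).
by apply/seteqP; split=> y; [move=> /xsectionP|move=> h; apply/xsectionP].
Qed.

End slices.

(** The slices of the preimage are preimages of slices at an affinely moved
    height, so every coordinate contributes one factor [c^-1]. *)
Lemma vol_affine (R : realType) d (c : R) (u : 'rV[R]_d) A : 0 < c -> borel A ->
  vol [set x | A (c *: x + u)] = ((c^-1 ^+ d)%:E * vol A)%E.
Proof.
move=> c0; elim: d u A => [|d IH] u A bA.
  rewrite expr0 mul1e /= !indicE; congr ((nat_of_bool _)%:R%:E).
  by apply/idP/idP; rewrite !inE /= (_ : _ + u = 0)//; apply/rowP => -[].
have [a [v uE]] := cons_rV_split u.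
pose F (x : R) := vol (slice A x).
have sec x : borel (slice A x) by exact: borel_slice.
have mF : measurable_fun setT (F : measurableTypeR R -> _) by exact: measurable_vol_slice.
have F0 x : (0 <= F x)%E by rewrite /F -vmE.
transitivity (\int[@lebesgue_measure R]_x ((c^-1 ^+ d)%:E * F (c * x + a)%R))%E.
  rewrite /=; apply: eq_integral => x _.
  rewrite -(IH v)//; congr vol; apply/seteqP; split=> y /=;
  by rewrite -[row_mx _ y]/(cons_rV (x, y)) uE cons_rV_affine.
rewrite ge0_integralZl//.
- rewrite ge0_integral_affine// muleA; congr (_ * _)%E.
  by rewrite -EFinM exprSr.
- apply: measurableT_comp mF _.
  by apply: measurable_funD => //; apply: measurable_funM.
- by rewrite lee_fin exprn_ge0// invr_ge0 ltW.
Qed.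

(** * The Euclidean norm *)

Section enorm.
Context (R : realType) (d : nat).
Implicit Types (x y : 'rV[R]_d) (c : R).

Lemma enorm_ge0 x : 0 <= enorm x.
Proof. exact: sqrtr_ge0. Qed.

Lemma enorm_sqr x : enorm x ^+ 2 = \sum_(i < d) x 0 i ^+ 2.
Proof. by rewrite sqr_sqrtr// sumr_ge0// => i _; rewrite sqr_ge0. Qed.

Lemma enorm_eq0 x : (enorm x == 0) = (x == 0).
Proof.
apply/idP/eqP => [|->].
  rewrite -sqrf_eq0 enorm_sqr psumr_eq0 => [/allP xi|i _]; last exact: sqr_ge0.
  apply/rowP => i; rewrite mxE; apply/eqP; rewrite -sqrf_eq0.
  by apply: xi; rewrite mem_index_enum.
by rewrite -sqrf_eq0 enorm_sqr big1// => i _; rewrite mxE expr0n.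
Qed.

Lemma enorm0 : enorm (0 : 'rV[R]_d) = 0.
Proof. by apply/eqP; rewrite enorm_eq0. Qed.

Lemma enorm_gt0 x : (0 < enorm x) = (x != 0).
Proof. by rewrite lt0r enorm_ge0 andbT enorm_eq0. Qed.

Lemma enormZ c x : enorm (c *: x) = `|c| * enorm x.
Proof.
rewrite /enorm -sqrtr_sqr -sqrtrM ?sqr_ge0// mulr_sumr; congr Num.sqrt.
by apply: eq_bigr => i _; rewrite mxE exprMn.
Qed.

Lemma enormN x : enorm (- x) = enorm x.
Proof. by rewrite -scaleN1r enormZ normrN1 mul1r. Qed.

Lemma le_coord_enorm x i : `|x 0 i| <= enorm x.
Proof.
rewrite -sqrtr_sqr ler_wsqrtr// (bigD1 i)//= lerDl.
by rewrite sumr_ge0// => j _; rewrite sqr_ge0.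
Qed.

(** Cauchy-Schwarz, from the square of [|y| x - |x| y]. *)
Lemma enorm_dot x y : \sum_(i < d) x 0 i * y 0 i <= enorm x * enorm y.
Proof.
have [x0|xn0] := eqVneq x 0.
  by rewrite big1 ?mulr_ge0 ?enorm_ge0// => i _; rewrite x0 mxE mul0r.
have [y0|yn0] := eqVneq y 0.
  by rewrite big1 ?mulr_ge0 ?enorm_ge0// => i _; rewrite y0 mxE mulr0.
have a0 : 0 < enorm x by rewrite enorm_gt0.
have b0 : 0 < enorm y by rewrite enorm_gt0.
set a := enorm x in a0 *; set b := enorm y in b0 *.
have : 0 <= \sum_(i < d) (b * x 0 i - a * y 0 i) ^+ 2.
  by apply: sumr_ge0 => i _; exact: sqr_ge0.
have -> : \sum_(i < d) (b * x 0 i - a * y 0 i) ^+ 2 =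
    b ^+ 2 * a ^+ 2 + a ^+ 2 * b ^+ 2 - 2 * (a * b) * \sum_(i < d) x 0 i * y 0 i.
  transitivity (b ^+ 2 * (\sum_(i < d) x 0 i ^+ 2) +
      a ^+ 2 * (\sum_(i < d) y 0 i ^+ 2) -
      2 * (a * b) * \sum_(i < d) x 0 i * y 0 i).
    rewrite !mulr_sumr -big_split -sumrB/=; apply: eq_bigr => i _; ring.
  by rewrite -!enorm_sqr.
move=> h; have ab0 : 0 < a * b by exact: mulr_gt0.
rewrite -(ler_pM2l ab0); nra.
Qed.

Lemma enormD x y : enorm (x + y) <= enorm x + enorm y.
Proof.
rewrite -(@ler_pXn2r _ 2) ?nnegrE ?addr_ge0 ?enorm_ge0//.
rewrite sqrrD !enorm_sqr.
rewrite (_ : \sum_(i < d) (x + y) 0 i ^+ 2 = \sum_(i < d) x 0 i ^+ 2 +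
  (\sum_(i < d) x 0 i * y 0 i) *+ 2 + \sum_(i < d) y 0 i ^+ 2).
  by rewrite lerD2r lerD2l lerMn2r enorm_dot orbT.
rewrite -sumrMnl -!big_split /=; apply: eq_bigr => i _.
by rewrite mxE sqrrD.
Qed.

Lemma enorm_continuous : continuous (@enorm R d).
Proof.
move=> x; apply: (@continuous_comp _ _ _ (fun x : 'rV[R]_d => \sum_(i < d) x 0 i ^+ 2));
  last exact: sqrt_continuous.
rewrite /=.
have : forall s : seq 'I_d, {for x, continuous
    (fun x : 'rV[R]_d => \sum_(i <- s) x 0 i ^+ 2 : R)}.
  elim=> [|i s IH].
    rewrite (_ : (fun _ => _) = cst 0); first exact: cst_continuous.
    by apply/funext => y; rewrite big_nil.
  rewrite (_ : (fun _ => _) = (fun y : 'rV[R]_d => y 0 i ^+ 2 +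
    \sum_(i <- s) y 0 i ^+ 2)).
    apply: continuousD => //.
    by apply: (@continuousM _ _ (fun y : 'rV[R]_d => y 0 i)
      (fun y : 'rV[R]_d => y 0 i)); exact: coord_continuous.
  by apply/funext => y; rewrite big_cons.
exact.
Qed.

Lemma le_norm_enorm x : `|x| <= enorm x.
Proof.
rewrite [leLHS]/Num.norm/= mx_normrE; apply: bigmax_le; first exact: enorm_ge0.
by move=> [i j] _ /=; rewrite ord1 le_coord_enorm.
Qed.

End enorm.

(** * Borel sets and compact sets *)

Section borel_sets.
Context (R : realType) (d : nat).
Implicit Types A B W : set 'rV[R]_d.

Lemma borelC A : borel A -> borel (~` A).
Proof. exact: (@measurableC _ (mrV R d)). Qed.

Lemma borelI A B : borel A -> borel B -> borel (A `&` B).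
Proof. exact: (@measurableI _ (mrV R d)). Qed.

Lemma borelU A B : borel A -> borel B -> borel (A `|` B).
Proof. exact: (@measurableU _ (mrV R d)). Qed.

Lemma borelD A B : borel A -> borel B -> borel (A `\` B).
Proof. exact: (@measurableD _ (mrV R d)). Qed.

Lemma closed_borel A : closed A -> borel A.
Proof.
move=> cA; rewrite -(setCK A); apply: borelC; apply: open_borel.
by rewrite openC.
Qed.

Lemma compact_closed_rV A : compact A -> closed A.
Proof. by apply: compact_closed; exact: norm_hausdorff. Qed.

Lemma compact_borel A : compact A -> borel A.
Proof. by move=> /compact_closed_rV; exact: closed_borel. Qed.

Lemma borel_shift A u : borel A -> borel [set x | A (x + u)].
Proof.
move=> bA; rewrite (_ : [set _ | _] = (fun x => 1 *: x + u) @^-1` A).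
  by apply: borel_preimage => //; exact: affine_continuous.
by apply/seteqP; split=> x /=; rewrite scale1r.
Qed.

Lemma vm_shift A u : borel A -> vm R d [set x | A (x + u)] = vm R d A.
Proof.
move=> bA; rewrite vmE; last exact: borel_shift.
rewrite (_ : [set _ | _] = [set x | A (1 *: x + u)]).
  by rewrite vol_affine// invr1 expr1n mul1e vmE.
by apply/seteqP; split=> x /=; rewrite scale1r.
Qed.

Lemma compact_cube A : compact A -> exists2 r, 0 < r & A `<=` cube d r.
Proof.
move=> /compact_bounded[M [_ AM]].
have M2 : 0 < `|M| + 1 + 1 by have := normr_ge0 M; lra.
exists (`|M| + 1 + 1) => // x /(AM (`|M| + 1)) h; rewrite cube_ball//.
rewrite -ball_normE /= sub0r normrN.
have : `|x| <= `|M| + 1 by apply: h; have := ler_norm M; lra.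
by move=> /le_lt_trans; apply; rewrite ltrDl.
Qed.

Lemma vm_sub_lty A B : borel A -> compact B -> A `<=` B -> (vm R d A < +oo)%E.
Proof.
move=> bA /compact_cube[r r0 Br] AB; apply: le_lt_trans (vm_cube_lty d r0).
apply: le_measure; rewrite ?inE//; first exact: borel_cube.
exact: subset_trans Br.
Qed.

Lemma vm_compact_lty A : compact A -> (vm R d A < +oo)%E.
Proof. by move=> cA; exact: (vm_sub_lty (compact_borel cA) cA). Qed.

Lemma volumeE A : compact A -> (volume A)%:E = vm R d A.
Proof.
move=> cA; rewrite /volume -vmE ?fineK//; last exact: compact_borel.
by rewrite ge0_fin_numE//; exact: vm_compact_lty.
Qed.

Lemma closed_enorm_ball r : closed [set x : 'rV[R]_d | enorm x <= r].
Proof.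
rewrite (_ : [set _ | _] = @enorm R d @^-1` [set y | y <= r])//.
by apply: closed_comp => [x _|]; [exact: enorm_continuous|exact: closed_le].
Qed.

Lemma compact_enorm_ball r : compact [set x : 'rV[R]_d | enorm x <= r].
Proof.
apply: bounded_closed_compact; last exact: closed_enorm_ball.
exists r; split; first exact: num_real.
by move=> M rM x /= xr; rewrite (le_trans (le_norm_enorm x))// (le_trans xr)// ltW.
Qed.

Lemma open_enorm_ball r : open [set x : 'rV[R]_d | enorm x < r].
Proof.
rewrite (_ : [set _ | _] = @enorm R d @^-1` [set y | y < r])//.
by apply: open_comp => [x _|]; [exact: enorm_continuous|exact: open_lt].
Qed.

Lemma ge0_integral_rV_affine (c : R) (u : 'rV[R]_d) (f : 'rV[R]_d -> \bar R) :
  0 < c -> measurable_fun setT (f : mrV R d -> \bar R) -> (forall x, (0 <= f x)%E) ->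
  (\int[vm R d]_x f (c *: (x : 'rV[R]_d) + u)%R
     = (c^-1 ^+ d)%:E * \int[vm R d]_x f x)%E.
Proof.
move=> c0 mf f0.
pose g : mrV R d -> mrV R d := fun x => c *: (x : 'rV[R]_d) + u.
have mg : measurable_fun setT g.
  move=> _ B mB; rewrite setTI; apply: borel_preimage => //.
  exact: affine_continuous.
have ci : 0 <= c^-1 ^+ d by rewrite exprn_ge0// invr_ge0 ltW.
pose mu2 : {measure set (mrV R d) -> \bar R} :=
  measure_function_pushforward__canonical__measure_function_Measure
    (vm R d) mg.
transitivity (\int[mu2]_x f x)%E.
  by rewrite ge0_integral_pushforward.
transitivity (\int[mscale (NngNum ci) (vm R d)]_x f x)%E.
  apply: eq_measure_integral => A mA _.
  rewrite -[LHS]/(vm R d (g @^-1` A)) /mscale.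
  rewrite (@vmE R d); last by apply: borel_preimage => //; exact: affine_continuous.
  by rewrite (@vol_affine R d)// -(@vmE R d).
by rewrite ge0_integral_mscale.
Qed.

End borel_sets.

(** * The truncated power kernel *)

(** The summand of the length functionals as a function of the difference of two
    points. The strict inequality and the value 0 at the origin make it lower
    semicontinuous for every exponent. *)
Definition ker (R : realType) d (tau delta : R) (u : 'rV[R]_d) : R :=
  if (u != 0) && (enorm u < delta) then enorm u `^ tau else 0.

Section ker.
Context (R : realType) (d : nat).
Implicit Types (tau delta c h : R) (u : 'rV[R]_d).

Lemma ker_ge0 tau delta u : 0 <= ker tau delta u.
Proof. by rewrite /ker; case: ifP => // _; exact: powR_ge0. Qed.

(** The kernel is continuous on the open set where it is positive. *)
Lemma open_ker tau delta a : open [set u : 'rV[R]_d | a < ker tau delta u].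
Proof.
have [a0|a0] := ltP a 0.
  rewrite (_ : [set _ | _] = setT); first exact: openT.
  by apply/seteqP; split=> // u _ /=; rewrite (lt_le_trans a0)// ker_ge0.
rewrite openE => u /=; rewrite {1}/ker; case: ifPn => [/andP[u0 ud] au|_]; last first.
  by rewrite ltNge a0.
have pu : 0 < enorm u by rewrite enorm_gt0.
have cu : {for u, continuous (fun v : 'rV[R]_d => enorm v `^ tau)}.
  apply: (@continuous_comp _ _ _ (@enorm R d) (fun r => r `^ tau)).
    exact: enorm_continuous.
  apply: differentiable_continuous; apply/derivable1_diffP/derivable_powR.
  by rewrite in_itv /= pu.
rewrite /interior /=.
near=> v.
have v0 : 0 < enorm v.
  near: v; apply: (cvgr_gt (enorm u)) pu; exact: enorm_continuous.
have vd : enorm v < delta.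
  near: v; apply: (cvgr_lt (enorm u)) ud; exact: enorm_continuous.
rewrite /= /ker -(enorm_gt0 v) v0 vd /=.
near: v; exact: (cvgr_gt (enorm u `^ tau)) cu _ au.
Unshelve. all: by end_near. Qed.

Lemma measurable_ker tau delta D :
  measurable_fun (D : set (mrV R d)) (ker tau delta : mrV R d -> R).
Proof. by apply: measurable_fun_open => a; exact: open_ker. Qed.

Lemma kerZ tau delta c u : 0 < c ->
  ker tau delta (c *: u) = c `^ tau * ker tau (delta / c) u.
Proof.
move=> c0; rewrite /ker scaler_eq0 gt_eqF//= enormZ gtr0_norm//.
rewrite ltr_pdivlMr// mulrC; case: ifP => _; last by rewrite mulr0.
by rewrite mulrC powRM// ?enorm_ge0 ?ltW.
Qed.

Definition ker_int tau delta : \bar R := (\int[vm R d]_u (ker tau delta u)%:E)%E.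

Lemma ker_int_ge0 tau delta : (0 <= ker_int tau delta)%E.
Proof. by apply: integral_ge0 => u _; rewrite lee_fin ker_ge0. Qed.

Lemma ker_intZ tau delta : 0 < delta ->
  ker_int tau delta = ((delta `^ (tau + d%:R))%:E * ker_int tau 1)%E.
Proof.
move=> d0.
have d0n : delta^-1 ^+ d * delta `^ (tau + d%:R) = delta `^ tau.
  rewrite powRD ?(gt_eqF d0) ?implybT// powR_mulrn ?(ltW d0)//.
  by rewrite mulrC -mulrA -exprMn mulfV ?gt_eqF// expr1n mulr1.
have h : (\int[vm R d]_x (ker tau delta (delta *: (x : 'rV[R]_d) + 0)%R)%:E =
   ((delta^-1 ^+ d)%:E * ker_int tau delta))%E.
  apply: (@ge0_integral_rV_affine R d delta 0 (fun u => (ker tau delta u)%:E)) => //.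
    by apply/measurable_EFinP; exact: measurable_ker.
  by move=> x; rewrite lee_fin ker_ge0.
have dd0 : 0 < delta ^+ d by rewrite exprn_gt0.
have : ((delta ^+ d)%:E * ((delta^-1 ^+ d)%:E * ker_int tau delta) =
   ker_int tau delta)%E.
  by rewrite muleA -EFinM -exprMn mulfV ?gt_eqF// expr1n mul1e.
move=> <-; rewrite -h.
under eq_integral do rewrite addr0 kerZ// divff ?gt_eqF// EFinM.
rewrite ge0_integralZl ?lee_fin ?powR_ge0//.
- rewrite muleA -EFinM; congr (_%:E * _)%E.
  by rewrite -d0n mulrA -exprMn mulfV ?gt_eqF// expr1n mul1r.
- by apply/measurable_EFinP; exact: measurable_ker.
- by move=> x _; rewrite lee_fin ker_ge0.
Qed.
End ker.

(** * Integral of the truncated power kernel *)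

Section ker_int.
Context (R : realType) (d : nat).
Implicit Types (tau delta c h s r : R) (u : 'rV[R]_d).

Definition oball r : set 'rV[R]_d := [set u | enorm u < r].

Lemma borel_oball r : borel (oball r).
Proof. by apply: open_borel; exact: open_enorm_ball. Qed.

Lemma vm_oball r : 0 < r -> vm R d (oball r) = ((r ^+ d)%:E * vm R d (oball 1))%E.
Proof.
move=> r0; have ri0 : 0 < r^-1 by rewrite invr_gt0.
have -> : oball r = [set u | oball 1 (r^-1 *: u + 0)].
  apply/seteqP; split=> u;
  by rewrite /oball /= addr0 enormZ gtr0_norm// ltr_pdivrMl// mulr1.
have bo : borel (oball 1) by exact: borel_oball.
rewrite (@vmE R d); last first.
  apply: (@borel_preimage R d d (fun x => r^-1 *: x + 0) (oball 1)).
    exact: affine_continuous.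
  exact: bo.
by rewrite vol_affine// invrK vmE.
Qed.

Lemma vm_oball_lty r : (vm R d (oball r) < +oo)%E.
Proof.
have sub : oball r `<=` [set u | enorm u <= r] by move=> u /=; exact: ltW.
exact: (vm_sub_lty (borel_oball r) (@compact_enorm_ball R d r) sub).
Qed.

(** The closed ball lies in the open balls of radius [r > 1], whose volumes are
    [r ^+ d] times the volume of the open unit ball; let [r] tend to 1. *)
Lemma kappaE : (kappa R d)%:E = vm R d (oball 1).
Proof.
rewrite volumeE; last exact: compact_enorm_ball.
have bB : borel [set u : 'rV[R]_d | enorm u <= 1].
  by apply: closed_borel; exact: closed_enorm_ball.
apply/eqP; rewrite eq_le; apply/andP; split; last first.
  by apply: le_measure; rewrite ?inE//; [exact: borel_oball|move=> u /ltW].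
have fo : vm R d (oball 1) \is a fin_num.
  by rewrite ge0_fin_numE//; exact: vm_oball_lty.
have fB : vm R d [set u : 'rV[R]_d | enorm u <= 1] \is a fin_num.
  by rewrite ge0_fin_numE//; apply: vm_compact_lty; exact: compact_enorm_ball.
have le r : 1 < r ->
  fine (vm R d [set u : 'rV[R]_d | enorm u <= 1]) <= r ^+ d * fine (vm R d (oball 1)).
  move=> r1; rewrite -lee_fin EFinM !fineK// -vm_oball ?(lt_trans ltr01)//.
  apply: le_measure; rewrite ?inE//; first exact: borel_oball.
  by move=> u /= u1; exact: le_lt_trans r1.
rewrite -(fineK fo) -(fineK fB) lee_fin.
set a := fine _ in le *; set b := fine _ in le *.
have : (fun r => r ^+ d * b) x @[x --> 1^'+] --> 1 ^+ d * b.
  apply: cvgMr_tmp; apply: cvg_at_right_filter; exact: exprn_continuous.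
rewrite expr1n mul1r => /cvgr_to_ge; apply.
by near=> r; apply: le; near: r; exact: nbhs_right_gt.
Unshelve. all: by end_near. Qed.

(** The part of the integral that comes from the annulus [s <= |u| < 1]. *)
Definition shell tau s : \bar R :=
  (\int[vm R d]_u (ker tau 1 (u : 'rV[R]_d) * \1_[set u | (s <= enorm u)%R] u)%:E)%E.

Lemma measurable_far s : measurable ([set u : 'rV[R]_d | s <= enorm u] : set (mrV R d)).
Proof.
rewrite -measurable_borel.
rewrite (_ : [set _ | _] = ~` oball s); first by apply: borelC; exact: borel_oball.
apply/seteqP; split=> u; rewrite /oball /=; last by move/negP; rewrite -leNgt.
by move=> su; apply/negP; rewrite -leNgt.
Qed.

Lemma measurable_ker_far tau s :
  measurable_fun setT (fun u : mrV R d =>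
    (ker tau 1 (u : 'rV[R]_d) * \1_[set u | (s <= enorm u)%R] u)%:E).
Proof.
apply/measurable_EFinP; apply: measurable_funM; first exact: measurable_ker.
by apply: measurable_indic; exact: measurable_far.
Qed.

Lemma ker_far_ge0 tau s u : 0 <= ker tau 1 u * \1_[set u | s <= enorm u] u.
Proof. by rewrite mulr_ge0// ker_ge0. Qed.

Lemma ker_split tau s u : 0 < s < 1 ->
  ker tau 1 u = ker tau 1 u * \1_[set u | s <= enorm u] u + ker tau s u.
Proof.
move=> /andP[s0 s1]; rewrite indicE /ker.
have [->|u0] := eqVneq u 0; first by rewrite mul0r addr0.
rewrite /=; have [su|us] := leP s (enorm u).
  by rewrite mem_set//= mulr1 addr0.
by rewrite memNset/= ?mulr0 ?add0r ?(lt_trans us s1)//; apply/negP; rewrite -ltNge.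
Qed.

(** The part of the integral inside radius [s] is a scaled copy of the whole. *)
Lemma shell_recursion tau s : 0 < s < 1 ->
  ker_int d tau 1 = (shell tau s + (s `^ (tau + d%:R))%:E * ker_int d tau 1)%E.
Proof.
move=> s01; have /andP[s0 _] := s01.
rewrite -[in RHS]ker_intZ// /ker_int /shell -ge0_integralD//.
- by apply: eq_integral => u _; rewrite -EFinD -ker_split.
- by move=> u _; rewrite lee_fin ker_far_ge0.
- exact: measurable_ker_far.
- by move=> u _; rewrite lee_fin ker_ge0.
- by apply/measurable_EFinP; exact: measurable_ker.
Qed.

Lemma vm_oballD s : 0 < s < 1 ->
  vm R d (oball 1 `\` oball s) = (kappa R d * (1 - s ^+ d))%:E.
Proof.
move=> /andP[s0 s1]; transitivity (vm R d (oball 1) - vm R d (oball s))%E.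
  rewrite measureD//; last 3 first.
  - exact: borel_oball.
  - exact: borel_oball.
  - exact: vm_oball_lty.
  by rewrite setIC setIidl// => u /= /lt_trans; apply.
rewrite (vm_oball s0) -kappaE -EFinM -EFinB; congr (_%:E); ring.
Qed.

(** The power [|u| `^ tau] differs from 1 by a factor of at most
    [expR (h * `|tau|)] on the thin annulus [expR (- h) <= |u| < 1]. *)
Lemma shell_bounds tau h : 0 < h ->
  ((expR (- (h * `|tau|)) * (kappa R d * (1 - expR (- h) ^+ d)))%:E <= shell tau (expR (- h))
   <= (expR (h * `|tau|) * (kappa R d * (1 - expR (- h) ^+ d)))%:E)%E.
Proof.
move=> h0; have s01 : 0 < expR (- h) < 1 by rewrite expR_gt0 expR_lt1 oppr_lt0.
have mA : measurable (oball 1 `\` oball (expR (- h)) : set (mrV R d)).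
  by apply: borelD; exact: borel_oball.
have E c : 0 <= c -> ((c * (kappa R d * (1 - expR (- h) ^+ d)))%:E =
    \int[vm R d]_u (c * \1_(oball 1 `\` oball (expR (- h))) u)%:E)%E.
  move=> c0; under eq_integral do rewrite EFinM.
  rewrite ge0_integralZl//.
    by rewrite integral_indic// setIT EFinM -vm_oballD.
  by apply/measurable_EFinP; exact: measurable_indic.
have key u : \1_(oball 1 `\` oball (expR (- h))) u * expR (- (h * `|tau|)) <=
    ker tau 1 u * \1_[set u | expR (- h) <= enorm u] u <=
    \1_(oball 1 `\` oball (expR (- h))) u * expR (h * `|tau|).
  rewrite !indicE /ker; have [u1|u1] := ltP (enorm u) 1; last first.
    rewrite andbF mul0r memNset ?mul0r ?lexx// => -[/=].
    by rewrite /oball /= ltNge u1.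
  have [su|su] := leP (expR (- h)) (enorm u); last first.
    rewrite !memNset ?mulr0 ?mul0r ?lexx//=; first by apply/negP; rewrite -ltNge.
    by move=> [_]; apply.
  have u0 : 0 < enorm u by rewrite (lt_le_trans _ su)// expR_gt0.
  rewrite -enorm_gt0 u0 /= !mem_set//; last first.
    by split => //; apply/negP; rewrite -leNgt.
  rewrite mulr1 !mul1r /powR gt_eqF// !ler_expR.
  have l0 : ln (enorm u) <= 0 by rewrite ln_le0// ltW.
  have l1 : - h <= ln (enorm u) by rewrite -(expRK (- h)) ler_ln// posrE ?expR_gt0.
  have : `|tau * ln (enorm u)| <= h * `|tau|.
    rewrite normrM mulrC ler_wpM2r//; rewrite ler_norml l1 /= (le_trans l0)// ltW//.
  by rewrite ler_norml.
have m c : measurable_fun setT (fun u : mrV R d =>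
    (c * \1_(oball 1 `\` oball (expR (- h))) u)%:E).
  apply/measurable_EFinP; apply: measurable_funM; first exact: measurable_cst.
  exact: measurable_indic.
rewrite !E ?expR_ge0//; apply/andP; split; apply: ge0_le_integral => //.
- exact: measurable_ker_far.
- by move=> u _; rewrite lee_fin mulrC; case/andP: (key u).
- by move=> u _; rewrite lee_fin ker_far_ge0.
- exact: measurable_ker_far.
- by move=> u _; rewrite lee_fin [leRHS]mulrC; case/andP: (key u).
Qed.

Lemma shell_lty tau s : 0 < s < 1 -> (shell tau s < +oo)%E.
Proof.
move=> /andP[s0 s1]; have h0 : 0 < - ln s by rewrite oppr_gt0 ln_lt0// s0.
have := shell_bounds tau h0; rewrite opprK lnK ?posrE// => /andP[_].
by move=> /le_lt_trans; apply; rewrite ltry.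
Qed.

(** The integrals [T n] cut off at radius [s ^+ n] satisfy
    [T (n + 1) = shell + s `^ (tau + d) * T n], so they stay below the fixed point
    [M] of this recursion. *)
Lemma ker_int_lty tau : - d%:R < tau -> (ker_int d tau 1 < +oo)%E.
Proof.
move=> taud; pose a := tau + d%:R; have a0 : 0 < a by rewrite /a; lra.
pose s : R := 2^-1; have s01 : 0 < s < 1 by rewrite /s; lra.
have /andP[s0 s1] := s01.
have sa : 0 < s `^ a < 1.
  rewrite powR_gt0//=; have := gt0_ltr_powR a0 _ _ s1.
  by rewrite powR1; apply; rewrite nnegrE// ltW.
have shf : shell tau s \is a fin_num.
  rewrite ge0_fin_numE; first exact: shell_lty.
  by apply: integral_ge0 => u _; rewrite lee_fin ker_far_ge0.
pose M := fine (shell tau s) / (1 - s `^ a).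
pose far n (u : 'rV[R]_d) := (ker tau 1 u * \1_[set u | s ^+ n <= enorm u] u)%:E.
have far0 n u : (0 <= far n u)%E by rewrite lee_fin ker_far_ge0.
have mfar n : measurable_fun setT (far n : mrV R d -> \bar R).
  exact: measurable_ker_far.
have mfar_affine n : measurable_fun setT
    (fun u : mrV R d => far n (s^-1 *: (u : 'rV[R]_d) + 0)).
  apply: (measurableT_comp (mfar n)) => _ B mB; rewrite setTI.
  by apply: (@borel_preimage R d d) => //; exact: affine_continuous.
have si : 0 < s^-1 by rewrite invr_gt0.
have step n u : far n.+1 u = ((ker tau 1 u * \1_[set u | s <= enorm u] u)%:E +
   (s `^ tau)%:E * far n (s^-1 *: u + 0)%R)%E.
  rewrite /far -EFinM -EFinD; congr (_%:E).
  have -> : s `^ tau * (ker tau 1 (s^-1 *: u + 0) *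
      \1_[set u | s ^+ n <= enorm u] (s^-1 *: u + 0)) =
      ker tau s u * \1_[set u | s ^+ n.+1 <= enorm u] u.
    have -> : ker tau s u = s `^ tau * ker tau 1 (s^-1 *: u).
      by rewrite -{1}(scalerKV (lt0r_neq0 s0) u) kerZ// divff// gt_eqF.
    rewrite addr0 mulrA; congr (_ * _); rewrite !indicE; congr ((nat_of_bool _)%:R).
    apply/idP/idP; rewrite !inE /= enormZ gtr0_norm// ler_pdivlMl//;
    by rewrite exprS.
  rewrite {1}(ker_split tau u s01) mulrDl -mulrA; congr (_ * _ + _).
    rewrite !indicE; have [su|su] := leP s (enorm u).
      have su' : s ^+ n.+1 <= enorm u.
        by rewrite (le_trans _ su)// -[leRHS]expr1 ler_wiXn2l// ltW.
      rewrite !mem_set//=.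
      by rewrite mulr1.
    by rewrite memNset/= ?mul0r//; apply/negP; rewrite -ltNge.
have T n : (\int[vm R d]_u far n u <= M%:E)%E.
  have M0 : 0 <= M.
    by rewrite divr_ge0//; [apply: fine_ge0; apply: integral_ge0 => u _;
      rewrite lee_fin ker_far_ge0|rewrite subr_ge0 ltW//; case/andP: sa].
  elim: n => [|n IH].
    rewrite integral0_eq// => u _; rewrite /far expr0 indicE /ker.
    have [u1|u1] := ltP (enorm u) 1; last by rewrite andbF mul0r.
    by rewrite memNset/= ?mulr0//; apply/negP; rewrite -ltNge.
  under eq_integral do rewrite step.
  rewrite ge0_integralD//; last 4 first.
  - by move=> u _; rewrite lee_fin ker_far_ge0.
  - exact: measurable_ker_far.
  - by move=> u _; rewrite mule_ge0// lee_fin powR_ge0.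
  - exact: measurable_funeM.
  rewrite -/(shell tau s) ge0_integralZl//; last by rewrite lee_fin powR_ge0.
  rewrite ge0_integral_rV_affine// invrK muleA -EFinM.
  rewrite -powR_mulrn ?(ltW s0)// -powRD ?(gt_eqF s0) ?implybT//.
  apply: (@le_trans _ _ (shell tau s + (s `^ a)%:E * M%:E)%E).
    by rewrite leeD2l// lee_wpmul2l// lee_fin powR_ge0.
  rewrite -(fineK shf) -EFinM -EFinD lee_fin /M.
  rewrite le_eqVlt; apply/orP; left; apply/eqP; field.
  by have /andP[_ ?] := sa; rewrite gt_eqF// subr_gt0.
have cv : (\int[vm R d]_u far n u)%E @[n --> \oo] --> ker_int d tau 1.
  have sn1 n m : (n <= m)%N -> s ^+ m <= s ^+ n.
    by move=> nm; rewrite ler_wiXn2l// ltW.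
  apply: monotone_convergence_cvg => // [u _ n m nm|u _].
    rewrite lee_fin ler_wpM2l ?ker_ge0// !indicE ler_nat.
    have [su|su] := leP (s ^+ n) (enorm u); last by rewrite memNset//= leNgt su.
    by rewrite !mem_set//= (le_trans _ su)// sn1.
  have [->|u0] := eqVneq u 0.
    rewrite (_ : (fun n => _) = cst 0%E); last first.
      by apply/funext => n; rewrite /far /ker eqxx mul0r.
    by rewrite /ker eqxx; exact: cvg_cst.
  have [N _ NE] : \forall n \near \oo, s ^+ n < enorm u.
    have := @cvg_expr R s; rewrite ger0_norm ?(ltW s0)// => /(_ s1).
    by move=> /cvgr_lt; apply; rewrite enorm_gt0.
  apply: cvg_near_cst; exists N => // n /NE sn; rewrite /far indicE.
  by rewrite mem_set/= ?mulr1// ltW.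
by apply: le_lt_trans (ltry M); apply: (cvge_to_le cv); exact: nearW.
Qed.

(** Peeling off one annulus of ratio [expR (- h)] expresses the integral through
    the volume of that annulus, up to factors that tend to 1 with [h]. This
    replaces polar coordinates. *)
Lemma ker_intE tau delta : - d%:R < tau -> 0 < delta ->
  ker_int d tau delta =
    (d%:R * kappa R d / (tau + d%:R) * delta `^ (tau + d%:R))%:E.
Proof.
move=> taud d0; rewrite ker_intZ// muleC EFinM; congr (_ * _)%E.
pose a := tau + d%:R; have a0 : 0 < a by rewrite /a; lra.
have If : ker_int d tau 1 \is a fin_num.
  by rewrite ge0_fin_numE ?ker_int_ge0// ker_int_lty.
rewrite -(fineK If); congr (_%:E); set I := fine _.
have k0 : 0 <= kappa R d by rewrite -lee_fin kappaE.
have I0 : 0 <= I by apply: fine_ge0; exact: ker_int_ge0.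
suff /eqP IE : I * a == d%:R * kappa R d by rewrite -IE -/a mulfK// gt_eqF.
have ex (p : R) : 1 - expR (- p) <= p by have := expR_ge1Dx (- p); lra.
have ex' (p : R) : p * expR (- p) <= 1 - expR (- p).
  have := expR_ge1Dx p; have := expR_gt0 (- p).
  have : expR p * expR (- p) = 1 by rewrite -expRD subrr expR0.
  nra.
have rec h : 0 < h ->
   expR (- (h * `|tau|)) * (kappa R d * (1 - expR (- (h * d%:R)))) <=
     I * (1 - expR (- (h * a))) <=
   expR (h * `|tau|) * (kappa R d * (1 - expR (- (h * d%:R)))).
  move=> h0; have s01 : 0 < expR (- h) < 1 by rewrite expR_gt0 expR_lt1 oppr_lt0.
  have shE : shell tau (expR (- h)) = (I * (1 - expR (- (h * a))))%:E.
    have shf : shell tau (expR (- h)) \is a fin_num.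
      rewrite ge0_fin_numE; first exact: shell_lty.
      by apply: integral_ge0 => u _; rewrite lee_fin ker_far_ge0.
    have := shell_recursion tau s01; rewrite -(fineK If) -/I -(fineK shf).
    rewrite -EFinM -EFinD => -[]; rewrite -/a /powR gt_eqF ?expR_gt0// expRK.
    by move=> IE; congr (_%:E); rewrite (_ : - (h * a) = a * - h); [lra|ring].
  have := shell_bounds tau h0; rewrite shE !lee_fin.
  have -> : expR (- h) ^+ d = expR (- (h * d%:R)).
    by rewrite -expRM_natr; congr expR; ring.
  by [].
(* The two sides of [rec], divided by [h], give [I * a] and [d * kappa] up to
   factors [expR (- (h * C))], which disappear as [h] tends to 0. *)
have lim (A B C : R) : 0 <= A -> 0 <= C ->
    (forall h, 0 < h -> A * expR (- (h * C)) <= B) -> A <= B.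
  move=> A0 C0 AB; apply/ler_addgt0Pr => e e0.
  pose h := e / (A * C + 1); have AC1 : 0 < A * C + 1 by rewrite ltr_wpDl ?mulr_ge0.
  have h0 : 0 < h by rewrite divr_gt0.
  have := AB _ h0; have := expR_ge1Dx (- (h * C)) => e1 e2.
  have : A * (1 + - (h * C)) <= B by apply: le_trans e2; exact: ler_wpM2l.
  have : A * (h * C) <= e.
    rewrite (_ : A * (h * C) = e * ((A * C) / (A * C + 1))); last by rewrite /h; field; rewrite gt_eqF.
    by rewrite ler_piMr ?(ltW e0)// ler_pdivrMr// mul1r lerDl.
  lra.
have d0' : 0 <= (d%:R : R) by rewrite ler0n.
rewrite eq_le; apply/andP; split.
- apply: (lim _ _ (a + `|tau|)); first by rewrite mulr_ge0// ltW.
    by rewrite addr_ge0// ltW.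
  move=> h h0; have /andP[_ r2] := rec _ h0.
  have e1 : I * (h * a * expR (- (h * a))) <= I * (1 - expR (- (h * a))).
    by rewrite ler_wpM2l.
  have e2 : expR (h * `|tau|) * (kappa R d * (1 - expR (- (h * d%:R)))) <=
      expR (h * `|tau|) * (kappa R d * (h * d%:R)).
    by rewrite ler_wpM2l ?expR_ge0// ler_wpM2l.
  have e3 := le_trans e1 (le_trans r2 e2).
  rewrite -(ler_pM2l h0) -(ler_pM2l (expR_gt0 (h * `|tau|))).
  rewrite (_ : - (h * (a + `|tau|)) = - (h * a) - h * `|tau|); last ring.
  rewrite expRD.
  have ee : expR (h * `|tau|) * expR (- (h * `|tau|)) = 1.
    by rewrite -expRD subrr expR0.
  rewrite (_ : _ * (h * (I * a * _)) = I * (h * a * expR (- (h * a))) *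
     (expR (h * `|tau|) * expR (- (h * `|tau|)))); last ring.
  by rewrite ee mulr1 (le_trans e3)// le_eqVlt; apply/orP; left; apply/eqP; ring.
- apply: (lim _ _ (d%:R + `|tau|)); first by rewrite mulr_ge0.
    by rewrite addr_ge0.
  move=> h h0; have /andP[r1 _] := rec _ h0.
  have e1 : I * (1 - expR (- (h * a))) <= I * (h * a) by rewrite ler_wpM2l.
  have e2 : expR (- (h * `|tau|)) * (kappa R d * (h * d%:R * expR (- (h * d%:R)))) <=
     expR (- (h * `|tau|)) * (kappa R d * (1 - expR (- (h * d%:R)))).
    by rewrite ler_wpM2l ?expR_ge0// ler_wpM2l.
  have e3 := le_trans e2 (le_trans r1 e1).
  rewrite -(ler_pM2l h0).
  rewrite (_ : - (h * (d%:R + `|tau|)) = - (h * `|tau|) - h * d%:R); last ring.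
  rewrite expRD (le_trans _ (le_trans e3 _))//; rewrite le_eqVlt; apply/orP; left; apply/eqP; ring.
Qed.

End ker_int.

(** * The one-dimensional Prekopa-Leindler inequality *)

(** One-dimensional Brunn-Minkowski inequality for intervals. An interval contains
    every point strictly between its endpoints, so [C] contains the open interval
    between the combinations [p] of the lower and [q] of the upper endpoints. *)
Lemma lebesgue_convex_comb (R : realType) (I J C : set R) (l : R) : 0 < l < 1 ->
  is_interval I -> is_interval J -> I !=set0 -> J !=set0 ->
  has_ubound I -> has_lbound I -> has_ubound J -> has_lbound J ->
  measurable C ->
  (forall x y, I x -> J y -> C ((1 - l) * x + l * y)) ->
  ((1 - l)%:E * lebesgue_measure I + l%:E * lebesgue_measure J <=
     @lebesgue_measure R C)%E.
Proof.
move=> /andP[l0 l1] itvI itvJ I0 J0 uI lI uJ lJ mC IJC.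
have l1' : 0 < 1 - l by lra.
have mI := is_interval_measurable itvI; have mJ := is_interval_measurable itvJ.
have inf_sup (K : set R) : K !=set0 -> has_ubound K -> has_lbound K -> inf K <= sup K.
  by move=> [x Kx] uK lK; rewrite (@le_trans _ _ x)//; [exact: ge_inf|exact: ub_le_sup].
have len (K : set R) : is_interval K -> K !=set0 -> has_ubound K -> has_lbound K ->
    (lebesgue_measure K <= (sup K - inf K)%:E)%E.
  move=> iK K0 uK lK; have := inf_sup K K0 uK lK => le.
  apply: (@le_trans _ _ (lebesgue_measure `[inf K, sup K]%classic)).
    apply: le_measure; rewrite ?inE//; first exact: is_interval_measurable.
    by move=> x Kx; rewrite /= in_itv/= ge_inf//= ub_le_sup.
  rewrite lebesgue_measure_itv/= lte_fin; case: ifPn => // _.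
  by rewrite lee_fin subr_ge0.
have pt (K : set R) th : is_interval K -> K !=set0 -> has_ubound K -> has_lbound K ->
    0 < th < 1 -> K (inf K + th * (sup K - inf K)).
  move=> iK K0 uK lK /andP[t0 t1]; have := inf_sup K K0 uK lK.
  rewrite le_eqVlt => /orP[/eqP e|lt].
    have [x Kx] := K0; rewrite e subrr mulr0 addr0.
    rewrite (_ : sup K = x)//; apply/eqP; rewrite eq_le.
    by rewrite -{1}e ge_inf//= ub_le_sup.
  set z := _ + _.
  have [y Ky yz] : exists2 y, K y & y < z.
    have /inf_lt [//|y Ky yz] : inf K < z.
      by rewrite /z ltrDl mulr_gt0// subr_gt0.
    by exists y.
  have [w Kw zw] : exists2 w, K w & z < w.
    have /sup_gt [//|w Kw zw] : z < sup K by rewrite /z; nra.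
    by exists w.
  by apply: (iK y w) => //; rewrite !ltW.
set a := inf I; set b := sup I; set c := inf J; set e := sup J.
have ab : a <= b by exact: inf_sup.
have ce : c <= e by exact: inf_sup.
pose p := (1 - l) * a + l * c; pose q := (1 - l) * b + l * e.
have pq : p <= q by rewrite /p /q lerD// ler_wpM2l// ltW.
apply: (@le_trans _ _ ((1 - l)%:E * (b - a)%:E + l%:E * (e - c)%:E)%E).
  by apply: leeD; apply: lee_wpmul2l; rewrite ?lee_fin ?(ltW l0) ?(ltW l1')//; exact: len.
rewrite -!EFinM -EFinD (_ : (1 - l) * (b - a) + l * (e - c) = q - p); last by rewrite /p /q; ring.
apply: (@le_trans _ _ (lebesgue_measure `]p, q[%classic)).
  rewrite lebesgue_measure_itv/= lte_fin; case: ifPn => //.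
  by rewrite -leNgt => qp; rewrite lee_fin subr_le0.
apply: le_measure; rewrite ?inE// => z; rewrite /= in_itv/= => /andP[pz zq].
have qp0 : 0 < q - p by lra.
pose th := (z - p) / (q - p).
have th01 : 0 < th < 1.
  by apply/andP; split; [rewrite divr_gt0// subr_gt0|rewrite ltr_pdivrMr// mul1r ltrD2r].
have -> : z = (1 - l) * (a + th * (b - a)) + l * (c + th * (e - c)).
  have -> : (1 - l) * (a + th * (b - a)) + l * (c + th * (e - c)) =
    p + th * (q - p) by rewrite /p /q; ring.
  by rewrite /th divfK ?gt_eqF//; ring.
by apply: IJC; exact: pt.
Qed.

(** Layer-cake formula, cut at height 1: Tonelli for the region below the graph. *)
Lemma integral_superlevel (R : realType) (h : R -> R) :
  measurable_fun setT (h : measurableTypeR R -> R) -> (forall x, 0 <= h x) ->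
  (\int[@lebesgue_measure R]_(s in `]0%R, 1%R[) lebesgue_measure [set x | (s < h x)%R]
     = \int[@lebesgue_measure R]_x (Num.min 1%R (h x))%:E)%E.
Proof.
move=> mh h0; pose T := measurableTypeR R.
pose S : set (T * T) := [set z | 0 < z.1 < 1 /\ z.1 < h z.2].
have mS : measurable S.
  pose f1 (p : T * T) := (0 < p.1)%R; pose f2 (p : T * T) := (p.1 < 1)%R.
  pose f3 (p : T * T) := (p.1 < h p.2)%R.
  rewrite (_ : S = f1 @^-1` [set true] `&` f2 @^-1` [set true] `&` f3 @^-1` [set true]).
    have m f : measurable_fun setT (f : T * T -> bool) -> measurable (f @^-1` [set true]).
      by move=> /(_ measurableT [set true]); rewrite setTI; exact.
    apply: measurableI; [apply: measurableI|]; apply: m.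
    - exact: measurable_fun_ltr.
    - exact: measurable_fun_ltr.
    - apply: measurable_fun_ltr => //; exact: measurableT_comp.
  apply/seteqP; split=> -[s x]; rewrite /S /f1 /f2 /f3 /=.
    by move=> [/andP[-> ->] ->].
  by move=> [[-> ->] ->].
have mls s : measurable ([set x | s < h x] : set T).
  have := mh measurableT `]s, +oo[%classic (measurable_itv _).
  by rewrite setTI; congr measurable; apply/seteqP; split=> x; rewrite /= in_itv/= andbT.
transitivity (\int[@lebesgue_measure R]_s \int[@lebesgue_measure R]_x (\1_S (s, x))%:E)%E.
  rewrite integral_mkcond; apply: eq_integral => s _; rewrite patchE.
  case: ifPn => [|]; rewrite ?inE ?notin_setE /= in_itv/= => s01.
    transitivity (\int[@lebesgue_measure R]_x (\1_[set x | (s < h x)%R] x)%:E)%E.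
      by rewrite integral_indic//= setIT.
    apply: eq_integral => x _; rewrite !indicE; congr ((nat_of_bool _)%:R%:E).
    apply/idP/idP; rewrite !inE /S /=; last by case.
    by move=> sh; split.
  rewrite integral0_eq// => x _; rewrite indicE memNset//= => -[/= h' _].
  exact: s01.
rewrite (@fubini_tonelli _ _ T T _ lebesgue_measure lebesgue_measure
  (fun z => (\1_S z)%:E)) /=.
- apply: eq_integral => x _.
  transitivity (\int[@lebesgue_measure R]_s (\1_`]0%R, (Num.min 1%R (h x))[ s)%:E)%E.
    apply: eq_integral => s _; rewrite !indicE; congr ((nat_of_bool _)%:R%:E).
    apply/idP/idP; rewrite !inE /S /= in_itv/= lt_min.
      by move=> [/andP[-> ->] ->].
    by move=> /and3P[-> -> ->].
  rewrite integral_indic//= setIT lebesgue_measure_itv/= lte_fin.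
  case: ifPn; first by rewrite oppr0 adde0.
  by rewrite -leNgt => m0; congr EFin; apply/eqP; rewrite eq_le m0 le_min ler01 h0.
- by apply/measurable_EFinP; exact: measurable_indic.
- by move=> z; rewrite lee_fin.
Qed.

Lemma measurable_superlevel (R : realType) (h : R -> R) D :
  measurable_fun setT (h : measurableTypeR R -> R) ->
  measurable_fun D (fun s : measurableTypeR R => @lebesgue_measure R [set x | (s < h x)%R]).
Proof.
move=> mh; pose T := measurableTypeR R.
apply: measurable_funS measurableT (@subsetT _ _) _.
pose S : set (T * T) := [set z | z.1 < h z.2].
have mS : measurable S.
  pose f3 (p : T * T) := (p.1 < h p.2)%R.
  have : measurable_fun setT f3.
    by apply: measurable_fun_ltr => //; exact: measurableT_comp.
  by move=> /(_ measurableT [set true]); rewrite setTI; exact.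
apply: eq_measurable_fun (measurable_fun_xsection (@lebesgue_measure R) mS) => s _ /=.
by congr lebesgue_measure; apply/seteqP; split=> x;
  [move=> /xsectionP|move=> h'; apply/xsectionP].
Qed.

Lemma weighted_amgm (R : realType) (u v l : R) : 0 < l < 1 -> 0 <= u -> 0 <= v ->
  u `^ (1 - l) * v `^ l <= (1 - l) * u + l * v.
Proof.
move=> /andP[l0 l1] u0 v0; have l1' : 0 < 1 - l by lra.
have := @conjugate_powR R (u `^ (1 - l)) (v `^ l) (1 - l)^-1 l^-1.
rewrite !powR_ge0 !invr_gt0 !invrK l0 l1' -!powRrM !mulfV ?gt_eqF// !powRr1//.
by rewrite [u * _]mulrC [v * _]mulrC; apply => //; ring.
Qed.

(** One-dimensional Prekopa-Leindler inequality for quasi-concave integrands: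
    after normalising both suprema to 1, the superlevel sets at every height
    below 1 are nonempty intervals, to which the one-dimensional
    Brunn-Minkowski inequality applies. *)
Lemma prekopa_leindler (R : realType) (f g h : R -> R) (l r K a b c : R) :
  0 < l < 1 ->
  measurable_fun setT (f : measurableTypeR R -> R) ->
  measurable_fun setT (g : measurableTypeR R -> R) ->
  measurable_fun setT (h : measurableTypeR R -> R) ->
  (forall x, 0 <= f x <= K) -> (forall x, 0 <= g x <= K) -> (forall x, 0 <= h x) ->
  (forall x, r < `|x| -> f x = 0) -> (forall x, r < `|x| -> g x = 0) ->
  (forall x y z, x <= z <= y -> Num.min (f x) (f y) <= f z) ->
  (forall x y z, x <= z <= y -> Num.min (g x) (g y) <= g z) ->
  (forall x y, f x `^ (1 - l) * g y `^ l <= h ((1 - l) * x + l * y)) ->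
  (\int[@lebesgue_measure R]_x (f x)%:E = a%:E)%E ->
  (\int[@lebesgue_measure R]_x (g x)%:E = b%:E)%E ->
  (\int[@lebesgue_measure R]_x (h x)%:E = c%:E)%E ->
  a `^ (1 - l) * b `^ l <= c.
Proof.
move=> l01 mf mg mh fK gK h0 fr gr qf qg fgh fa gb hc.
have /andP[l0 l1] := l01; have l1' : 0 < 1 - l by lra.
have c0 : 0 <= c by rewrite -lee_fin -hc; apply: integral_ge0 => x _; rewrite lee_fin.
have zero (u : R -> R) w : (forall x, 0 <= u x <= K) ->
    (\int[@lebesgue_measure R]_x (u x)%:E = w%:E)%E ->
    w = 0 \/ exists2 M, 0 < M & (forall x, u x <= M) /\
      (forall s, s < M -> exists x, s < u x).
  move=> uK uw; have [[x ux]|/forallNP nu] := pselect (exists x, 0 < u x).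
    right; exists (sup (range u)).
      apply: (lt_le_trans ux); apply: ub_le_sup; last by exists x.
      by exists K => _ [y _ <-]; case/andP: (uK y).
    split=> [y|s /sup_gt []]; last by move=> _ [y _ <-] sy; exists y.
      by apply: ub_le_sup; [exists K => _ [z _ <-]; case/andP: (uK z)|exists y].
    by exists (u x), x.
  left; apply: EFin_inj; rewrite -uw integral0_eq// => x _.
  congr (_%:E); apply/eqP; rewrite eq_le; case/andP: (uK x) => -> _.
  by rewrite andbT leNgt; apply/negP.
have [->|[M M0 [fM Mf]]] := zero f a fK fa.
  by rewrite powR0 ?gt_eqF// mul0r.
have [->|[N N0 [gN Ng]]] := zero g b gK gb.
  by rewrite (@powR0 _ l) ?gt_eqF// mulr0.
pose P := M `^ (1 - l) * N `^ l.
have P0 : 0 < P by rewrite mulr_gt0// powR_gt0.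
have norm_int (u : R -> R) w m : 0 < m -> (forall x, 0 <= u x) ->
    measurable_fun setT (u : measurableTypeR R -> R) ->
    (\int[@lebesgue_measure R]_x (u x)%:E = w%:E)%E ->
    (\int[@lebesgue_measure R]_x (m^-1 * u x)%:E = (m^-1 * w)%:E)%E.
  move=> m0 u0 mu uw; under eq_integral do rewrite EFinM.
  rewrite ge0_integralZl ?uw//.
  - exact/measurable_EFinP.
  - by move=> x _; rewrite lee_fin.
  - by rewrite lee_fin invr_ge0 ltW.
have ms (u : R -> R) m : measurable_fun setT (u : measurableTypeR R -> R) ->
    measurable_fun setT ((fun x => m^-1 * u x) : measurableTypeR R -> R).
  by move=> mu; apply: measurable_funM => //; exact: measurable_cst.
have layer (u : R -> R) w m : 0 < m -> (forall x, 0 <= u x <= m) ->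
    measurable_fun setT (u : measurableTypeR R -> R) ->
    (\int[@lebesgue_measure R]_x (u x)%:E = w%:E)%E ->
    (\int[@lebesgue_measure R]_(s in `]0%R, 1%R[)
       lebesgue_measure [set x | (s < m^-1 * u x)%R] = (m^-1 * w)%:E)%E.
  move=> m0 um mu uw; rewrite integral_superlevel; last 2 first.
  - exact: ms.
  - by move=> x; rewrite mulr_ge0 ?invr_ge0 ?(ltW m0)//; case/andP: (um x).
  rewrite -(norm_int u)//; last by move=> x; case/andP: (um x).
  apply: eq_integral => x _; congr EFin; apply/min_idPr.
  by rewrite ler_pdivrMl// mulr1; case/andP: (um x).
have key : (((1 - l) * (M^-1 * a) + l * (N^-1 * b))%:E <= (P^-1 * c)%:E)%E.
  rewrite -(norm_int h)//.
  apply: (@le_trans _ _ (\int[@lebesgue_measure R]_x (Num.min 1%R (P^-1 * h x)%R)%:E)%E); last first.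
    apply: ge0_le_integral => //.
    - by move=> x _; rewrite lee_fin le_min ler01 mulr_ge0// invr_ge0 ltW.
    - by apply/measurable_EFinP; apply: measurable_minr => //; exact: ms.
    - by apply/measurable_EFinP; exact: ms.
    - by move=> x _; rewrite lee_fin ge_min lexx orbT.
  rewrite -integral_superlevel; last 2 first.
  - exact: ms.
  - by move=> x; rewrite mulr_ge0// invr_ge0 ltW.
  rewrite EFinD EFinM [X in (_ + X)%E]EFinM.
  rewrite -(layer f a M)//; last by move=> x; rewrite fM; case/andP: (fK x) => ->.
  rewrite -(layer g b N)//; last by move=> x; rewrite gN; case/andP: (gK x) => ->.
  rewrite -!ge0_integralZl//; last 4 first.
  - by apply: measurable_superlevel; exact: ms.
  - by rewrite lee_fin ltW.
  - by apply: measurable_superlevel; exact: ms.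
  - by rewrite lee_fin ltW.
  have mz (m : R) u : measurable_fun setT (u : measurableTypeR R -> R) ->
     measurable_fun (`]0%R, 1%R[%classic : set (measurableTypeR R)) (fun s : measurableTypeR R =>
       (m%:E * @lebesgue_measure R [set x | (s < u x)%R])%E).
    by move=> mu; apply: measurable_funeM; exact: measurable_superlevel.
  rewrite -ge0_integralD//; last 4 first.
  - by move=> s _; rewrite mule_ge0// lee_fin ltW.
  - by apply: mz; exact: ms.
  - by move=> s _; rewrite mule_ge0// lee_fin ltW.
  - by apply: mz; exact: ms.
  apply: ge0_le_integral => //.
  - by move=> s _; rewrite adde_ge0// mule_ge0// lee_fin ltW.
  - by apply: emeasurable_funD; apply: mz; exact: ms.
  - by apply: measurable_superlevel; exact: ms.
  move=> s; rewrite /= in_itv/= => /andP[s0 s1].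
  have sl (u : R -> R) m : 0 < m -> (forall x, u x <= m) ->
      (forall s, s < m -> exists x, s < u x) -> (forall x, r < `|x| -> u x = 0) ->
      (forall x y z, x <= z <= y -> Num.min (u x) (u y) <= u z) ->
      [/\ is_interval [set x | s < m^-1 * u x], [set x | s < m^-1 * u x] !=set0,
        has_ubound [set x | s < m^-1 * u x] & has_lbound [set x | s < m^-1 * u x]].
    move=> m0 um mu ur qu.
    have bd x : s < m^-1 * u x -> `|x| <= r.
      by move=> su; rewrite leNgt; apply/negP => /ur ux; move: su; rewrite ux mulr0 ltNge ltW.
    split.
    - move=> x y /= sx sy z /andP[xz zy]; rewrite ltr_pdivlMl//.
      apply: lt_le_trans (qu x y z _); last by rewrite xz zy.
      by rewrite lt_min -!ltr_pdivlMl// sx sy.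
    - by have [|x sx] := mu (m * s); [rewrite gtr_pMr|exists x; rewrite /= ltr_pdivlMl].
    - by exists r => x /= /bd; rewrite ler_norml => /andP[].
    - by exists (- r) => x /= /bd; rewrite ler_norml => /andP[].
  have [? ? ? ?] := sl f M M0 fM Mf fr qf.
  have [? ? ? ?] := sl g N N0 gN Ng gr qg.
  apply: lebesgue_convex_comb => //.
    have := (ms h P mh) measurableT `]s, +oo[%classic (measurable_itv _).
    by rewrite setTI; congr measurable; apply/seteqP; split=> x; rewrite /= in_itv/= andbT.
  move=> x y /=; rewrite !ltr_pdivlMl// => sx sy.
  apply: lt_le_trans (fgh x y).
  have -> : P * s = (M * s) `^ (1 - l) * (N * s) `^ l.
    rewrite !powRM ?(ltW M0) ?(ltW N0) ?(ltW s0)// mulrACA -/P -powRD; last first.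
      by rewrite (gt_eqF s0) implybT.
    by rewrite subrK powRr1// ltW.
  have Ms : 0 < M * s by rewrite mulr_gt0.
  have Ns : 0 < N * s by rewrite mulr_gt0.
  apply: ltr_pM; rewrite ?powR_ge0//.
    by apply: gt0_ltr_powR; rewrite ?nnegrE ?ltW// (lt_trans Ms).
  by apply: gt0_ltr_powR; rewrite ?nnegrE ?ltW// (lt_trans Ns).
have a0 : 0 <= a.
  by rewrite -lee_fin -fa; apply: integral_ge0 => x _; rewrite lee_fin; case/andP: (fK x).
have b0 : 0 <= b.
  by rewrite -lee_fin -gb; apply: integral_ge0 => x _; rewrite lee_fin; case/andP: (gK x).
have Ma0 : 0 <= M^-1 * a by rewrite mulr_ge0// invr_ge0 ltW.
have Nb0 : 0 <= N^-1 * b by rewrite mulr_ge0// invr_ge0 ltW.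
rewrite lee_fin in key.
have := le_trans (weighted_amgm l01 Ma0 Nb0) key.
rewrite ler_pdivlMl//; apply: le_trans.
rewrite /P mulrACA -!powRM ?(ltW M0) ?(ltW N0)//.
by rewrite !mulrA !mulfV ?gt_eqF// !mul1r.
Qed.

(** * Log-concavity of the volume *)

(** Convexity in terms of vector operations, with both ends of the segment
    allowed. *)
Definition cvx (R : realType) d (A : set 'rV[R]_d) :=
  forall x y (l : R), A x -> A y -> 0 <= l <= 1 -> A ((1 - l) *: x + l *: y).

Lemma convex_set_cvx (R : realType) d (A : set 'rV[R]_d) : convex_set A -> cvx A.
Proof.
move=> /convex_setW cA x y l Ax Ay /andP[l0 l1].
have [->|ln0] := eqVneq l 0; first by rewrite subr0 scale1r scale0r addr0.
have [->|ln1] := eqVneq l 1; first by rewrite subrr scale1r scale0r add0r.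
have l0' : 0 < l by rewrite lt0r ln0.
have l1' : l < 1 by rewrite lt_neqAle ln1.
have := cA y x; rewrite !inE => /(_ Ay Ax (Itv01 l0 l1) l0' l1').
rewrite inE; congr A.
by rewrite /conv/= addrC.
Qed.

Section sections.
Context (R : realType) (d : nat).
Implicit Types (A : set 'rV[R]_d.+1) (x : R).

Lemma cons_rV_continuous x : continuous (fun y : 'rV[R]_d => cons_rV (x, y)).
Proof.
move=> y B /nbhs_ballP[e /= e0 eB]; apply/nbhs_ballP; exists e => // z yz.
by apply: eB; apply: (@ball_cons_rV R d (x, y) (x, z)) => //; exact: ballxx.
Qed.

Lemma slice_cube A r x : A `<=` cube d.+1 r -> slice A x `<=` cube d r.
Proof. by move=> Ar y /Ar h i; have := h (lift 0 i); rewrite cons_rVS. Qed.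

Lemma compact_slice A x : compact A -> compact (slice A x).
Proof.
move=> cA; have [r r0 Ar] := compact_cube cA.
apply: bounded_closed_compact.
  exists r; split; first exact: num_real.
  move=> M rM y /(slice_cube Ar); rewrite cube_ball// -ball_normE /= sub0r normrN.
  by move=> /ltW /le_trans; apply; exact: ltW.
apply: (@closed_comp _ _ (fun y : 'rV[R]_d => cons_rV (x, y)) A).
  by move=> y _; exact: cons_rV_continuous.
exact: compact_closed_rV.
Qed.

Lemma cons_rV_comb (l x x' : R) (y y' : 'rV[R]_d) :
  cons_rV ((1 - l) * x + l * x', (1 - l) *: y + l *: y') =
  (1 - l) *: cons_rV (x, y) + l *: cons_rV (x', y').
Proof.
rewrite /cons_rV /= !(@scale_row_mx _ 1 1 d) (@add_row_mx _ 1 1 d).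
by rewrite !scale_scalar_mx -raddfD.
Qed.

Lemma cvx_slice A x : cvx A -> cvx (slice A x).
Proof.
move=> cA y z l Ay Az l01; rewrite /slice /=.
have := cA _ _ l Ay Az l01; rewrite -cons_rV_comb.
by rewrite -mulrDl subrK mul1r.
Qed.

Lemma volume_slice_le A r x : compact A -> A `<=` cube d.+1 r -> 0 < r ->
  0 <= volume (slice A x) <= fine (vm R d (cube d r)).
Proof.
move=> cA Ar r0; have cs := @compact_slice A x cA.
rewrite -!lee_fin volumeE// measure_ge0 fineK; last first.
  by rewrite ge0_fin_numE//; exact: vm_cube_lty.
apply: le_measure; rewrite ?inE//; first exact: compact_borel.
  exact: borel_cube.
exact: slice_cube.
Qed.

Lemma slice_far A r x : A `<=` cube d.+1 r -> r < `|x| -> volume (slice A x) = 0.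
Proof.
move=> Ar rx; rewrite (_ : slice A x = set0).
  by rewrite /volume -(@vmE R d) ?measure0//; exact: (@measurable0 _ (mrV R d)).
rewrite -subset0 => y /Ar /(_ 0); rewrite cons_rV0 /= => xr.
by have := lt_trans rx xr; rewrite ltxx.
Qed.

Lemma integral_volume_slice A : compact A ->
  (\int[@lebesgue_measure R]_x (volume (slice A x))%:E = (volume A)%:E)%E.
Proof.
move=> cA; rewrite volumeE// (@vmE R d.+1) /=; last exact: compact_borel.
apply: eq_integral => x _; rewrite volumeE; last exact: compact_slice.
by rewrite (@vmE R d)//; apply: borel_slice; exact: compact_borel.
Qed.

Lemma measurable_volume_slice A : compact A ->
  measurable_fun setT (fun x : measurableTypeR R => volume (slice A x)).
Proof.
move=> cA; apply: (measurableT_comp (@fine_measurable R _ measurableT)).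
by apply: measurable_vol_slice; exact: compact_borel.
Qed.

End sections.

Lemma volume_ge0 (R : realType) d (A : set 'rV[R]_d) : compact A -> 0 <= volume A.
Proof. by move=> cA; rewrite -lee_fin volumeE. Qed.

(** Induction on the dimension: the volumes of the slices satisfy the
    hypothesis of the one-dimensional Prekopa-Leindler inequality, and the
    same induction hypothesis makes them quasi-concave. *)
Lemma volume_log_concave (R : realType) d (A B C : set 'rV[R]_d) (l : R) :
  0 < l < 1 -> compact A -> compact B -> compact C -> cvx A -> cvx B ->
  (forall x y, A x -> B y -> C ((1 - l) *: x + l *: y)) ->
  volume A `^ (1 - l) * volume B `^ l <= volume C.
Proof.
elim: d A B C l => [|d IH] A B C l l01 cA cB cC vA vB ABC; have /andP[l0 l1] := l01.
  have l1' : 0 < 1 - l by lra.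
  rewrite /volume /= !indicE.
  have [Aa|nA] := boolP (0 \in A); last by rewrite /= powR0 ?mul0r// gt_eqF.
  have [Bb|nB] := boolP (0 \in B); last by rewrite /= (@powR0 _ l) ?mulr0// gt_eqF.
  rewrite (_ : 0 \in C = true)//=; last first.
    apply/mem_set; have := ABC _ _ (set_mem Aa) (set_mem Bb).
    by rewrite (_ : _ + _ = 0)//; apply/rowP => -[].
  by rewrite !powR1 mulr1.
have [ra ra0 Ar] := compact_cube cA; have [rb rb0 Br] := compact_cube cB.
pose r := Num.max ra rb.
have r0 : 0 < r by rewrite lt_max ra0.
have {}Ar : A `<=` cube d.+1 r.
  by move=> x /Ar h i; rewrite (lt_le_trans (h i))// le_max lexx.
have {}Br : B `<=` cube d.+1 r.
  by move=> x /Br h i; rewrite (lt_le_trans (h i))// le_max lexx orbT.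
have qc (D : set 'rV[R]_d.+1) x y z : compact D -> cvx D -> x <= z <= y ->
    Num.min (volume (slice D x)) (volume (slice D y)) <= volume (slice D z).
  move=> cD vD /andP[xz zy].
  have [->|xzn] := eqVneq x z; first by rewrite ge_min lexx.
  have [->|zyn] := eqVneq z y; first by rewrite ge_min lexx orbT.
  have xz' : x < z by rewrite lt_neqAle xzn.
  have zy' : z < y by rewrite lt_neqAle zyn.
  pose m := (z - x) / (y - x); have yx0 : 0 < y - x by lra.
  have m01 : 0 < m < 1.
    apply/andP; split; first by rewrite divr_gt0// subr_gt0.
    by rewrite ltr_pdivrMr// mul1r ltrD2r.
  have zE : z = (1 - m) * x + m * y.
    have : m * (y - x) = z - x by rewrite /m divfK// gt_eqF.
    by move=> h; lra.
  have /andP[m0 m1] := m01.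
  have := IH (slice D x) (slice D y) (slice D z) m m01 (@compact_slice R d D x cD)
    (@compact_slice R d D y cD) (@compact_slice R d D z cD) (@cvx_slice R d D x vD) (@cvx_slice R d D y vD).
  have Dz u v : slice D x u -> slice D y v -> slice D z ((1 - m) *: u + m *: v).
    move=> Du Dv; rewrite /slice /= zE cons_rV_comb; apply: vD => //.
    by rewrite !ltW.
  move=> /(_ Dz); apply: le_trans; set mn := Num.min _ _.
  have mn0 : 0 <= mn by rewrite /mn le_min !volume_ge0//; exact: compact_slice.
  have -> : mn = mn `^ (1 - m) * mn `^ m.
    have [->|mn00] := eqVneq mn 0; first by rewrite powR0 ?mul0r// gt_eqF// subr_gt0.
    by rewrite -powRD ?mn00 ?implybT// subrK powRr1.
  apply: ler_pM; rewrite ?powR_ge0//; apply: ge0_ler_powR; rewrite ?nnegrE//.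
  - by rewrite subr_ge0 ltW.
  - by rewrite volume_ge0//; exact: compact_slice.
  - by rewrite /mn ge_min lexx.
  - exact: ltW.
  - by rewrite volume_ge0//; exact: compact_slice.
  - by rewrite /mn ge_min lexx orbT.
apply: (@prekopa_leindler R (fun x => volume (slice A x)) (fun x => volume (slice B x))
  (fun x => volume (slice C x)) l r (fine (vm R d (cube d r)))) => //.
- exact: measurable_volume_slice.
- exact: measurable_volume_slice.
- exact: measurable_volume_slice.
- by move=> x; exact: volume_slice_le.
- by move=> x; exact: volume_slice_le.
- by move=> x; rewrite volume_ge0//; exact: compact_slice.
- by move=> x; exact: slice_far.
- by move=> x; exact: slice_far.
- by move=> x y z; exact: qc.
- by move=> x y z; exact: qc.
- move=> x y; apply: IH => //; try exact: compact_slice; try exact: cvx_slice.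
  by move=> u v Au Bv; rewrite /slice /= cons_rV_comb; exact: ABC.
- exact: integral_volume_slice.
- exact: integral_volume_slice.
- exact: integral_volume_slice.
Qed.

(** * The surface area of a convex body *)

Section parallel_set.
Context (R : realType) (d : nat).
Variable W : set 'rV[R]_d.
Hypothesis cW : compact W.
Hypothesis vW : cvx W.
Hypothesis W0 : 0 < volume W.

Lemma parallel_setE e : parallel_set W e =
  (fun z : 'rV[R]_d * 'rV[R]_d => z.1 + z.2) @` (W `*` [set x | enorm x <= e]).
Proof.
apply/seteqP; split=> [x [a Wa ae]|_ [[a b] [/= Wa be] <-]].
  by exists (a, x - a) => //=; rewrite addrC subrK.
by exists a => //; rewrite addrC addKr.
Qed.

Lemma compact_parallel_set e : compact (parallel_set W e).
Proof.
rewrite parallel_setE; apply: continuous_compact.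
  by apply: continuous_subspaceT => z; exact: add_continuous.
by apply: compact_setX => //; exact: compact_enorm_ball.
Qed.

Lemma sub_parallel_set e : 0 <= e -> W `<=` parallel_set W e.
Proof. by move=> e0 x Wx; exists x => //; rewrite subrr enorm0. Qed.

Lemma cvx_parallel_set e : cvx (parallel_set W e).
Proof.
move=> x y l [a Wa xa] [b Wb yb] l01; have /andP[l0 l1] := l01.
exists ((1 - l) *: a + l *: b); first exact: vW.
rewrite opprD addrACA -!scalerBr (le_trans (enormD _ _))// !enormZ.
rewrite (ger0_norm l0) ger0_norm ?subr_ge0//.
rewrite [leRHS](_ : e = (1 - l) * e + l * e); last ring.
by rewrite lerD// ler_wpM2l// subr_ge0.
Qed.

Let v e := volume (parallel_set W e).

Lemma volume_parallel_ge e : 0 <= e -> volume W <= v e.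
Proof.
move=> e0; rewrite -lee_fin /v !volumeE//; last exact: compact_parallel_set.
apply: le_measure; rewrite ?inE; [exact: compact_borel| |exact: sub_parallel_set].
by apply: compact_borel; exact: compact_parallel_set.
Qed.

(** The combination [(1 - l) W + l W_e] of [W] and its parallel set [W_e] lies in
    the parallel set at distance [l * e], as [W] is convex. *)
Lemma volume_parallel_log_concave l e : 0 < l < 1 ->
  volume W `^ (1 - l) * v e `^ l <= v (l * e).
Proof.
move=> l01; have /andP[l0 l1] := l01.
apply: volume_log_concave => //; try exact: compact_parallel_set.
  exact: cvx_parallel_set.
move=> x y Wx [a Wa ya]; exists ((1 - l) *: x + l *: a).
  by apply: vW => //; rewrite !ltW.
by rewrite opprD addrACA subrr add0r -scalerBr enormZ gtr0_norm// ler_pM2l.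
Qed.

Let phi e := ln (v e / volume W) / e.

Let vW1 e : 0 <= e -> 1 <= v e / volume W.
Proof. by move=> e0; rewrite ler_pdivlMr// mul1r volume_parallel_ge. Qed.

Let phi_ge0 e : 0 < e -> 0 <= phi e.
Proof. by move=> e0; rewrite divr_ge0 ?(ltW e0)// ln_ge0// vW1// ltW. Qed.

(** Log-concavity along [0 < x < y]: the logarithm of the parallel volume lies
    above its chord from 0 to [y]. *)
Let phi_nonincreasing x y : 0 < x -> x < y -> phi y <= phi x.
Proof.
move=> x0 xy; have y0 := lt_trans x0 xy.
pose l := x / y; have l01 : 0 < l < 1.
  by rewrite /l divr_gt0//= ltr_pdivrMr// mul1r.
have /andP[l0 l1] := l01.
have := volume_parallel_log_concave y l01; rewrite [l * y]divfK ?gt_eqF// => h.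
have vy0 : 0 < v y by rewrite (lt_le_trans W0)// volume_parallel_ge// ltW.
have vx0 : 0 < v x by rewrite (lt_le_trans W0)// volume_parallel_ge// ltW.
have : ln (volume W `^ (1 - l) * v y `^ l) <= ln (v x).
  by rewrite ler_ln// posrE// mulr_gt0// powR_gt0.
rewrite lnM ?posrE ?powR_gt0// !ln_powR => {}h.
rewrite /phi !ln_div ?posrE// ler_pdivrMr//.
rewrite -mulrA [x^-1 * y]mulrC -[y / x]invf_div -/l ler_pdivlMr//; lra.
Qed.

(** The logarithmic difference quotient [phi] is monotone, hence has a limit [S] in
    [[0, +oo]]. The difference quotient of the volume is at least [volume W * phi]
    and, when [S = s] is finite, at most [volume W * (s * expR (e * s))], so it has
    a limit too, which is then the surface area. *)
Lemma surface_area_cvg :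
  ((vol (parallel_set W e) - vol W) * (e^-1)%:E)%E @[e --> 0^'+] --> surface_area W.
Proof.
suff [l cl] : exists l : \bar R, ((vol (parallel_set W e) - vol W) * (e^-1)%:E)%E @[e --> 0^'+] --> l.
  by rewrite /surface_area (cvg_lim _ cl).
have qE : \forall e \near 0^'+, ((v e - volume W) / e)%:E =
    ((vol (parallel_set W e) - vol W) * (e^-1)%:E)%E.
  near=> e; rewrite EFinM EFinB /v !volumeE//; last exact: compact_parallel_set.
  by rewrite !(@vmE R d)//; [exact: compact_borel|
    by apply: compact_borel; exact: compact_parallel_set].
suff [l cl] : exists l : \bar R, ((v e - volume W) / e)%:E @[e --> 0^'+] --> l.
  by exists l; apply: cvg_trans cl; apply: near_eq_cvg.
pose S := ereal_sup ((fun e => (phi e)%:E) @` `]0, +oo[%classic).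
have phiS : (phi e)%:E @[e --> 0^'+] --> S.
  apply: (@nonincreasing_at_right_cvge _ _ _ +oo%O) => //.
  move=> x y; rewrite !in_itv/= !andbT => x0 y0.
  by rewrite le_eqVlt => /predU1P[->//|xy]; rewrite lee_fin phi_nonincreasing.
have S_ub e : 0 < e -> ((phi e)%:E <= S)%E.
  by move=> e0; apply: ereal_sup_ubound; exists e => //; rewrite /= in_itv/= e0.
have vE e : 0 < e -> v e = volume W * expR (e * phi e).
  move=> e0; have -> : e * phi e = ln (v e / volume W).
    by rewrite /phi mulrC divfK// gt_eqF.
  rewrite lnK ?posrE.
    by rewrite mulrC divfK// gt_eqF.
  by rewrite (lt_le_trans ltr01)// vW1// ltW.
have q_lb e : 0 < e -> volume W * phi e <= (v e - volume W) / e.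
  move=> e0; rewrite ler_pdivlMr// vE//.
  have := ler_wpM2l (ltW W0) (expR_ge1Dx (e * phi e)); lra.
have q_ub e s : 0 < e -> phi e <= s -> (v e - volume W) / e <= volume W * (s * expR (e * s)).
  move=> e0 es; rewrite ler_pdivrMr// vE//.
  have s0 : 0 <= s := le_trans (phi_ge0 e0) es.
  have h1 : expR (e * phi e) <= expR (e * s) by rewrite ler_expR ler_pM2l.
  have h2 : expR (e * s) * (1 - e * s) <= 1.
    have : 1 - e * s <= expR (- (e * s)) by exact: expR_ge1Dx.
    by rewrite -(ler_pM2l (expR_gt0 (e * s))) -expRD subrr expR0.
  have -> : volume W * (s * expR (e * s)) * e = volume W * (expR (e * s) * (e * s)) by ring.
  rewrite -[X in _ - X]mulr1 -mulrBr ler_pM2l//; lra.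
clearbody S; case: S phiS S_ub => [s||] phiS S_ub.
- exists (volume W * s)%:E; apply: cvg_EFin; first exact: nearW.
  have phis : phi e @[e --> 0^'+] --> s by exact: (fine_cvg phiS).
  apply: (@squeeze_cvgr _ _ _ _ (fun e => volume W * phi e)
    (fun e => volume W * (s * expR (e * s)))).
  + near=> e; have e0 : 0 < e by near: e; exact: nbhs_right_gt.
    by rewrite q_lb//= q_ub// -lee_fin S_ub.
  + by apply: cvgMl_tmp.
  + have -> : volume W * s = volume W * (s * expR (0 * s)).
      by rewrite mul0r expR0 mulr1.
    apply: cvgMl_tmp; apply: cvgMl_tmp.
    apply: (@cvg_at_right_filter _ _ (fun e => expR (e * s))).
    have : {for (0 : R), continuous (expR \o (fun e : R => e * s))}.
      by apply: continuous_comp; [exact: mulrr_continuous|exact: continuous_expR].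
    exact.
- exists +oo%E; apply/cvgeryP; apply/cvgryPge => A.
  have : \forall e \near 0^'+, A / volume W <= phi e.
    by move: phiS => /cvgeryP /cvgryPge; exact.
  move=> h; near=> e; have e0 : 0 < e by near: e; exact: nbhs_right_gt.
  apply: le_trans (q_lb _ e0); rewrite mulrC -ler_pdivrMr//.
  by near: e.
- by have := S_ub 1 ltr01.
Unshelve. all: by end_near. Qed.

End parallel_set.

(** * Points of a convex body that leave it under a translation *)

Section finite_measure_sets.
Context (R : realType) (d : nat).
Implicit Types A B : set 'rV[R]_d.

(** Borel sets of finite measure, on which [mes] is additive. *)
Definition finb A := borel A /\ (vm R d A < +oo)%E.

Definition mes A : R := fine (vm R d A).

Lemma mesE A : finb A -> (mes A)%:E = vm R d A.
Proof. by move=> [bA fA]; rewrite /mes fineK// ge0_fin_numE. Qed.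

Lemma finb_sub A B : borel A -> finb B -> A `<=` B -> finb A.
Proof.
move=> bA [bB fB] AB; split => //; apply: le_lt_trans fB.
by apply: le_measure; rewrite ?inE.
Qed.

Lemma finb_compact A : compact A -> finb A.
Proof. by move=> cA; split; [exact: compact_borel|exact: vm_compact_lty]. Qed.

Lemma finbU A B : finb A -> finb B -> finb (A `|` B).
Proof.
move=> [bA fA] [bB fB]; split; first exact: borelU.
by apply: le_lt_trans (measureU2 (vm R d) bA bB) _; rewrite lte_add_pinfty.
Qed.

Lemma finbD A B : finb A -> borel B -> finb (A `\` B).
Proof. by move=> fA bB; apply: (finb_sub (borelD fA.1 bB) fA) => x []. Qed.

Lemma finb_shift u A : finb A -> finb [set x | A (x + u)].
Proof. by move=> [bA fA]; split; [exact: borel_shift|rewrite vm_shift]. Qed.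

Lemma mes_shift u A : borel A -> mes [set x | A (x + u)] = mes A.
Proof. by move=> bA; rewrite /mes vm_shift. Qed.

Lemma mes_ge0 A : 0 <= mes A.
Proof. exact: fine_ge0. Qed.

Lemma mes_le A B : borel A -> finb B -> A `<=` B -> mes A <= mes B.
Proof.
move=> bA fB AB; rewrite -lee_fin !mesE//; last exact: finb_sub AB.
by case: fB => bB _; apply: le_measure; rewrite ?inE.
Qed.

Lemma mesU A B : finb A -> finb B -> A `&` B = set0 ->
  mes (A `|` B) = mes A + mes B.
Proof.
move=> fA fB AB; apply: EFin_inj; rewrite EFinD !mesE//; last exact: finbU.
by case: fA => bA _; case: fB => bB _; apply: measureU.
Qed.

Lemma mesDI A B : finb A -> borel B -> mes A = mes (A `\` B) + mes (A `&` B).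
Proof.
move=> fA bB; have bA := fA.1; rewrite -mesU.
- by congr mes; rewrite setUC setUIDK.
- exact: finbD.
- exact: (finb_sub (borelI bA bB) fA (@subIsetl _ A B)).
- by rewrite setIC setDE setIACA setICr setI0.
Qed.

End finite_measure_sets.

Section loss.
Context (R : realType) (d : nat).
Variable W : set 'rV[R]_d.
Hypothesis cW : compact W.
Hypothesis vW : cvx W.

Definition exits (u : 'rV[R]_d) : set 'rV[R]_d := W `\` [set x | W (x + u)].

Let bW : borel W. Proof. exact: compact_borel. Qed.
Let fW : finb W. Proof. exact: finb_compact. Qed.

Lemma finb_exits u : finb (exits u).
Proof. by apply: finbD => //; exact: borel_shift. Qed.

(** A point that leaves [W] in [n + 1] steps is outside after [n] steps, or leaves
    with the last step. *)
Lemma mes_exits_mulrn v n : mes (exits (v *+ n)) <= n%:R * mes (exits v).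
Proof.
elim: n => [|n IH].
  rewrite mul0r mulr0n (_ : exits 0 = set0) /mes ?measure0//.
  by rewrite -subset0 => x [Wx] /=; rewrite addr0.
have fS : finb [set x | exits v (x + v *+ n)] by apply: finb_shift; exact: finb_exits.
have fT := finb_exits (v *+ n).
apply: (@le_trans _ _ (mes (exits (v *+ n) `|` ([set x | exits v (x + v *+ n)] `\` exits (v *+ n))))).
  apply: mes_le; first by case: (finb_exits (v *+ n.+1)).
    by apply: finbU => //; exact: finbD fS fT.1.
  move=> x [Wx Wn]; have [Wxn|Wxn] := pselect (W (x + v *+ n)); last by left.
  right; split; last by move=> [].
  by split=> //= Wxv; apply: Wn; rewrite /= mulrSr addrA.
rewrite mesU //.
- rewrite -natr1 mulrDl mul1r lerD//.
  rewrite -(@mes_shift R d (v *+ n) (exits v)); last exact: (finb_exits v).1.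
  by apply: mes_le => //; apply: borelD; [case: fS|case: fT].
- exact: finbD fS fT.1.
- by rewrite setIDA setIC setDE -setIA setICr setI0.
Qed.

(** The translates of a convex set by v and -v leave it in disjoint regions,
    both of which lie in the parallel set at distance |v|. *)
Lemma two_exits_le v :
  2 * mes (exits v) <= mes (parallel_set W (enorm v) `\` W).
Proof.
pose Ap := [set x | W (x - v)] `\` W; pose Am := [set x | W (x + v)] `\` W.
have fWp : finb [set x | W (x + v)] by exact: finb_shift.
have fWm : finb [set x | W (x - v)] by exact: finb_shift.
have fp : finb Ap by exact: finbD.
have fm : finb Am by exact: finbD.
have App : mes Ap = mes (exits v).
  rewrite -(mes_shift v fp.1); congr mes; apply/seteqP.
  by split=> x; rewrite /Ap /exits /setD /= addrK.
have Amp : mes Am = mes (exits v).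
  have := mesDI fW fWp.1; have := mesDI fWp bW; rewrite mes_shift//.
  rewrite setIC -/Am -/(exits v); lra.
have disj : Ap `&` Am = set0.
  rewrite -subset0 => x [[/= Wm nW] [Wp _]]; apply: nW.
  have E : (1 - 2^-1) *: (x - v) + 2^-1 *: (x + v) = x.
    have -> : 1 - 2^-1 = 2^-1 :> R by lra.
    rewrite -scalerDr addrACA addNr addr0 scalerDr -scalerDl.
    by rewrite (_ : 2^-1 + 2^-1 = 1 :> R) ?scale1r//; lra.
  by have := vW Wm Wp (l := 2^-1); rewrite E; apply; lra.
rewrite mulr2n mulrDl mul1r -{1}App -Amp -mesU//.
apply: mes_le; first by apply: borelU; [case: fp|case: fm].
  by apply: finbD => //; apply: finb_compact; exact: compact_parallel_set.
move=> x [|] [/= Wx nW]; split=> //.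
  by exists (x - v) => //; rewrite opprB addrC subrK.
by exists (x + v) => //; rewrite opprD addrA subrr add0r enormN.
Qed.

(** Cut [u] into [n] steps of length [e = |u| / n]. By [mes_exits_mulrn] and
    [two_exits_le] the quotient [2 * mes (exits u) / |u|] is at most the difference
    quotient of the parallel volume at [e]; let [n] tend to infinity. *)
Lemma exits_surface u : u != 0 -> 0 < volume W ->
  ((2 * mes (exits u))%:E <= (enorm u)%:E * surface_area W)%E.
Proof.
move=> u0 W0; have e0 : 0 < enorm u by rewrite enorm_gt0.
have cvq := surface_area_cvg cW vW W0.
set b := mes _.
suff : ((2 * b / enorm u)%:E <= surface_area W)%E.
  move=> h; rewrite (_ : 2 * b = enorm u * (2 * b / enorm u)); last first.
    by field; rewrite gt_eqF.
  by rewrite EFinM lee_pmul2l.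
have e0n n : 0 < enorm u / n.+1%:R by rewrite divr_gt0.
pose e n : R := enorm u / n.+1%:R.
have ce : e n @[n --> \oo] --> (0 : R)^'+.
  move=> B [r /= r0 rB]; suff : \forall n \near \oo, B (e n) by [].
  near=> n; apply: rB => /=; last exact: e0n.
  rewrite sub0r normrN gtr0_norm ?e0n// /e ltr_pdivrMr// mulrC -ltr_pdivrMr//.
  near: n; exists (Num.bound (enorm u / r)) => // n /= bn.
  apply: (lt_le_trans (archi_boundP _)); first by rewrite divr_ge0 ?(ltW e0) ?(ltW r0).
  by rewrite ler_nat leqW.
apply: (cvge_to_ge (cvg_comp _ _ ce cvq)); apply: nearW => n.
rewrite /= /e.
pose v := n.+1%:R^-1 *: u.
have vE : enorm v = e n by rewrite /v enormZ gtr0_norm ?invr_gt0// mulrC.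
have uE : u = v *+ n.+1 by rewrite -scaler_nat scalerA mulfV ?scale1r.
have h1 := mes_exits_mulrn v n.+1; have h2 := two_exits_le v.
rewrite -uE -/b in h1.
have fK : finb (parallel_set W (e n)).
  by apply: finb_compact; exact: compact_parallel_set.
have := mesDI fK bW; rewrite setIidr; last by apply: sub_parallel_set; rewrite ltW ?e0n.
move=> DE; rewrite vE in h2.
rewrite -!(@vmE R d)//; last by case: fK.
rewrite -!mesE// -EFinB -EFinM lee_fin ler_pdivrMr// -/(e n).
rewrite (_ : _ / e n * enorm u = n.+1%:R * (mes (parallel_set W (e n)) - mes W)); last first.
  have N0 : 0 < (n.+1%:R : R) by [].
  move: (mes (parallel_set W (e n))) => K; rewrite /e.
  by move: (n.+1%:R) N0 => N N0; field; rewrite !gt_eqF.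
apply: (@le_trans _ _ (n.+1%:R * (2 * mes (exits v)))); last first.
  by rewrite ler_wpM2l//; lra.
lra.
Unshelve. all: by end_near. Qed.

(** The exit regions of the successive translates are pairwise disjoint: a
    line that has left a convex set does not come back. *)
Lemma disjoint_translates v n : exists2 U, finb U &
  mes U = n%:R * mes (exits v) /\
  forall x, U x -> exists k, (k < n)%N /\ exits v (x + k%:R *: v).
Proof.
elim: n => [|n [U fU [mU sU]]].
  exists set0; last by split=> //; rewrite mul0r /mes measure0.
  split; first exact: (@measurable0 _ (mrV R d)).
  by rewrite measure0.
have bv : borel (exits v) := (finb_exits v).1.
have fV : finb [set x | exits v (x + n%:R *: v)] by apply: finb_shift; exact: finb_exits.
exists (U `|` [set x | exits v (x + n%:R *: v)]); first exact: finbU.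
split=> [|x [/sU[k [kn xk]]|xn]]; last 2 first.
- by exists k; split=> //; exact: ltnW.
- by exists n.
rewrite mesU//.
  by rewrite mU (mes_shift _ bv) -natr1 mulrDl mul1r.
rewrite -subset0 => x [/sU[k [kn [Wk nk]]] [/= Wn _]]; apply: nk => /=.
have kn0 : 0 < (n%:R - k%:R : R) by rewrite subr_gt0 ltr_nat.
have kn1 : k%:R + 1 <= (n%:R : R) by rewrite natr1 ler_nat.
pose l : R := (n%:R - k%:R)^-1.
have -> : x + k%:R *: v + v = (1 - l) *: (x + k%:R *: v) + l *: (x + n%:R *: v).
  rewrite !scalerDr addrACA -scalerDl subrK scale1r !scalerA -scalerDl -addrA.
  congr (_ + _); rewrite -{2}(scale1r v) -scalerDl; congr (_ *: _).
  have : l * (n%:R - k%:R) = 1 by rewrite mulVf// gt_eqF.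
  lra.
apply: vW => //; apply/andP; split; first by rewrite invr_ge0 ltW.
by rewrite invf_le1//; lra.
Qed.

(** About [1 / |u|] disjoint translates of the exit region fit into the parallel
    set at distance 1. The constant is finite by construction, whereas the bound
    of [exits_surface] would be void for an infinite surface area. *)
Lemma mes_exits_lipschitz : exists2 C, 0 < C &
  forall u, 0 < enorm u <= 1 -> mes (exits u) <= C * enorm u.
Proof.
pose M := mes (parallel_set W 1).
have fK : finb (parallel_set W 1).
  by apply: finb_compact; exact: compact_parallel_set.
exists (2 * M + 1); first by have := mes_ge0 (parallel_set W 1); rewrite -/M; lra.
move=> u /andP[u0 u1].
pose n := Num.trunc (enorm u)^-1.
have ui : 1 <= (enorm u)^-1 by rewrite invf_ge1.
have n1 : n%:R <= (enorm u)^-1 by rewrite truncn_le (le_trans ler01).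
have n2 : (enorm u)^-1 < n.+1%:R := truncnS_gt _.
have n0 : (0 < n)%N by rewrite truncn_gt0.
have [U fU [mU sU]] := disjoint_translates u n.
have : mes U <= M.
  apply: mes_le => //; first by case: fU.
  move=> x /sU[k [kn [Wx _]]]; exists (x + k%:R *: u) => //.
  rewrite opprD addrA subrr add0r enormN enormZ ger0_norm//.
  rewrite -ler_pdivlMr// div1r.
  by apply: le_trans n1; rewrite ler_nat ltnW.
rewrite mU => h.
have e0 := mes_ge0 (exits u).
have : (enorm u)^-1 * mes (exits u) <= 2 * M.
  have n3 : (enorm u)^-1 <= 2 * n%:R.
    by rewrite (le_trans (ltW n2))// -natrM ler_nat; lia.
  by rewrite (le_trans (ler_wpM2r e0 n3))// -mulrA ler_wpM2l.
rewrite ler_pdivrMl// => h2; apply: (le_trans h2).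
by rewrite mulrC ler_wpM2r ?(ltW u0)// lerDl.
Qed.

End loss.

(** * Moments of independent Poisson counts *)

Section independent_counts.
Context (R : realType) disp (Omega : measurableType disp) (P : probability Omega R).
Context (I : finType) (N : I -> Omega -> nat) (p : I -> nat -> R).
Hypothesis mN : forall i, measurable_fun [set: Omega] (N i).
Hypothesis indepN : forall k : I -> nat,
  P [set w | forall i, N i w = k i] = (\prod_i p i (k i))%:E.

Lemma measurable_count_event (k : I -> nat) :
  measurable [set w | forall i, N i w = k i].
Proof.
rewrite (_ : [set _ | _] = \bigcap_(i in [set: I]) (N i @^-1` [set k i])).
  apply: fin_bigcap_measurable => [|i _]; first exact: finite_finset.
  by rewrite -[X in measurable X]setTI; exact: mN.
by apply/seteqP; split=> w h i; [move=> _; exact: h|exact: (h i)].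
Qed.

(** Only finitely many values of the counts contribute, and the finite sum over
    them factorises by independence. *)
Lemma truncated_product_expectation (g : I -> nat -> R) (K : nat) :
  (\int[P]_w (\prod_i (if (N i w < K)%N then g i (N i w) else 0))%:E
    = (\prod_i \sum_(k < K) g i k * p i k)%:E)%E.
Proof.
pose E (k : {ffun I -> 'I_K}) : set Omega := [set w | forall i, N i w = k i].
have mE k : measurable (E k) := measurable_count_event _.
transitivity (\int[P]_w (\sum_(k : {ffun I -> 'I_K}) (\prod_i g i (k i))%:E * (\1_(E k) w)%:E))%E.
  apply: eq_integral => w _.
  rewrite (eq_bigr (fun i => \sum_(j < K) g i j * (N i w == j)%:R)); last first.
    move=> i _; case: ifPn => [NK|nNK].
      rewrite (bigD1 (Ordinal NK))//= eqxx mulr1 big1 ?addr0// => j jN.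
      rewrite (_ : (N i w == j) = false) ?mulr0//; apply/negbTE; move: jN.
      by apply: contraNneq => e; apply/eqP/val_inj.
    rewrite big1// => j _; rewrite (_ : (N i w == j) = false) ?mulr0//.
    by apply/negbTE; apply: contra nNK => /eqP ->.
  rewrite bigA_distr_bigA/= -sumEFin; apply: eq_bigr => k _.
  rewrite -EFinM big_split /=; congr (_ * _)%:E.
  rewrite indicE; have [wE|wE] := boolP (w \in E k).
    by rewrite big1// => i _; move/set_mem : wE => ->; rewrite eqxx.
  have /existsP[i iN] : [exists i, N i w != k i].
    rewrite -negb_forall; apply: contra wE => /forallP h; apply/mem_set => i.
    exact/eqP.
  by rewrite (bigD1 i)//= (negbTE iN) mul0r.
rewrite integral_sum//; last first.
  move=> k; apply: integrableZl => //.
  by apply: integrable_indic.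
rewrite bigA_distr_bigA/= -sumEFin; apply: eq_bigr => k _.
rewrite integralZl//; last exact: integrable_indic.
rewrite integral_indic// setIT.
transitivity ((\prod_i g i (k i))%:E * (\prod_i p i (k i))%:E)%E.
  by congr (_ * _)%E; exact: indepN.
by rewrite -EFinM big_split.
Qed.

(** Monotone convergence in the truncation level [K]. *)
Lemma product_expectation (g : I -> nat -> R) (m : I -> R) :
  (forall i k, 0 <= g i k) ->
  (forall i, \sum_(k < K) g i k * p i k @[K --> \oo] --> m i) ->
  (\int[P]_w (\prod_i g i (N i w))%:E = (\prod_i m i)%:E)%E.
Proof.
move=> g0 gm.
pose T K w := (\prod_i (if (N i w < K)%N then g i (N i w) else 0))%:E.
have mT K : measurable_fun setT (T K).
  apply/measurable_EFinP; apply: measurable_prod => i _.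
  by apply: (measurableT_comp (f := fun n : nat => if (n < K)%N then g i n else 0)).
have cv : (\int[P]_w T K w)%E @[K --> \oo] --> (\int[P]_w (\prod_i g i (N i w))%:E)%E.
  apply: monotone_convergence_cvg => //.
  - move=> K w _; rewrite lee_fin; apply: prodr_ge0 => i _.
    by case: ifP.
  - move=> w _ K L KL; rewrite lee_fin; apply: ler_prod => i _.
    case: ifPn => [NK|_]; first by rewrite g0 (leq_trans NK KL) lexx.
    by rewrite lexx /=; case: ifP.
  - move=> w _; apply: cvg_near_cst; exists (\max_i N i w).+1 => //= K NK.
    rewrite /T; congr EFin; apply: eq_bigr => i _.
    by rewrite (leq_ltn_trans _ NK)//; exact: (leq_bigmax i).
have cv2 : (\int[P]_w T K w)%E @[K --> \oo] --> (\prod_i m i)%:E.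
  rewrite (_ : (fun K => _) = (fun K => (\prod_i \sum_(k < K) g i k * p i k)%:E)).
    apply: cvg_EFin; first exact: nearW.
    exact: (@cvg_big R I *%R 1 xpredT (@mul_continuous R)).
  by apply/funext => K; rewrite truncated_product_expectation.
exact: (cvg_unique _ cv cv2).
Qed.

End independent_counts.

Section poisson_moments.
Context (R : realType) (mu : R).
Hypothesis mu0 : 0 <= mu.

Definition pmass (k : nat) : R := mu ^+ k / k`!%:R * expR (- mu).

Lemma poisson_prob_set1 k : poisson_prob mu 0 [set k] = (pmass k)%:E.
Proof.
rewrite /poisson_prob; case: ifPn => [m0|].
  by rewrite esum_set1 ?lee_fin ?poisson_pmf_ge0// /poisson_pmf m0.
rewrite -leNgt => m0; have mE : mu = 0 by apply/eqP; rewrite eq_le m0.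
rewrite diracE /pmass mE oppr0 expR0 mulr1.
case: k => [|k]; first by rewrite mem_set// expr0 fact0 divr1.
by rewrite memNset//= expr0n mul0r.
Qed.

Lemma pmass_sum : \sum_(k < K) pmass k @[K --> \oo] --> (1 : R).
Proof.
have : (fun K => (\sum_(k < K) mu ^+ k / k`!%:R) * expR (- mu)) K @[K --> \oo] --> expR mu * expR (- mu).
  apply: cvgMr_tmp.
  have := is_cvg_series_exp_coeff mu.
  rewrite /expR /series /exp_coeff /=.
  by under eq_fun do rewrite big_mkord; exact.
rewrite -expRD subrr expR0; apply: cvg_trans; apply: near_eq_cvg.
by apply: nearW => K /=; rewrite mulr_suml.
Qed.

(** The moments of order 0, 1 and 2 of the Poisson law; the value at higher orders
    is a dummy. *)
Definition pmoment (c : nat) : R :=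
  if c is c'.+1 then if c' is _.+1 then mu ^+ 2 + mu else mu else 1.

Lemma pmassS k : k.+1%:R * pmass k.+1 = mu * pmass k.
Proof.
rewrite /pmass factS natrM exprS; field.
by rewrite pnatr_eq0 -lt0n fact_gt0 addrC natr1 pnatr_eq0.
Qed.

Let moment1 : \sum_(k < K) k%:R ^+ 1 * pmass k @[K --> \oo] --> mu.
Proof.
rewrite -(cvg_shiftS (fun K => \sum_(k < K) k%:R ^+ 1 * pmass k)).
have -> : (fun K => \sum_(k < K.+1) k%:R ^+ 1 * pmass k) =
    (fun K => mu * \sum_(k < K) pmass k).
  apply/funext => K; rewrite big_ord_recl expr1 mul0r add0r mulr_sumr.
  by apply: eq_bigr => k _; rewrite expr1 -pmassS.
have : mu * (\sum_(k < K) pmass k) @[K --> \oo] --> mu * 1.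
  by apply: cvgMl_tmp; exact: pmass_sum.
by rewrite mulr1.
Qed.

Lemma pmass_moment c : (c <= 2)%N ->
  \sum_(k < K) k%:R ^+ c * pmass k @[K --> \oo] --> pmoment c.
Proof.
case: c => [_|[_|[_|//]]].
- by under eq_fun do under eq_bigr do rewrite expr0 mul1r; exact: pmass_sum.
- exact: moment1.
- rewrite -(cvg_shiftS (fun K => \sum_(k < K) k%:R ^+ 2 * pmass k)).
  have -> : (fun K => \sum_(k < K.+1) k%:R ^+ 2 * pmass k) = (fun K =>
      mu * (\sum_(k < K) k%:R ^+ 1 * pmass k + \sum_(k < K) pmass k)).
    apply/funext => K; rewrite big_ord_recl expr0n mul0r add0r -big_split mulr_sumr.
    apply: eq_bigr => k _; rewrite lift0 expr2 -mulrA pmassS -natr1 /=; ring.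
  rewrite /= (_ : mu ^+ 2 + mu = mu * (mu + 1)); last ring.
  by apply: cvgMl_tmp; apply: cvgD; [exact: moment1|exact: pmass_sum].
Qed.
End poisson_moments.

Lemma measurable_natr (R : realType) d (T : measurableType d) (N : T -> nat) :
  measurable_fun setT N -> measurable_fun setT (fun w => (N w)%:R : R).
Proof.
move=> mN; have mf : measurable_fun [set: nat] (fun n => n%:R : R) by [].
exact: (measurableT_comp mf mN).
Qed.

Section poisson_quadratic_form.
Context (R : realType) disp (Omega : measurableType disp) (P : probability Omega R).
Context (I : finType) (N : I -> Omega -> nat) (mu : I -> R).
Hypothesis mu0 : forall i, 0 <= mu i.
Hypothesis mN : forall i, measurable_fun [set: Omega] (N i).
Hypothesis indepN : forall k : I -> nat,
  P [set w | forall i, N i w = k i] = (\prod_i pmass (mu i) (k i))%:E.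

Lemma mixed_moment (c : I -> nat) : (forall i, (c i <= 2)%N) ->
  (\int[P]_w (\prod_i (N i w)%:R ^+ c i)%:E = (\prod_i pmoment (mu i) (c i))%:E)%E.
Proof.
move=> c2.
have h i : \sum_(k < K) k%:R ^+ c i * pmass (mu i) k @[K --> \oo] -->
  pmoment (mu i) (c i) by exact: pmass_moment.
have g0 (i : I) (k : nat) : 0 <= (k%:R ^+ c i : R) by exact: exprn_ge0.
exact: (product_expectation (p := fun i => pmass (mu i)) mN indepN g0 h).
Qed.

Lemma prod_count (J : finType) (F : J -> R) (s : seq J) :
  \prod_(j <- s) F j = \prod_j F j ^+ count_mem j s.
Proof.
elim: s => [|x s IH]; first by rewrite big_nil big1.
rewrite big_cons IH /=.
under [in RHS]eq_bigr do rewrite exprD.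
rewrite big_split/=; congr (_ * _).
by rewrite (bigD1 x)//= eqxx expr1 big1 ?mulr1// => j jx; rewrite eq_sym (negbTE jx).
Qed.

Lemma prod_subset (J : finType) (F : J -> R) (s : seq J) : uniq s ->
  (forall j, j \notin s -> F j = 1) -> \prod_j F j = \prod_(j <- s) F j.
Proof.
move=> us F1; rewrite [RHS]big_uniq//= [RHS]big_mkcond/=; apply: eq_bigr => j _.
by case: ifPn => // /F1.
Qed.

(** By independence, each count contributes the Poisson moment whose order is its
    multiplicity in the list. *)
Lemma list_moment (s r : seq I) : (forall i, (count_mem i s <= 2)%N) ->
  uniq r -> (forall i, i \notin r -> count_mem i s = 0%N) ->
  (\int[P]_w (\prod_(i <- s) (N i w)%:R)%:E =
    (\prod_(i <- r) pmoment (mu i) (count_mem i s))%:E)%E.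
Proof.
move=> s2 ur rs; under eq_integral do rewrite prod_count.
rewrite mixed_moment//; congr EFin; apply: prod_subset => // j jr.
by rewrite rs.
Qed.

Lemma moment2 i j : i != j ->
  (\int[P]_w ((N i w)%:R * (N j w)%:R)%:E = (mu i * mu j)%:E)%E.
Proof.
move=> ij; have := @list_moment [:: i; j] [:: i; j].
under eq_integral do rewrite !big_cons big_nil mulr1.
move=> ->.
- by rewrite !big_cons big_nil /= !eqxx (negbTE ij) eq_sym (negbTE ij) /= mulr1.
- by move=> k /=; do ! case: eqP => //=.
- by rewrite /= inE ij.
- by move=> k; rewrite !inE negb_or => /andP[/negbTE ki /negbTE kj];
    rewrite /= eq_sym ki eq_sym kj.
Qed.

(** As [i != j] and [k != l], coincidences only occur between the two pairs. Each
    one adds a summand with a factor less, since [pmoment mu 2 = mu ^+ 2 + mu]. *)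
Lemma moment4 i j k l : i != j -> k != l ->
  (\int[P]_w ((N i w)%:R * (N j w)%:R * ((N k w)%:R * (N l w)%:R))%:E =
   (mu i * mu j * (mu k * mu l)
   + (i == k)%:R * (mu i * mu j * mu l) + (i == l)%:R * (mu i * mu j * mu k)
   + (j == k)%:R * (mu i * mu j * mu l) + (j == l)%:R * (mu i * mu j * mu k)
   + (i == k)%:R * (j == l)%:R * (mu i * mu j)
   + (i == l)%:R * (j == k)%:R * (mu i * mu j))%:E)%E.
Proof.
move=> ij kl.
have E r : uniq r -> (forall x, x \notin r -> x \notin [:: i; j; k; l]) ->
  (\int[P]_w ((N i w)%:R * (N j w)%:R * ((N k w)%:R * (N l w)%:R))%:E =
    (\prod_(x <- r) pmoment (mu x) (count_mem x [:: i; j; k; l]))%:E)%E.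
  move=> ur rs; rewrite -(list_moment (s := [:: i; j; k; l]) _ ur).
  - by apply: eq_integral => w _; rewrite !big_cons big_nil mulr1 !mulrA.
  - move=> x /=.
    have h1 : ~~ ((i == x) && (j == x)).
      by apply: contra ij => /andP[/eqP -> /eqP ->].
    have h2 : ~~ ((k == x) && (l == x)).
      by apply: contra kl => /andP[/eqP -> /eqP ->].
    by move: h1 h2; case: (i == x); case: (j == x); case: (k == x); case: (l == x).
  - by move=> x /rs; rewrite -has_pred1 has_count -leqNgt leqn0 => /eqP.
have ne (x y : I) : x != y -> ((x == y) = false) * ((y == x) = false).
  by move=> xy; rewrite [y == x]eq_sym (negbTE xy).
have [ik|ik] := eqVneq i k.
  subst k; have [jl|jl] := eqVneq j l.
    subst l; rewrite (E [:: i; j]).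
    - by rewrite !big_cons big_nil /= !eqxx !(ne _ _ ij) /=; congr EFin; ring.
    - by rewrite /= inE ij.
    - by move=> x; rewrite !inE !negb_or => /andP[-> ->].
  rewrite (E [:: i; j; l]).
  - by rewrite !big_cons big_nil /= !eqxx !(ne _ _ ij) !(ne _ _ kl) !(ne _ _ jl) /=;
      congr EFin; ring.
  - by rewrite /= !inE negb_or ij kl jl.
  - by move=> x; rewrite !inE !negb_or => /and3P[-> -> ->].
have [il|il] := eqVneq i l.
  subst l; have [jk|jk] := eqVneq j k.
    subst k; rewrite (E [:: i; j]).
    - by rewrite !big_cons big_nil /= !eqxx !(ne _ _ ij) /=; congr EFin; ring.
    - by rewrite /= inE ij.
    - by move=> x; rewrite !inE !negb_or => /andP[-> ->].
  rewrite (E [:: i; j; k]).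
  - by rewrite !big_cons big_nil /= !eqxx !(ne _ _ ij) !(ne _ _ ik) !(ne _ _ jk) /=;
      congr EFin; ring.
  - by rewrite /= !inE negb_or ij ik jk.
  - by move=> x; rewrite !inE !negb_or => /and3P[-> -> ->].
have [jk|jk] := eqVneq j k.
  subst k; rewrite (E [:: i; j; l]).
  - by rewrite !big_cons big_nil /= !eqxx !(ne _ _ ij) !(ne _ _ il) !(ne _ _ kl) /=;
      congr EFin; ring.
  - by rewrite /= !inE negb_or ij il kl.
  - by move=> x; rewrite !inE !negb_or => /and3P[-> -> ->].
have [jl|jl] := eqVneq j l.
  subst l; rewrite (E [:: i; j; k]).
  - by rewrite !big_cons big_nil /= !eqxx !(ne _ _ ij) !(ne _ _ ik) !(ne _ _ jk) /=;
      congr EFin; ring.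
  - by rewrite /= !inE negb_or ij ik jk.
  - by move=> x; rewrite !inE !negb_or => /and3P[-> -> ->].
rewrite (E [:: i; j; k; l])//.
  by rewrite !big_cons big_nil /= !eqxx !(ne _ _ ij) !(ne _ _ ik) !(ne _ _ jk)
    !(ne _ _ il) !(ne _ _ jl) !(ne _ _ kl) /=; congr EFin; ring.
by rewrite /= !inE !negb_or ij ik il jk jl kl.
Qed.

Definition quad (a : I -> I -> R) (w : Omega) : R :=
  \sum_(q : I * I) a q.1 q.2 * ((N q.1 w)%:R * (N q.2 w)%:R).

Variables a b : I -> I -> R.
Hypothesis a0 : forall i j, 0 <= a i j.
Hypothesis b0 : forall i j, 0 <= b i j.
Hypothesis aii : forall i, a i i = 0.
Hypothesis bii : forall i, b i i = 0.
Hypothesis aC : forall i j, a i j = a j i.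
Hypothesis bC : forall i j, b i j = b j i.

Lemma measurable_quad : measurable_fun setT (quad a).
Proof.
apply: measurable_sum => q; apply: measurable_funM; first exact: measurable_cst.
by apply: measurable_funM; exact: measurable_natr.
Qed.

Lemma quad_ge0 w : 0 <= quad a w.
Proof. by apply: sumr_ge0 => q _; rewrite !mulr_ge0. Qed.

Lemma expectation_quad :
  (\int[P]_w (quad a w)%:E = (\sum_(q : I * I) a q.1 q.2 * (mu q.1 * mu q.2))%:E)%E.
Proof.
under eq_integral do rewrite /quad -sumEFin.
rewrite ge0_integral_sum//; last 2 first.
- move=> q; apply/measurable_EFinP; apply: measurable_funM; first exact: measurable_cst.
  by apply: measurable_funM; exact: measurable_natr.
- by move=> q w _; rewrite lee_fin !mulr_ge0.
rewrite -sumEFin; apply: eq_bigr => -[i j] _ /=.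
have [<-|ij] := eqVneq i j.
  by rewrite aii mul0r integral0_eq// => w _; rewrite mul0r.
under eq_integral do rewrite EFinM.
rewrite ge0_integralZl// ?moment2//.
- by apply/measurable_EFinP; apply: measurable_funM;
    exact: measurable_natr.
- by rewrite lee_fin.
Qed.

(** Expansion by [moment4]: the four single coincidences give equal sums by the
    symmetry of [a] and [b], and so do the two double coincidences. *)
Lemma expectation_quadM :
  (\int[P]_w (quad a w * quad b w)%:E =
   ((\sum_(q : I * I) a q.1 q.2 * (mu q.1 * mu q.2)) *
    (\sum_(q : I * I) b q.1 q.2 * (mu q.1 * mu q.2))
    + 4 * (\sum_i mu i * ((\sum_j a i j * mu j) * (\sum_j b i j * mu j)))
    + 2 * (\sum_(q : I * I) a q.1 q.2 * b q.1 q.2 * (mu q.1 * mu q.2)))%:E)%E.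
Proof.
have mm (q r : I * I) : measurable_fun setT (fun w => (N q.1 w)%:R * (N q.2 w)%:R *
    ((N r.1 w)%:R * (N r.2 w)%:R) : R).
  by apply: measurable_funM; apply: measurable_funM;
    exact: measurable_natr.
transitivity (\sum_(q : I * I) \sum_(r : I * I) a q.1 q.2 * b r.1 r.2 *
   (mu q.1 * mu q.2 * (mu r.1 * mu r.2)
   + (q.1 == r.1)%:R * (mu q.1 * mu q.2 * mu r.2) + (q.1 == r.2)%:R * (mu q.1 * mu q.2 * mu r.1)
   + (q.2 == r.1)%:R * (mu q.1 * mu q.2 * mu r.2) + (q.2 == r.2)%:R * (mu q.1 * mu q.2 * mu r.1)
   + (q.1 == r.1)%:R * (q.2 == r.2)%:R * (mu q.1 * mu q.2)
   + (q.1 == r.2)%:R * (q.2 == r.1)%:R * (mu q.1 * mu q.2)))%:E.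
  transitivity (\int[P]_w \sum_(q : I * I) \sum_(r : I * I)
     ((a q.1 q.2 * b r.1 r.2) * ((N q.1 w)%:R * (N q.2 w)%:R *
       ((N r.1 w)%:R * (N r.2 w)%:R)))%:E)%E.
    apply: eq_integral => w _; rewrite /quad big_distrlr/= -sumEFin.
    apply: eq_bigr => q _; rewrite -sumEFin; apply: eq_bigr => r _.
    by congr EFin; ring.
  have m1 (q r : I * I) : measurable_fun setT (fun w => ((a q.1 q.2 * b r.1 r.2) *
      ((N q.1 w)%:R * (N q.2 w)%:R * ((N r.1 w)%:R * (N r.2 w)%:R)))%:E).
    by apply/measurable_EFinP; apply: measurable_funM.
  have p1 (q r : I * I) w : (0 <= ((a q.1 q.2 * b r.1 r.2) *
      ((N q.1 w)%:R * (N q.2 w)%:R * ((N r.1 w)%:R * (N r.2 w)%:R)))%:E)%E.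
    by rewrite lee_fin !mulr_ge0.
  rewrite ge0_integral_sum//; last 2 first.
  - by move=> q; exact: emeasurable_sum.
  - by move=> q w _; apply: sume_ge0.
  rewrite -sumEFin; apply: eq_bigr => -[i j] _.
  rewrite ge0_integral_sum// -sumEFin; apply: eq_bigr => -[k l] _ /=.
  have [<-|ij] := eqVneq i j.
    by rewrite aii !mul0r integral0_eq// => w _; rewrite !mul0r.
  have [<-|kl] := eqVneq k l.
    by rewrite bii mulr0 !mul0r integral0_eq// => w _; rewrite mul0r.
  under eq_integral do rewrite EFinM.
  rewrite ge0_integralZl// ?moment4//.
  - by apply/measurable_EFinP; exact: (mm (i, j) (k, l)).
  - by rewrite lee_fin mulr_ge0.
congr EFin.
pose T1 := \sum_i mu i * ((\sum_j a i j * mu j) * (\sum_j b i j * mu j)).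
pose T2 := \sum_(q : I * I) a q.1 q.2 * b q.1 q.2 * (mu q.1 * mu q.2).
(* a Kronecker delta collapses one of the sums *)
have col (J : finType) (x : J) (F : J -> R) : \sum_y (x == y)%:R * F y = F x.
  rewrite (bigD1 x)//= eqxx mul1r big1 ?addr0// => y yx.
  by rewrite eq_sym (negbTE yx) mul0r.
have pairE (F : I -> I -> R) : \sum_(q : I * I) F q.1 q.2 = \sum_i \sum_j F i j.
  by rewrite pair_big.
have T1E : T1 = \sum_i \sum_j \sum_k mu i * mu j * mu k * (a i j * b i k).
  apply: eq_bigr => i _; rewrite big_distrlr mulr_sumr/=; apply: eq_bigr => j _.
  by rewrite mulr_sumr; apply: eq_bigr => k _; ring.
have one i j x : \sum_(r : I * I) a i j * b r.1 r.2 * ((x == r.1)%:R * (mu i * mu j * mu r.2))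
    = \sum_k mu i * mu j * mu k * (a i j * b x k).
  rewrite (pairE (fun k l => a i j * b k l * ((x == k)%:R * (mu i * mu j * mu l)))).
  rewrite exchange_big /=; apply: eq_bigr => l _.
  rewrite -(col _ x (fun k => mu i * mu j * mu l * (a i j * b k l))).
  by apply: eq_bigr => k _; ring.
have two i j x : \sum_(r : I * I) a i j * b r.1 r.2 * ((x == r.2)%:R * (mu i * mu j * mu r.1))
    = \sum_k mu i * mu j * mu k * (a i j * b x k).
  rewrite (pairE (fun k l => a i j * b k l * ((x == l)%:R * (mu i * mu j * mu k)))).
  apply: eq_bigr => k _; rewrite (bC x k).
  rewrite -(col _ x (fun l => mu i * mu j * mu k * (a i j * b k l))).
  by apply: eq_bigr => l _; ring.
have four x y i j : \sum_(r : I * I) a i j * b r.1 r.2 *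
    ((x == r.1)%:R * (y == r.2)%:R * (mu i * mu j)) = a i j * b x y * (mu i * mu j).
  rewrite (pairE (fun k l => a i j * b k l * ((x == k)%:R * (y == l)%:R * (mu i * mu j)))).
  rewrite -(col _ x (fun k => a i j * b k y * (mu i * mu j))).
  apply: eq_bigr => k _; rewrite -(col _ y (fun l => a i j * b k l * (mu i * mu j))) mulr_sumr.
  by apply: eq_bigr => l _; ring.
have T1a : \sum_(q : I * I) \sum_k mu q.1 * mu q.2 * mu k * (a q.1 q.2 * b q.1 k) = T1.
  by rewrite T1E (pairE (fun i j => \sum_k mu i * mu j * mu k * (a i j * b i k))).
have T1b : \sum_(q : I * I) \sum_k mu q.1 * mu q.2 * mu k * (a q.1 q.2 * b q.2 k) = T1.
  rewrite T1E (pairE (fun i j => \sum_k mu i * mu j * mu k * (a i j * b j k))).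
  rewrite exchange_big; apply: eq_bigr => i _; apply: eq_bigr => j _ /=.
  by apply: eq_bigr => k _; rewrite (aC j i); ring.
transitivity (\sum_(q : I * I) (
    \sum_(r : I * I) (a q.1 q.2 * (mu q.1 * mu q.2)) * (b r.1 r.2 * (mu r.1 * mu r.2))
  + \sum_k mu q.1 * mu q.2 * mu k * (a q.1 q.2 * b q.1 k)
  + \sum_k mu q.1 * mu q.2 * mu k * (a q.1 q.2 * b q.1 k)
  + \sum_k mu q.1 * mu q.2 * mu k * (a q.1 q.2 * b q.2 k)
  + \sum_k mu q.1 * mu q.2 * mu k * (a q.1 q.2 * b q.2 k)
  + a q.1 q.2 * b q.1 q.2 * (mu q.1 * mu q.2)
  + a q.1 q.2 * b q.2 q.1 * (mu q.1 * mu q.2))).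
  apply: eq_bigr => q _.
  rewrite -{1}(one q.1 q.2 q.1) -{1}(two q.1 q.2 q.1) -{1}(one q.1 q.2 q.2) -{1}(two q.1 q.2 q.2).
  rewrite -(four q.1 q.2 q.1 q.2) -(four q.2 q.1 q.1 q.2) -!big_split/=.
  by apply: eq_bigr => r _; ring.
rewrite !big_split /= T1a T1b -/T1.
rewrite big_distrlr/= -/T2.
rewrite [X in _ + X = _](_ : _ = T2); last first.
  by apply: eq_bigr => q _; rewrite (bC q.2 q.1).
ring.
Qed.

End poisson_quadratic_form.

(** * Approximation of kernels by step kernels *)

Section cells.
Context (R : realType) (d : nat).

Definition base : nat -> set 'rV[R]_d := sval (cid (rV_countable_base R d)).

Lemma open_base n : open (base n).
Proof. by rewrite /base; case: cid => U /= []. Qed.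

Lemma base_nbhs O x : open O -> O x -> exists2 n, base n x & base n `<=` O.
Proof. by rewrite /base; case: cid => U /= [_]; exact. Qed.

(** The [n]-th partition is generated by the first [n] sets of a countable base:
    the label of a point says in which of them it lies. These partitions are
    finite and nested, and a neighbourhood of a point contains its cells from
    some [n] on. *)
Definition cell n (x : 'rV[R]_d) : {ffun 'I_n -> bool} := [ffun k : 'I_n => `[< base k x >]].

Lemma cell_base n k x y : (k < n)%N -> cell n x = cell n y -> base k x -> base k y.
Proof.
move=> kn /ffunP/(_ (Ordinal kn)); rewrite !ffunE /= => xy bx.
by apply/asboolP; rewrite -xy; apply/asboolP.
Qed.

Lemma cell_le n m x y : (n <= m)%N -> cell m x = cell m y -> cell n x = cell n y.
Proof.
move=> nm /ffunP xy; apply/ffunP => k; rewrite !ffunE.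
by have := xy (widen_ord nm k); rewrite !ffunE.
Qed.

Lemma borel_cell n i : borel [set x | cell n x = i].
Proof.
rewrite (_ : [set _ | _] = \bigcap_(k in [set: 'I_n])
  (if i k then base k else ~` base k)).
  apply: (@fin_bigcap_measurable _ (mrV R d)) => [|k _]; first exact: finite_finset.
  by case: ifP => _; [|apply: borelC]; apply: open_borel; exact: open_base.
apply/seteqP; split=> x /=.
  move=> <- k _; rewrite ffunE; case: asboolP => //.
move=> h; apply/ffunP => k; rewrite ffunE; have := h k I.
by case: (i k) => bk; [apply/asboolP|apply/asboolPn].
Qed.

Lemma measurable_cell (h : forall n, {ffun 'I_n -> bool} -> R) n D :
  measurable_fun D (fun x : mrV R d => h n (cell n x)).
Proof.
move=> mD; apply: (measurable_funS measurableT (@subsetT _ _)) mD => _ B mB.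
rewrite setTI (_ : _ @^-1` _ = \bigcup_(i in [set i | B (h n i)]) [set x | cell n x = i]).
  apply: fin_bigcup_measurable => [|i _]; first exact: finite_finset.
  exact: borel_cell.
by apply/seteqP; split=> [x Bx|x [i Bi /= xi]]; [exists (cell n x)|rewrite /= xi].
Qed.

Variable f : 'rV[R]_d -> 'rV[R]_d -> R.
Hypothesis f0 : forall x y, 0 <= f x y.
Hypothesis fxx : forall x, f x x = 0.
Hypothesis fC : forall x y, f x y = f y x.

(** Joint lower semicontinuity. *)
Definition lsc_kernel (f : 'rV[R]_d -> 'rV[R]_d -> R) := forall x y a, a < f x y ->
  exists Q1 Q2, [/\ open Q1, open Q2, Q1 x, Q2 y &
    forall x' y', Q1 x' -> Q2 y' -> a < f x' y'].

Definition cell_values n (i j : {ffun 'I_n -> bool}) : set R :=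
  [set r | exists x y, [/\ cell n x = i, cell n y = j & r = f x y]].

Definition cell_inf n i j : R := inf (@cell_values n i j).

Let lb n i j : has_lbound (@cell_values n i j).
Proof. by exists 0 => _ [x [y [_ _ ->]]]. Qed.

Lemma cell_inf_ge0 n i j : 0 <= @cell_inf n i j.
Proof.
have [ne|/set0P/negP/negPn/eqP e0] := pselect (@cell_values n i j !=set0).
  by apply: lb_le_inf => // _ [x [y [_ _ ->]]].
by rewrite /cell_inf e0 inf0.
Qed.

Lemma cell_inf_diag n i : @cell_inf n i i = 0.
Proof.
apply/eqP; rewrite eq_le cell_inf_ge0 andbT.
have [[_ [x [_ [xi _ _]]]]|/set0P/negP/negPn/eqP e0] := pselect (@cell_values n i i !=set0).
  by rewrite -(fxx x); apply: ge_inf => //; exists x, x.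
by rewrite /cell_inf e0 inf0.
Qed.

Lemma cell_infC n i j : @cell_inf n i j = cell_inf j i.
Proof.
rewrite /cell_inf; congr inf; apply/seteqP.
by split=> _ [x [y [xi yj ->]]]; exists y, x; split => //; rewrite fC.
Qed.

Definition step n x y := cell_inf (cell n x) (cell n y).

Lemma step_ge0 n x y : 0 <= step n x y.
Proof. exact: cell_inf_ge0. Qed.

Lemma step_le_kernel n x y : step n x y <= f x y.
Proof. by apply: ge_inf => //; exists x, y. Qed.

Lemma step_nondecreasing x y n m : (n <= m)%N -> step n x y <= step m x y.
Proof.
move=> nm; apply: lb_le_inf; first by exists (f x y), x, y.
move=> _ [x' [y' [xx yy ->]]]; apply: ge_inf => //.
by exists x', y'; split => //; exact: cell_le nm _.
Qed.

(** Near a pair of points the kernel is not much smaller than at the pair, and the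
    cells of the two points eventually lie that near. *)
Lemma step_cvg x y : lsc_kernel f -> step n x y @[n --> \oo] --> f x y.
Proof.
move=> lf; apply/cvgrPdist_le => e e0.
have [|Q1 [Q2 [nq1 nq2 x1 y2 h]]] := lf x y (f x y - e); first by rewrite ltrBlDr ltrDl.
have [k1 kx k1O] := base_nbhs nq1 x1; have [k2 ky k2O] := base_nbhs nq2 y2.
exists (maxn k1 k2).+1 => // n /= kn.
rewrite ger0_norm ?subr_ge0 ?step_le_kernel// lerBlDr addrC -lerBlDr.
apply: lb_le_inf; first by exists (f x y), x, y.
move=> _ [x' [y' [xx yy ->]]]; rewrite ltW// h//.
  by apply: k1O; apply: cell_base (esym xx) kx; rewrite (leq_ltn_trans _ kn)// leq_maxl.
by apply: k2O; apply: cell_base (esym yy) ky; rewrite (leq_ltn_trans _ kn)// leq_maxr.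
Qed.

End cells.

(** * Second moments of pair sums of a Poisson process *)

Section pairsum.
Context (R : realType) (d : nat).
Implicit Types (X : {fset 'rV[R]_d}) (f : 'rV[R]_d -> 'rV[R]_d -> R).

Definition pairsum f X : R := \sum_(x <- X) \sum_(y <- X) f x y.

Lemma npointsE X (A : set 'rV[R]_d) : npoints X A = (\sum_(x <- X) (x \in A))%N.
Proof.
rewrite /npoints card_fset_sum1 -big_fset_condE [LHS]big_mkcond /=.
by apply: eq_bigr => x _; case: (x \in A).
Qed.

Lemma sum_by_cell (I : finType) (c : 'rV[R]_d -> I) (W : set 'rV[R]_d) X (h : I -> R) :
  (forall x, x \in X -> W x) ->
  \sum_(x <- X) h (c x) = \sum_i h i * (npoints X [set x | W x /\ c x = i])%:R.
Proof.
move=> XW; transitivity (\sum_i \sum_(x <- X) h i * (x \in [set x | W x /\ c x = i])%:R).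
  rewrite exchange_big /= big_seq [RHS]big_seq; apply: eq_bigr => x xX.
  rewrite (bigD1 (c x))//= mem_set ?mulr1 ?big1 ?addr0//; last by split=> //; exact: XW.
  by move=> i ix; rewrite memNset ?mulr0// => -[_ /= xi]; rewrite xi eqxx in ix.
by apply: eq_bigr => i _; rewrite npointsE natr_sum mulr_sumr.
Qed.

End pairsum.

Section poisson_second_moment.
Context (R : realType) (d : nat) (disp : measure_display)
  (Omega : measurableType disp) (P : probability Omega R).
Variables (W : set 'rV[R]_d) (t : R) (eta : Omega -> {fset 'rV[R]_d}).
Hypothesis cW : compact W.
Hypothesis t0 : 0 < t.
Hypothesis etaP : poisson_process P W t eta.

Let bW : borel W. Proof. exact: compact_borel. Qed.

Definition wcell n (i : {ffun 'I_n -> bool}) : set 'rV[R]_d := [set x | W x /\ cell n x = i].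

Lemma borel_wcell n (i : {ffun 'I_n -> bool}) : borel (wcell i).
Proof. by apply: borelI => //; exact: borel_cell. Qed.

Lemma finb_wcell n (i : {ffun 'I_n -> bool}) : finb (wcell i).
Proof. by apply: (finb_sub (borel_wcell i) (finb_compact cW)) => x []. Qed.

Definition count_in n (i : {ffun 'I_n -> bool}) w := npoints (eta w) (wcell i).

Definition rate n (i : {ffun 'I_n -> bool}) : R := t * mes (wcell i).

Lemma rate_ge0 n (i : {ffun 'I_n -> bool}) : 0 <= rate i.
Proof. by rewrite mulr_ge0 ?mes_ge0// ltW. Qed.

Lemma measurable_count n (i : {ffun 'I_n -> bool}) : measurable_fun setT (count_in i).
Proof. by case: etaP => _ + _ _; apply; [exact: borel_wcell|move=> x []]. Qed.

Lemma count_indep n (k : {ffun 'I_n -> bool} -> nat) :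
  P [set w | forall i, count_in i w = k i] = (\prod_i pmass (rate i) (k i))%:E.
Proof.
case: etaP => _ _ law ind.
pose J := {ffun 'I_n -> bool}.
have := ind #|J| (fun j => wcell (enum_val j)).
have disj (i j : 'I_#|J|) : i != j -> wcell (enum_val i) `&` wcell (enum_val j) = set0.
  move=> ij; rewrite -subset0 => x [[_ xi] [_ xj]]; move: ij.
  by rewrite -(inj_eq enum_val_inj) -xi -xj eqxx.
move=> /(_ _ disj) h.
have {}h := h (fun i => conj (borel_wcell _) (fun x => @proj1 _ _)).
have {h} := h (fun j => [set k (enum_val j)]).
rewrite (_ : [set w | forall i : 'I_#|J|, _] = [set w | forall i : J, count_in i w = k i]); last first.
  apply/seteqP; split=> w /= h i; last exact: h.
  by have := h (enum_rank i); rewrite enum_rankK.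
move=> ->.
rewrite (reindex (fun j : 'I_#|J| => enum_val j)) /=; last first.
  by exists enum_rank => j _; rewrite ?enum_valK ?enum_rankK.
rewrite -prodEFin; apply: eq_bigr => j _.
rewrite -poisson_prob_set1; last exact: rate_ge0.
rewrite /rate /mes (@vmE R d); last exact: borel_wcell.
apply: (law (wcell (enum_val j)) _ _ [set k (enum_val j)]); first exact: borel_wcell.
by move=> x [].
Qed.

Lemma integral_cell n (h : {ffun 'I_n -> bool} -> R) : (forall i, 0 <= h i) ->
  (\int[vm R d]_(x in W) (h (cell n x))%:E = (\sum_i h i * mes (wcell i))%:E)%E.
Proof.
move=> h0; transitivity (\int[vm R d]_(x in W) (\sum_i (h i)%:E * (\1_(wcell i) x)%:E))%E.
  apply: eq_integral => x /set_mem Wx; rewrite (bigD1 (cell n x))//= indicE mem_set//.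
  rewrite mule1 big1 ?adde0// => i ix; rewrite indicE memNset ?mule0// => -[_ /= xi].
  by rewrite xi eqxx in ix.
rewrite ge0_integral_sum//; last 2 first.
- move=> i; apply: measurable_funeM; apply/measurable_EFinP.
  by apply: measurable_indic; exact: borel_wcell.
- by move=> i x _; rewrite mule_ge0// lee_fin.
rewrite -sumEFin; apply: eq_bigr => i _.
rewrite ge0_integralZl//; last 2 first.
- by apply/measurable_EFinP; apply: measurable_indic; exact: borel_wcell.
- by rewrite lee_fin.
rewrite integral_indic//; last exact: borel_wcell.
rewrite setIidl; last by move=> x [].
by rewrite EFinM mesE//; exact: finb_wcell.
Qed.

Section one_kernel.
Variable f : 'rV[R]_d -> 'rV[R]_d -> R.
Hypothesis f0 : forall x y, 0 <= f x y.
Hypothesis fxx : forall x, f x x = 0.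
Hypothesis fC : forall x y, f x y = f y x.
Hypothesis lf : lsc_kernel f.

Definition qf n := quad (@count_in n) (fun i j => cell_inf f i j).

(** Counting the points in each cell turns the pair sum of a step kernel into a
    quadratic form in independent Poisson counts. *)
Lemma quad_pairsum n w : qf n w = pairsum (step f n) (eta w).
Proof.
have etaW : forall x, x \in eta w -> W x by case: etaP => + _ _ _; exact.
rewrite /pairsum /step.
under [RHS]eq_bigr => x _.
  rewrite (sum_by_cell (cell n) (fun j => cell_inf f (cell n x) j) etaW).
  over.
rewrite (sum_by_cell (cell n)
  (fun i => \sum_j cell_inf f i j * (npoints (eta w) [set x | W x /\ cell n x = j])%:R) etaW).
rewrite /qf /quad -(pair_big xpredT xpredT (fun i j => cell_inf f i j *
   ((count_in i w)%:R * (count_in j w)%:R)))/=.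
apply: eq_bigr => i _; rewrite mulr_suml; apply: eq_bigr => j _.
by rewrite -mulrA [X in _ * X = _]mulrC.
Qed.

Lemma pairsum_ge0 X : 0 <= pairsum f X.
Proof. by apply: sumr_ge0 => x _; apply: sumr_ge0. Qed.

Lemma quad_cvg w : qf n w @[n --> \oo] --> pairsum f (eta w).
Proof.
under eq_fun do rewrite quad_pairsum.
apply: (@cvg_big _ _ +%R 0 xpredT (@add_continuous R)) => x _.
apply: (@cvg_big _ _ +%R 0 xpredT (@add_continuous R)) => y _.
exact: step_cvg.
Qed.

Lemma quad_nondecreasing w n m : (n <= m)%N -> qf n w <= qf m w.
Proof.
move=> nm; rewrite !quad_pairsum; apply: ler_sum => x _; apply: ler_sum => y _.
exact: step_nondecreasing.
Qed.

Lemma measurable_qf n : measurable_fun setT (qf n).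
Proof. by apply: measurable_quad; exact: measurable_count. Qed.

Lemma measurable_pairsum : measurable_fun setT (fun w => pairsum f (eta w)).
Proof.
apply: (measurable_fun_cvg measurable_qf) => w _; exact: quad_cvg.
Qed.

End one_kernel.

Section cell_kernel.
Variable A : forall n, {ffun 'I_n -> bool} -> {ffun 'I_n -> bool} -> R.
Variable f : 'rV[R]_d -> 'rV[R]_d -> R.
Let K n (x y : 'rV[R]_d) : R := A (cell n x) (cell n y).
Hypothesis A0 : forall n (i j : {ffun 'I_n -> bool}), 0 <= A i j.
Hypothesis K_nd : forall x y n m, (n <= m)%N -> K n x y <= K m x y.
Hypothesis Kf : forall x y, K n x y @[n --> \oo] --> f x y.

Definition marginal (h : 'rV[R]_d -> 'rV[R]_d -> R) x : \bar R :=
  (\int[vm R d]_(y in W) (h x y)%:E)%E.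

Definition double (h : 'rV[R]_d -> 'rV[R]_d -> R) : \bar R :=
  (\int[vm R d]_(x in W) marginal h x)%E.

Let measurable_K n x D : measurable_fun D (fun y : mrV R d => (K n x y)%:E).
Proof.
apply/measurable_EFinP.
exact: (measurable_cell (fun n j => A (cell n x) j)).
Qed.

Lemma marginal_cellE n x : marginal (K n) x =
  (\sum_j A (cell n x) j * mes (wcell j))%:E.
Proof. by apply: integral_cell => j. Qed.

Lemma marginal_cell_cvg x : marginal (K n) x @[n --> \oo] --> marginal f x.
Proof.
apply: monotone_convergence_cvg => //.
- by move=> n y _; rewrite lee_fin A0.
- by move=> y _ n m nm; rewrite lee_fin K_nd.
- by move=> y _; apply: cvg_EFin; [exact: nearW|exact: Kf].
Qed.

Lemma marginal_cell_ge0 n x : (0 <= marginal (K n) x)%E.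
Proof. by apply: integral_ge0 => y _; rewrite lee_fin A0. Qed.

Lemma marginal_cell_nd x n m : (n <= m)%N -> (marginal (K n) x <= marginal (K m) x)%E.
Proof.
move=> nm; apply: ge0_le_integral => //.
- by move=> y _; rewrite lee_fin A0.
- by move=> y _; rewrite lee_fin K_nd.
Qed.

Lemma measurable_marginal_cell n D :
  measurable_fun D (fun x : mrV R d => marginal (K n) x).
Proof.
apply: (eq_measurable_fun (fun x : mrV R d =>
  (\sum_j A (cell n x) j * mes (wcell j))%:E)) => [x _|]; first by rewrite marginal_cellE.
apply/measurable_EFinP.
exact: (measurable_cell (fun n i => \sum_j A i j * mes (wcell j))).
Qed.

Lemma measurable_marginal_lim D : measurable_fun D (fun x : mrV R d => marginal f x).
Proof.
apply: (@emeasurable_fun_cvg _ (mrV R d) R D (fun n (x : mrV R d) => marginal (K n) x)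
  (fun x : mrV R d => marginal f x)) => [n|x _].
  exact: measurable_marginal_cell.
exact: marginal_cell_cvg.
Qed.

Lemma double_cellE n : double (K n) =
  (\sum_(q : {ffun 'I_n -> bool} * {ffun 'I_n -> bool})
     A q.1 q.2 * (mes (wcell q.1) * mes (wcell q.2)))%:E.
Proof.
rewrite /double; under eq_integral do rewrite marginal_cellE.
rewrite (integral_cell (h := fun i => \sum_j A i j * mes (wcell j))); last first.
  by move=> i; apply: sumr_ge0 => j _; rewrite mulr_ge0 ?mes_ge0.
congr EFin; rewrite -(pair_big xpredT xpredT (fun i j => A i j *
   (mes (wcell i) * mes (wcell j))))/=.
by apply: eq_bigr => i _; rewrite mulr_suml; apply: eq_bigr => j _; ring.
Qed.

Lemma double_cell_cvg : double (K n) @[n --> \oo] --> double f.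
Proof.
apply: monotone_convergence_cvg => //.
- by move=> n; exact: measurable_marginal_cell.
- by move=> n x _; exact: marginal_cell_ge0.
- by move=> x _ n m; exact: marginal_cell_nd.
- by move=> x _; exact: marginal_cell_cvg.
Qed.

Lemma double_rate_cvg :
  (\sum_(q : {ffun 'I_n -> bool} * {ffun 'I_n -> bool})
     A q.1 q.2 * (rate q.1 * rate q.2))%:E @[n --> \oo] -->
  ((t ^+ 2)%:E * double f)%E.
Proof.
rewrite (_ : (fun n => _) = (fun n => (t ^+ 2)%:E * double (K n))%E).
  by apply: cvgeZl => //; exact: double_cell_cvg.
apply/funext => n; rewrite double_cellE -EFinM; congr EFin.
by rewrite mulr_sumr; apply: eq_bigr => q _; rewrite /rate; ring.
Qed.

End cell_kernel.

Lemma marginal_ge0 f x : (forall x y, 0 <= f x y) -> (0 <= marginal f x)%E.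
Proof. by move=> f0; apply: integral_ge0 => y _; rewrite lee_fin. Qed.

Section two_kernels.
Variables f g : 'rV[R]_d -> 'rV[R]_d -> R.
Hypotheses (f0 : forall x y, 0 <= f x y) (g0 : forall x y, 0 <= g x y).
Hypotheses (fxx : forall x, f x x = 0) (gxx : forall x, g x x = 0).
Hypotheses (fC : forall x y, f x y = f y x) (gC : forall x y, g x y = g y x).
Hypotheses (lf : lsc_kernel f) (lg : lsc_kernel g).

Let fA0 n (i j : {ffun 'I_n -> bool}) : 0 <= cell_inf f i j.
Proof. exact: cell_inf_ge0. Qed.
Let gA0 n (i j : {ffun 'I_n -> bool}) : 0 <= cell_inf g i j.
Proof. exact: cell_inf_ge0. Qed.

(** For step kernels this is [expectation_quad], and both sides pass to the limit
    by monotone convergence. The coefficients vanish on the diagonal because the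
    kernel does: a point is not paired with itself. *)
Lemma expectation_pairsum :
  (\int[P]_w (pairsum f (eta w))%:E = (t ^+ 2)%:E * double f)%E.
Proof.
have c1 : (\int[P]_w (qf f n w)%:E)%E @[n --> \oo] -->
    (\int[P]_w (pairsum f (eta w))%:E)%E.
  apply: monotone_convergence_cvg => //.
  - by move=> n; apply/measurable_EFinP; exact: measurable_qf.
  - by move=> n w _; rewrite lee_fin; apply: quad_ge0.
  - by move=> w _ n m nm; rewrite lee_fin quad_nondecreasing.
  - by move=> w _; apply: cvg_EFin; [exact: nearW|exact: quad_cvg].
have sf x y : step f n x y @[n --> \oo] --> f x y by exact: step_cvg.
have ndf x y n m : (n <= m)%N -> step f n x y <= step f m x y.
  exact: step_nondecreasing.
have c2 := @double_rate_cvg (fun n i j => cell_inf f i j) f fA0 ndf sf.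
suff cE : (fun n => \int[P]_w (qf f n w)%:E)%E = (fun n =>
    (\sum_(q : {ffun 'I_n -> bool} * {ffun 'I_n -> bool})
     cell_inf f q.1 q.2 * (rate q.1 * rate q.2))%:E).
  by rewrite cE in c1; exact: (cvg_unique _ c1 c2).
apply/funext => n; rewrite (expectation_quad (mu := @rate n))//.
- exact: measurable_count.
- exact: count_indep.
- by move=> i; exact: cell_inf_diag.
Qed.

Hypothesis ff : exists C : R, forall x, (marginal f x <= C%:E)%E.
Hypothesis gf : exists C : R, forall x, (marginal g x <= C%:E)%E.

Lemma double_fin h : (forall x y, 0 <= h x y) -> lsc_kernel h ->
  (exists C : R, forall x, (marginal h x <= C%:E)%E) -> double h \is a fin_num.
Proof.
move=> h0 lh [C hC]; rewrite ge0_fin_numE; last first.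
  by apply: integral_ge0 => x _; exact: marginal_ge0.
have C0 : 0 <= C by rewrite -lee_fin (le_trans _ (hC 0))// marginal_ge0.
apply: (@le_lt_trans _ _ (\int[vm R d]_(x in W) C%:E)%E).
  apply: ge0_le_integral => //.
  - by move=> x _; exact: marginal_ge0.
  - apply: (@measurable_marginal_lim (fun n i j => cell_inf h i j)).
    + by move=> n i j; exact: cell_inf_ge0.
    + by move=> x y n m; exact: step_nondecreasing.
    + by move=> x y; exact: step_cvg.
rewrite integral_cst// lte_mul_pinfty ?lee_fin//.
exact: vm_compact_lty.
Qed.

(** The limit of [expectation_quadM] along the step kernels. Two pairs share no
    point, one point or both points, which gives the three terms; 4 and 2 count
    the ways in which ordered pairs share one or two points. *)
Lemma expectation_pairsumM :
  (\int[P]_w (pairsum f (eta w) * pairsum g (eta w))%:E =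
   ((t ^+ 2)%:E * double f) * ((t ^+ 2)%:E * double g)
   + (4 * t ^+ 3)%:E * \int[vm R d]_(x in W) (marginal f x * marginal g x)
   + (2 * t ^+ 2)%:E * double (fun x y => f x y * g x y)%R)%E.
Proof.
have c1 : (\int[P]_w (qf f n w * qf g n w)%:E)%E @[n --> \oo] -->
    (\int[P]_w (pairsum f (eta w) * pairsum g (eta w))%:E)%E.
  apply: monotone_convergence_cvg => //.
  - by move=> n; apply/measurable_EFinP; apply: measurable_funM; exact: measurable_qf.
  - by move=> n w _; rewrite lee_fin; apply: mulr_ge0; apply: quad_ge0.
  - move=> w _ n m nm; rewrite lee_fin; apply: ler_pM; try exact: quad_nondecreasing;
    by apply: quad_ge0.
  - move=> w _; apply: cvg_EFin; first exact: nearW.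
    by apply: cvgM; exact: quad_cvg.
have sf x y : step f n x y @[n --> \oo] --> f x y by exact: step_cvg.
have sg x y : step g n x y @[n --> \oo] --> g x y by exact: step_cvg.
have ndf x y n m : (n <= m)%N -> step f n x y <= step f m x y.
  exact: step_nondecreasing.
have ndg x y n m : (n <= m)%N -> step g n x y <= step g m x y.
  exact: step_nondecreasing.
have cf := @double_rate_cvg (fun n i j => cell_inf f i j) f fA0 ndf sf.
have cg := @double_rate_cvg (fun n i j => cell_inf g i j) g gA0 ndg sg.
have cfg : (\sum_(q : {ffun 'I_n -> bool} * {ffun 'I_n -> bool})
     cell_inf f q.1 q.2 * cell_inf g q.1 q.2 * (rate q.1 * rate q.2))%:E @[n --> \oo] -->
    ((t ^+ 2)%:E * double (fun x y => f x y * g x y)%R)%E.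
  apply: (@double_rate_cvg (fun n i j => cell_inf f i j * cell_inf g i j)
    (fun x y => f x y * g x y)).
  - by move=> n i j; apply: mulr_ge0.
  - by move=> x y n m nm; apply: ler_pM; [exact: step_ge0|exact: step_ge0|exact: ndf|exact: ndg].
  - by move=> x y; apply: cvgM; [exact: sf|exact: sg].
have ct : (\sum_(i : {ffun 'I_n -> bool}) rate i * ((\sum_j cell_inf f i j * rate j) *
     (\sum_j cell_inf g i j * rate j)))%:E @[n --> \oo] -->
   ((t ^+ 3)%:E * \int[vm R d]_(x in W) (marginal f x * marginal g x))%E.
  rewrite (_ : (fun n => _) = (fun n => (t ^+ 3)%:E *
     \int[vm R d]_(x in W) (marginal (step f n) x * marginal (step g n) x))%E); last first.
    apply/funext => n; under eq_integral => x _.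
      rewrite (@marginal_cellE (fun n i j => cell_inf f i j) fA0 n x).
      rewrite (@marginal_cellE (fun n i j => cell_inf g i j) gA0 n x).
      rewrite -EFinM; over.
    rewrite (integral_cell (h := fun i => (\sum_j cell_inf f i j * mes (wcell j)) *
       (\sum_j cell_inf g i j * mes (wcell j)))); last first.
      by move=> i; apply: mulr_ge0; apply: sumr_ge0 => j _; rewrite mulr_ge0 ?mes_ge0.
    rewrite -EFinM; congr EFin; rewrite mulr_sumr; apply: eq_bigr => i _.
    have rE (h : {ffun 'I_n -> bool} -> R) :
        \sum_j h j * rate j = t * \sum_j h j * mes (wcell j).
      by rewrite mulr_sumr; apply: eq_bigr => j _; rewrite /rate; ring.
    by rewrite !rE /rate; ring.
  apply: cvgeZl => //; apply: monotone_convergence_cvg => //.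
  - move=> n; apply: emeasurable_funM.
      exact: (@measurable_marginal_cell (fun n i j => cell_inf f i j) fA0).
    exact: (@measurable_marginal_cell (fun n i j => cell_inf g i j) gA0).
  - move=> n x _; apply: mule_ge0; apply: marginal_ge0 => *; exact: step_ge0.
  - move=> x _ n m nm; apply: lee_pmul.
    + by apply: marginal_ge0 => *; exact: step_ge0.
    + by apply: marginal_ge0 => *; exact: step_ge0.
    + exact: (@marginal_cell_nd (fun n i j => cell_inf f i j) fA0 ndf).
    + exact: (@marginal_cell_nd (fun n i j => cell_inf g i j) gA0 ndg).
  - move=> x _; apply: cvgeM.
    + have [Cf fC'] := ff; have [Cg gC'] := gf.
      by apply: mule_def_fin; rewrite ge0_fin_numE ?marginal_ge0//;
        [apply: le_lt_trans (fC' x) _|apply: le_lt_trans (gC' x) _]; rewrite ltry.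
    + exact: (@marginal_cell_cvg (fun n i j => cell_inf f i j) f fA0 ndf sf).
    + exact: (@marginal_cell_cvg (fun n i j => cell_inf g i j) g gA0 ndg sg).
have dff := double_fin f0 lf ff; have dgf := double_fin g0 lg gf.
pose J n := {ffun 'I_n -> bool}.
pose Sf n := \sum_(q : J n * J n) cell_inf f q.1 q.2 * (rate q.1 * rate q.2).
pose Sg n := \sum_(q : J n * J n) cell_inf g q.1 q.2 * (rate q.1 * rate q.2).
pose Sfg n := \sum_(q : J n * J n)
  cell_inf f q.1 q.2 * cell_inf g q.1 q.2 * (rate q.1 * rate q.2).
pose S3 n := \sum_(i : J n) rate i *
  ((\sum_j cell_inf f i j * rate j) * (\sum_j cell_inf g i j * rate j)).
have c2 : ((Sf n)%:E * (Sg n)%:E + 4%:E * (S3 n)%:E + 2%:E * (Sfg n)%:E)%E @[n --> \oo] -->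
   (((t ^+ 2)%:E * double f) * ((t ^+ 2)%:E * double g)
   + 4%:E * ((t ^+ 3)%:E * \int[vm R d]_(x in W) (marginal f x * marginal g x))
   + 2%:E * ((t ^+ 2)%:E * double (fun x y => f x y * g x y)%R))%E.
  have pos1 : (0 <= 4%:E * ((t ^+ 3)%:E * \int[vm R d]_(x in W) (marginal f x * marginal g x)))%E.
    rewrite !mule_ge0 ?lee_fin ?exprn_ge0 ?(ltW t0)//.
    by apply: integral_ge0 => x _; rewrite mule_ge0// marginal_ge0.
  have pos2 h : (forall x y, 0 <= h x y) -> (0 <= double h)%E.
    by move=> h0; apply: integral_ge0 => x _; exact: marginal_ge0.
  have pos3 : (0 <= ((t ^+ 2)%:E * double f) * ((t ^+ 2)%:E * double g))%E.
    by rewrite !mule_ge0 ?lee_fin ?exprn_ge0 ?(ltW t0) ?pos2.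
  apply: cvgeD.
  - apply: ge0_adde_def; rewrite inE; first exact: adde_ge0.
    rewrite !mule_ge0 ?lee_fin ?exprn_ge0 ?(ltW t0)//.
    by apply: pos2 => x y; rewrite mulr_ge0.
  - apply: cvgeD; first by apply: ge0_adde_def; rewrite inE.
      by apply: cvgeM => //; apply: mule_def_fin; rewrite fin_numM.
    exact: cvgeZl.
  - exact: cvgeZl.
suff cE : (fun n => \int[P]_w (qf f n w * qf g n w)%:E)%E = (fun n =>
    (Sf n)%:E * (Sg n)%:E + 4%:E * (S3 n)%:E + 2%:E * (Sfg n)%:E)%E.
  rewrite !EFinM -!muleA in c2 *.
  by rewrite cE in c1; exact: (cvg_unique _ c1 c2).
apply/funext => n; rewrite (expectation_quadM (mu := @rate n))//.
- exact: measurable_count.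
- exact: count_indep.
- by move=> i; exact: cell_inf_diag.
- by move=> i; exact: cell_inf_diag.
- by move=> i j; exact: cell_infC.
- by move=> i j; exact: cell_infC.
Qed.
End two_kernels.

End poisson_second_moment.

(** * The boundary deficit *)

Section difference_kernel.
Context (R : realType) (d : nat).
Implicit Types (x y u : 'rV[R]_d) (tau delta : R).

Definition dker tau delta x y : R := ker tau delta (x - y).

Lemma dker_ge0 tau delta x y : 0 <= dker tau delta x y.
Proof. exact: ker_ge0. Qed.

Lemma dkerxx tau delta x : dker tau delta x x = 0.
Proof. by rewrite /dker subrr /ker eqxx. Qed.

Lemma kerN tau delta u : ker tau delta (- u) = ker tau delta u.
Proof. by rewrite /ker oppr_eq0 enormN. Qed.

Lemma dkerC tau delta x y : dker tau delta x y = dker tau delta y x.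
Proof. by rewrite /dker -kerN opprB. Qed.

Lemma lsc_dker tau delta : lsc_kernel (dker tau delta).
Proof.
move=> x y a axy; have /nbhs_ballP[e /= e0 eK] :
    nbhs (x - y) [set u | a < ker tau delta u].
  by apply: open_nbhs_nbhs; split => //; exact: open_ker.
exists (ball x (e / 2)), (ball y (e / 2)); split; try exact: ball_open;
  try by apply: ballxx; rewrite divr_gt0.
move=> x' y'; rewrite -!ball_normE /= => xx yy; apply: eK.
rewrite -ball_normE /=.
have -> : x - y - (x' - y') = (x - x') - (y - y').
  by apply/rowP => i; rewrite !mxE; ring.
rewrite (le_lt_trans (ler_normB _ _))// [ltRHS](_ : e = e / 2 + e / 2) ?ltrD//.
by field.
Qed.

Lemma kerM tau1 tau2 delta u :
  ker tau1 delta u * ker tau2 delta u = ker (tau1 + tau2) delta u.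
Proof.
rewrite /ker; case: ifPn => [/andP[u0 _]|_]; last by rewrite mul0r.
by rewrite powRD// enorm_eq0 u0 implybT.
Qed.

Lemma ker_le tau delta delta' u : delta <= delta' -> ker tau delta u <= ker tau delta' u.
Proof.
move=> dd; rewrite /ker; case: ifPn => [/andP[-> ud]|_]; first by rewrite (lt_le_trans ud dd).
by case: ifP => // _; exact: powR_ge0.
Qed.

End difference_kernel.

Section deficit.
Context (R : realType) (d : nat) (W : set 'rV[R]_d).
Hypothesis cW : compact W.
Let bW : borel W. Proof. exact: compact_borel. Qed.
Implicit Types (x y u : 'rV[R]_d) (tau delta : R).

(** The mass that the kernel centred at [x] has outside [W]. *)
Definition deficit tau delta x : \bar R :=
  (\int[vm R d]_u (\1_(~` W) (x + (u : 'rV[R]_d)) * ker tau delta u)%:E)%E.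

Let m_shift_indic (A : set 'rV[R]_d) x : borel A ->
  measurable_fun setT (fun u : mrV R d => \1_A (x + (u : 'rV[R]_d)) : R).
Proof.
move=> bA; rewrite (_ : (fun u => _) = \1_[set u | A (u + x)]).
  by apply: measurable_indic; exact: borel_shift.
apply/funext => u; rewrite !indicE; congr ((nat_of_bool _)%:R).
by apply/idP/idP => /set_mem h; apply/mem_set; rewrite /= ?[u + x]addrC// addrC.
Qed.

Let m_integrand (A : set 'rV[R]_d) tau delta x : borel A ->
  measurable_fun setT (fun u : mrV R d => (\1_A (x + (u : 'rV[R]_d)) * ker tau delta u)%:E).
Proof.
move=> bA; apply/measurable_EFinP; apply: measurable_funM; first exact: m_shift_indic.
exact: measurable_ker.
Qed.

Lemma deficit_ge0 tau delta x : (0 <= deficit tau delta x)%E.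
Proof. by apply: integral_ge0 => u _; rewrite lee_fin mulr_ge0 ?ker_ge0. Qed.

Lemma deficit_le tau delta delta' x : delta <= delta' ->
  (deficit tau delta x <= deficit tau delta' x)%E.
Proof.
have bC : borel (~` W) by exact: borelC.
move=> dd; apply: ge0_le_integral => //.
- by move=> u _; rewrite lee_fin mulr_ge0 ?ker_ge0.
- exact: m_integrand.
- exact: m_integrand.
- by move=> u _; rewrite lee_fin ler_wpM2l// ker_le.
Qed.

Lemma marginal_shift tau delta x : marginal W (dker tau delta) x =
  (\int[vm R d]_u (\1_W (x + (u : 'rV[R]_d)) * ker tau delta u)%:E)%E.
Proof.
have mf : measurable_fun setT (fun y : mrV R d => (\1_W y * ker tau delta ((y : 'rV[R]_d) - x))%:E).
  apply/measurable_EFinP; apply: measurable_funM; first exact: measurable_indic.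
  apply: measurable_fun_open => a.
  rewrite (_ : [set _ | _] = (fun y => 1 *: y + - x) @^-1` [set u | a < ker tau delta u]).
    apply: open_comp => [y _|]; [exact: affine_continuous|exact: open_ker].
  by apply/seteqP; split=> y /=; rewrite scale1r.
transitivity (\int[vm R d]_y (\1_W (y : 'rV[R]_d) * ker tau delta ((y : 'rV[R]_d) - x))%:E)%E.
  rewrite /marginal integral_mkcond; apply: eq_integral => y _; rewrite patchE indicE.
  by case: ifPn => _; rewrite ?mul1r ?mul0r// dkerC.
have := @ge0_integral_rV_affine R d 1 x
  (fun y => (\1_W y * ker tau delta (y - x))%:E) ltr01 mf.
rewrite invr1 expr1n mul1e => <-; last first.
  by move=> y; rewrite lee_fin mulr_ge0 ?ker_ge0.
apply: eq_integral => u _; rewrite scale1r addrK; congr (_%:E); congr (_ * _).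
by rewrite addrC.
Qed.

Lemma marginal_deficit tau delta x :
  (marginal W (dker tau delta) x + deficit tau delta x = ker_int d tau delta)%E.
Proof.
rewrite marginal_shift /deficit -ge0_integralD//.
- apply: eq_integral => u _; rewrite -EFinD -mulrDl; congr (_%:E).
  rewrite !indicE in_setC; case: (_ \in W) => /=; by rewrite ?addr0 ?add0r mul1r.
- by move=> u _; rewrite lee_fin mulr_ge0 ?ker_ge0.
- exact: m_integrand.
- by move=> u _; rewrite lee_fin mulr_ge0 ?ker_ge0.
- by apply: m_integrand; exact: borelC.
Qed.

Lemma marginal_le tau delta x : (marginal W (dker tau delta) x <= ker_int d tau delta)%E.
Proof. by rewrite -(marginal_deficit tau delta x) leeDl// deficit_ge0. Qed.

Let measurable_outside :
  measurable [set z : mrV R d * mrV R d | (~` W) ((z.1 : 'rV[R]_d) + (z.2 : 'rV[R]_d))].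
Proof.
apply: (@measurable_rectangle_cover _ _ (mrV R d) (mrV R d) (@base R d) (@base R d)).
- by move=> n; apply: open_borel; exact: open_base.
- by move=> n; apply: open_borel; exact: open_base.
move=> x y /= Wxy.
have oW : open (~` W) by rewrite openC; exact: compact_closed_rV.
pose x0 : 'rV[R]_d := x; pose y0 : 'rV[R]_d := y.
have /nbhs_ballP[e /= e0 eW] : nbhs (x0 + y0) (~` W).
  by apply: open_nbhs_nbhs; split.
have e20 : 0 < e / 2 by rewrite divr_gt0.
have [n nx nB] := base_nbhs (ball_open x0 (e / 2)) (ballxx x0 e20).
have [m my mB] := base_nbhs (ball_open y0 (e / 2)) (ballxx y0 e20).
exists n, m; split => // -[x' y'] [/= /nB xx /mB yy]; apply: eW.
move: xx yy; rewrite -!ball_normE /= => xx yy.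
have -> : x0 + y0 - ((x' : 'rV[R]_d) + (y' : 'rV[R]_d)) = (x0 - x') + (y0 - y').
  by apply/rowP => i; rewrite !mxE; ring.
rewrite (le_lt_trans (ler_normD _ _))// [ltRHS](_ : e = e / 2 + e / 2) ?ltrD//.
by field.
Qed.

(** Tonelli: for a fixed displacement [u], the points [x] of [W] with [x + u]
    outside [W] form [exits W u]. *)
Lemma integral_deficit tau delta :
  (\int[vm R d]_(x in W) deficit tau delta x =
   \int[vm R d]_u ((ker tau delta u)%:E * vm R d (exits W u)))%E.
Proof.
pose F (z : mrV R d * mrV R d) : \bar R :=
  (\1_W z.1 * \1_[set z : mrV R d * mrV R d | (~` W) ((z.1 : 'rV[R]_d) + (z.2 : 'rV[R]_d))] z
    * ker tau delta (z.2 : 'rV[R]_d))%:E.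
have mF : measurable_fun setT F.
  apply/measurable_EFinP; apply: measurable_funM; first apply: measurable_funM.
  - by apply: (@measurableT_comp _ _ _ _ _ _ (\1_W : mrV R d -> R)) => //;
      exact: measurable_indic.
  - exact: measurable_indic.
  - apply: (@measurableT_comp _ _ _ _ _ _ (ker tau delta : mrV R d -> R)) => //.
    exact: measurable_ker.
transitivity (\int[vm R d]_x \int[vm R d]_u F (x, u))%E.
  rewrite integral_mkcond; apply: eq_integral => x _; rewrite patchE.
  case: ifPn => xW.
    apply: eq_integral => u _; rewrite /F /= !indicE xW mul1r.
    congr (((nat_of_bool _)%:R * _)%:E).
  by rewrite integral0_eq// => u _; rewrite /F/= !indicE (negbTE xW) !mul0r.
rewrite (@fubini_tonelli _ _ _ _ _ (vm R d) (vm R d) F)//; last first.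
  by move=> z; rewrite lee_fin !mulr_ge0 ?ker_ge0.
apply: eq_integral => u _.
transitivity (\int[vm R d]_x ((ker tau delta u)%:E * (\1_(exits W u) x)%:E))%E.
  apply: eq_integral => x _; rewrite /F -EFinM mulrC; congr ((_ * _)%:E).
  rewrite !indicE -natrM mulnb; congr ((nat_of_bool _)%:R).
  apply/idP/idP => [/andP[/set_mem h1 /set_mem h2]|/set_mem[h1 h2]]; first exact/mem_set.
  by apply/andP; split; apply/mem_set.
have mE : measurable (exits W u : set (mrV R d)) by exact: (finb_exits cW u).1.
rewrite ge0_integralZl//.
- by rewrite integral_indic// setIT.
- by apply/measurable_EFinP; exact: measurable_indic.
- by rewrite lee_fin ker_ge0.
Qed.

Lemma integral_deficit_le tau delta (beta : R) : 0 <= beta ->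
  (forall u, u != 0 -> enorm u < delta -> mes (exits W u) <= beta) ->
  (\int[vm R d]_(x in W) deficit tau delta x <= beta%:E * ker_int d tau delta)%E.
Proof.
move=> b0 hb; rewrite integral_deficit.
have mE : measurable_fun setT (fun u : mrV R d => vm R d (exits W u)).
  pose S := [set z : mrV R d * mrV R d | W z.1] `&`
    [set z : mrV R d * mrV R d | (~` W) ((z.1 : 'rV[R]_d) + (z.2 : 'rV[R]_d))].
  have mS : measurable S.
    apply: measurableI => //; rewrite (_ : [set _ | _] = W `*` setT).
      exact: measurableX.
    by apply/seteqP; split=> z /=; [split|case].
  apply: eq_measurable_fun (measurable_fun_ysection (vm R d) mS) => u _ /=.
  congr (vm R d _); apply/seteqP; split=> x; first by move=> /ysectionP[].
  by move=> [h1 h2]; apply/ysectionP.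
rewrite /ker_int -ge0_integralZl//; last 2 first.
- by apply/measurable_EFinP; exact: measurable_ker.
- by move=> u _; rewrite lee_fin ker_ge0.
apply: ge0_le_integral => //.
- by move=> u _; rewrite mule_ge0// lee_fin ker_ge0.
- by apply: emeasurable_funM => //; apply/measurable_EFinP; exact: measurable_ker.
- apply: measurable_funeM; by apply/measurable_EFinP; exact: measurable_ker.
move=> u _; rewrite muleC; have [/andP[u0 ud]|nu] := boolP ((u != 0) && (enorm u < delta)).
  rewrite lee_wpmul2r ?lee_fin ?ker_ge0// -mesE; last exact: finb_exits.
  by rewrite lee_fin hb.
by rewrite /ker (negbTE nu) !mule0.
Qed.

End deficit.

(** The integral of the kernel over the whole space, as a real number. *)
Definition kval (R : realType) d (tau delta : R) : R :=
  d%:R * kappa R d / (tau + d%:R) * delta `^ (tau + d%:R).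

Lemma ker_int_kval (R : realType) d (tau delta : R) : - d%:R < tau -> 0 < delta ->
  ker_int d tau delta = (kval d tau delta)%:E.
Proof. exact: ker_intE. Qed.

(** Expanding [(c1 - m1) * (c2 - m2) >= 0]: two functions below constants that are
    close to them in mean have a product that is so too. *)
Lemma integral_mul_ge disp (T : measurableType disp) (R : realType)
    (mu : {measure set T -> \bar R}) (A : set T) (mA : measurable A)
    (c1 c2 : R) (m1 m2 D1 D2 : T -> \bar R) :
  0 <= c1 -> 0 <= c2 ->
  measurable_fun A m1 -> measurable_fun A m2 ->
  measurable_fun A D1 -> measurable_fun A D2 ->
  (forall x, 0 <= m1 x)%E -> (forall x, 0 <= m2 x)%E ->
  (forall x, 0 <= D1 x)%E -> (forall x, 0 <= D2 x)%E ->
  (forall x, m1 x + D1 x = c1%:E)%E -> (forall x, m2 x + D2 x = c2%:E)%E ->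
  (\int[mu]_(x in A) (c1 * c2)%:E <= \int[mu]_(x in A) (m1 x * m2 x) +
    (c1%:E * \int[mu]_(x in A) D2 x + c2%:E * \int[mu]_(x in A) D1 x))%E.
Proof.
move=> c10 c20 mm1 mm2 mD1 mD2 m10 m20 D10 D20 e1 e2.
have mcD1 : measurable_fun A (fun x => c2%:E * D1 x)%E by exact: measurable_funeM.
have mcD2 : measurable_fun A (fun x => c1%:E * D2 x)%E by exact: measurable_funeM.
have cD1 x : (0 <= c2%:E * D1 x)%E by rewrite mule_ge0 ?lee_fin.
have cD2 x : (0 <= c1%:E * D2 x)%E by rewrite mule_ge0 ?lee_fin.
have mM : measurable_fun A (fun x => m1 x * m2 x)%E by exact: emeasurable_funM.
have mS : measurable_fun A (fun x => c1%:E * D2 x + c2%:E * D1 x)%E.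
  exact: emeasurable_funD.
rewrite -!ge0_integralZl// -ge0_integralD// -ge0_integralD//; last 2 first.
- by move=> x _; rewrite mule_ge0.
- by move=> x _; rewrite adde_ge0.
apply: ge0_le_integral => //.
- by move=> x _; rewrite lee_fin mulr_ge0.
- exact: emeasurable_funD.
move=> x _; have := e1 x; have := e2 x; move: (m10 x) (m20 x) (D10 x) (D20 x).
case: (m1 x) (D1 x) (m2 x) (D2 x) => [a| |] [b| |] [p| |] [q| |]//=.
rewrite -?EFinM -?EFinD ?lee_fin => a0 p0 b0 q0 [<-] [<-].
have := mulr_ge0 b0 q0; lra.
Qed.

Section integral_bounds.
Context (R : realType) (d : nat) (W : set 'rV[R]_d).
Hypothesis cW : compact W.
Variable delta beta : R.
Hypothesis delta0 : 0 < delta.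
Hypothesis beta0 : 0 <= beta.
Hypothesis betaP : forall u : 'rV[R]_d, u != 0 -> enorm u < delta ->
  mes (exits W u) <= beta.
Let bW : borel W. Proof. exact: compact_borel. Qed.
Implicit Types (tau : R).

Lemma measurable_marginal tau D :
  measurable_fun D (fun x : mrV R d => marginal W (dker tau delta) x).
Proof.
apply: (@measurable_marginal_lim R d W cW
  (fun n i j => cell_inf (dker tau delta) i j) (dker tau delta)).
- by move=> n i j; apply: cell_inf_ge0; exact: dker_ge0.
- by move=> x y n m; apply: step_nondecreasing; exact: dker_ge0.
- by move=> x y; apply: step_cvg; [exact: dker_ge0|exact: lsc_dker].
Qed.

Lemma kval_ge0 tau : - d%:R < tau -> 0 <= kval d tau delta.
Proof. by move=> td; rewrite -lee_fin -(ker_int_kval td delta0) ker_int_ge0. Qed.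

Lemma marginal_dker_ge0 tau x : (0 <= marginal W (dker tau delta) x)%E.
Proof. by apply: marginal_ge0; exact: dker_ge0. Qed.

Lemma marginal_kval tau x : - d%:R < tau ->
  (marginal W (dker tau delta) x <= (kval d tau delta)%:E)%E.
Proof. by move=> td; rewrite -(ker_int_kval td delta0); exact: marginal_le. Qed.

Lemma marginal_fin tau x : - d%:R < tau ->
  marginal W (dker tau delta) x \is a fin_num.
Proof.
move=> td; rewrite ge0_fin_numE ?marginal_dker_ge0//.
by rewrite (le_lt_trans (marginal_kval x td))// ltry.
Qed.

Lemma deficitE tau x : - d%:R < tau -> deficit W tau delta x =
  ((kval d tau delta)%:E - marginal W (dker tau delta) x)%E.
Proof.
move=> td; have := marginal_deficit cW tau delta x; rewrite (ker_int_kval td delta0) => <-.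
by rewrite [(marginal _ _ _ + _)%E]addeC addeK// marginal_fin.
Qed.

Lemma measurable_deficit tau D : - d%:R < tau ->
  measurable_fun D (fun x : mrV R d => deficit W tau delta x).
Proof.
move=> td; apply: (eq_measurable_fun (fun x : mrV R d =>
  ((kval d tau delta)%:E - marginal W (dker tau delta) x)%E)) => [x _|].
  by rewrite deficitE.
by apply: emeasurable_funB; [exact: measurable_cst|exact: measurable_marginal].
Qed.

Lemma deficit_bound tau : - d%:R < tau ->
  (\int[vm R d]_(x in W) deficit W tau delta x <= (beta * kval d tau delta)%:E)%E.
Proof. by move=> td; rewrite EFinM -(ker_int_kval td delta0); exact: integral_deficit_le. Qed.

Lemma integral_cst_W (c : R) : (\int[vm R d]_(x in W) c%:E = (c * volume W)%:E)%E.
Proof. by rewrite integral_cst// EFinM volumeE. Qed.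

Lemma double_le tau : - d%:R < tau ->
  (double W (dker tau delta) <= (volume W * kval d tau delta)%:E)%E.
Proof.
move=> td; rewrite mulrC -integral_cst_W; apply: ge0_le_integral => //.
- by move=> x _; exact: marginal_dker_ge0.
- exact: measurable_marginal.
- by move=> x _; exact: marginal_kval.
Qed.

Lemma double_ge tau : - d%:R < tau ->
  (((volume W - beta) * kval d tau delta)%:E <= double W (dker tau delta))%E.
Proof.
move=> td; rewrite mulrBl EFinB leeBlDr//.
apply: (@le_trans _ _ (double W (dker tau delta) +
    \int[vm R d]_(x in W) deficit W tau delta x)%E); last first.
  by rewrite leeD2l// deficit_bound.
rewrite /double -ge0_integralD//.
- rewrite mulrC -integral_cst_W; apply: ge0_le_integral => //.
  - by move=> x _; rewrite lee_fin kval_ge0.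
  - apply: emeasurable_funD; [exact: measurable_marginal|exact: measurable_deficit].
  - by move=> x _; rewrite marginal_deficit// (ker_int_kval td delta0).
- by move=> x _; exact: marginal_dker_ge0.
- exact: measurable_marginal.
- by move=> x _; exact: deficit_ge0.
- exact: measurable_deficit.
Qed.

Lemma double_fin_num tau : - d%:R < tau -> double W (dker tau delta) \is a fin_num.
Proof.
move=> td; rewrite ge0_fin_numE.
  by rewrite (le_lt_trans (double_le td))// ltry.
by apply: integral_ge0 => x _; exact: marginal_dker_ge0.
Qed.

Definition marginal_product tau1 tau2 : \bar R :=
  (\int[vm R d]_(x in W) (marginal W (dker tau1 delta) x * marginal W (dker tau2 delta) x))%E.

Lemma marginal_product_le tau1 tau2 : - d%:R < tau1 -> - d%:R < tau2 ->
  (marginal_product tau1 tau2 <=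
    (volume W * (kval d tau1 delta * kval d tau2 delta))%:E)%E.
Proof.
move=> td1 td2; rewrite mulrC -integral_cst_W; apply: ge0_le_integral => //.
- by move=> x _; rewrite mule_ge0// marginal_dker_ge0.
- by apply: emeasurable_funM; exact: measurable_marginal.
- move=> x _; rewrite EFinM; apply: lee_pmul; rewrite ?marginal_dker_ge0//;
  exact: marginal_kval.
Qed.

Lemma marginal_product_fin_num tau1 tau2 : - d%:R < tau1 -> - d%:R < tau2 ->
  marginal_product tau1 tau2 \is a fin_num.
Proof.
move=> td1 td2; rewrite ge0_fin_numE.
  by rewrite (le_lt_trans (marginal_product_le td1 td2))// ltry.
by apply: integral_ge0 => x _; rewrite mule_ge0// marginal_dker_ge0.
Qed.

Lemma marginal_product_ge tau1 tau2 : - d%:R < tau1 -> - d%:R < tau2 ->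
  (((volume W - 2 * beta) * (kval d tau1 delta * kval d tau2 delta))%:E <=
    marginal_product tau1 tau2)%E.
Proof.
move=> td1 td2; have k1 := kval_ge0 td1; have k2 := kval_ge0 td2.
rewrite mulrBl EFinB leeBlDr// mulrC -integral_cst_W.
have h tau x : - d%:R < tau ->
    (marginal W (dker tau delta) x + deficit W tau delta x = (kval d tau delta)%:E)%E.
  by move=> td; rewrite marginal_deficit// (ker_int_kval td delta0).
have hh := (@integral_mul_ge _ (mrV R d) R (vm R d) W bW _ _ _ _ _ _ k1 k2
  (@measurable_marginal tau1 W) (@measurable_marginal tau2 W)
  (@measurable_deficit tau1 W td1) (@measurable_deficit tau2 W td2)
  (marginal_dker_ge0 tau1) (marginal_dker_ge0 tau2)
  (deficit_ge0 W tau1 delta) (deficit_ge0 W tau2 delta) (fun x => h _ x td1) (fun x => h _ x td2)).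
apply: (le_trans hh); apply: leeD2l.
rewrite (_ : 2 * beta * (kval d tau1 delta * kval d tau2 delta) =
  kval d tau1 delta * (beta * kval d tau2 delta) +
  kval d tau2 delta * (beta * kval d tau1 delta)); last ring.
rewrite EFinD; apply: leeD; rewrite [leRHS]EFinM;
  apply: lee_wpmul2l; rewrite ?lee_fin//; exact: deficit_bound.
Qed.

End integral_bounds.

(** * The covariance of the length functionals *)

Section covariance_formula.
Context (R : realType) (d : nat) (disp : measure_display)
  (Omega : measurableType disp) (P : probability Omega R).
Variables (W : set 'rV[R]_d) (t : R) (eta : Omega -> {fset 'rV[R]_d}) (delta : R).
Hypothesis cW : compact W.
Hypothesis t0 : 0 < t.
Hypothesis etaP : poisson_process P W t eta.
Hypothesis delta0 : 0 < delta.
Implicit Types (tau : R).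

(** The kernel of [length_power], with a closed ball; it is a decreasing limit of
    the lower semicontinuous kernels with larger radii. *)
Definition cker tau (x y : 'rV[R]_d) : R :=
  if (x != y) && (enorm (x - y) <= delta) then enorm (x - y) `^ tau else 0.

Lemma length_powerE tau X : length_power delta tau X = 2^-1 * pairsum (cker tau) X.
Proof.
rewrite /length_power /pairsum; congr (_ * _); apply: eq_bigr => x _.
rewrite big_mkcond; apply: eq_bigr => y _; rewrite /cker.
by case: (x != y) => //=; case: ifP => _; rewrite ?mul1r ?mul0r.
Qed.

Lemma cker_ge0 tau x y : 0 <= cker tau x y.
Proof. by rewrite /cker; case: ifP => // _; exact: powR_ge0. Qed.

Lemma dker_le_cker tau x y : dker tau delta x y <= cker tau x y.
Proof.
rewrite /dker /ker /cker subr_eq0; case: ifPn => [/andP[-> /ltW ->]//|_].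
exact: cker_ge0.
Qed.

Lemma cker_le_dker tau delta' x y : delta < delta' -> cker tau x y <= dker tau delta' x y.
Proof.
move=> dd; rewrite /cker; case: ifPn => [/andP[xy xd]|_]; last exact: dker_ge0.
by rewrite /dker /ker subr_eq0 xy (le_lt_trans xd dd).
Qed.

Let delta_ n := delta + n.+1%:R^-1.

Let delta_gt n : delta < delta_ n. Proof. by rewrite ltrDl invr_gt0. Qed.

Let delta_cvg : delta_ n @[n --> \oo] --> delta.
Proof.
have : delta + n.+1%:R^-1 @[n --> \oo] --> delta + 0.
  by apply: cvgD; [exact: cvg_cst|exact: cvg_harmonic].
by rewrite addr0.
Qed.

Lemma dker_cvg_cker tau x y : dker tau (delta_ n) x y @[n --> \oo] --> cker tau x y.
Proof.
have [xd|dx] := leP (enorm (x - y)) delta.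
  apply: cvg_near_cst; apply: nearW => n.
  rewrite /dker /ker /cker subr_eq0 xd andbT.
  by rewrite (le_lt_trans xd (delta_gt n)) andbT.
apply: cvg_near_cst.
have : \forall n \near \oo, delta_ n < enorm (x - y) by exact: (cvgr_lt _ delta_cvg).
apply: filterS => n nd; rewrite /dker /ker /cker.
by rewrite [_ <= _]leNgt dx [_ < delta_ n]ltNge (ltW nd) !andbF.
Qed.

Lemma pairsum_le (f g : 'rV[R]_d -> 'rV[R]_d -> R) X :
  (forall x y, f x y <= g x y) -> pairsum f X <= pairsum g X.
Proof. by move=> fg; apply: ler_sum => x _; apply: ler_sum. Qed.

Lemma measurable_dpair tau delta' :
  measurable_fun setT (fun w => pairsum (dker tau delta') (eta w)).
Proof. by apply: (measurable_pairsum cW etaP); [exact: dker_ge0|exact: lsc_dker]. Qed.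

Lemma measurable_cpair tau : measurable_fun setT (fun w => pairsum (cker tau) (eta w)).
Proof.
apply: (measurable_fun_cvg (fun n => measurable_dpair tau (delta_ n))) => w _.
apply: (@cvg_big _ _ +%R 0 xpredT (@add_continuous R)) => x _.
apply: (@cvg_big _ _ +%R 0 xpredT (@add_continuous R)) => y _.
exact: dker_cvg_cker.
Qed.

Lemma expectation_dpair tau delta' :
  (\int[P]_w (pairsum (dker tau delta') (eta w))%:E
    = (t ^+ 2)%:E * double W (dker tau delta'))%E.
Proof.
apply: (expectation_pairsum cW t0 etaP).
- exact: dker_ge0.
- exact: dkerxx.
- exact: dkerC.
- exact: lsc_dker.
Qed.

(** The deficit grows with the radius, so the integral over [W * W] grows by at
    most [volume W] times the growth of the integral over the whole space. *)
Lemma double_increment tau delta' : - d%:R < tau -> delta < delta' ->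
  (double W (dker tau delta') <= double W (dker tau delta) +
     (volume W * (kval d tau delta' - kval d tau delta))%:E)%E.
Proof.
move=> td dd; have delta'0 := lt_trans delta0 dd.
have kk : kval d tau delta <= kval d tau delta'.
  rewrite -lee_fin -!ker_int_kval//; apply: ge0_le_integral => //.
  - by move=> u _; rewrite lee_fin ker_ge0.
  - by apply/measurable_EFinP; exact: measurable_ker.
  - by apply/measurable_EFinP; exact: measurable_ker.
  - by move=> u _; rewrite lee_fin ker_le// ltW.
rewrite mulrC -integral_cst_W// -ge0_integralD//; last 4 first.
- exact: compact_borel.
- by move=> x _; exact: marginal_dker_ge0.
- exact: measurable_marginal.
- by move=> x _; rewrite lee_fin subr_ge0.
apply: ge0_le_integral => //.
- exact: compact_borel.
- by move=> x _; exact: marginal_dker_ge0.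
- exact: measurable_marginal.
- by apply: emeasurable_funD; [exact: measurable_marginal|exact: measurable_cst].
move=> x _.
have fx := marginal_fin cW delta0 x td; have fx' := marginal_fin cW delta'0 x td.
have := deficit_le cW tau x (ltW dd).
rewrite !deficitE// -(fineK fx) -(fineK fx') -!EFinB -EFinD !lee_fin; lra.
Qed.

(** Closed balls of radius [delta] lie in open balls of radius [delta + 1 / n], and
    by [double_increment] the mean for the latter tends to the mean for the open
    ball of radius [delta]. Hence almost surely no distance equals [delta]. *)
Lemma expectation_cpair tau : - d%:R < tau ->
  (\int[P]_w (pairsum (cker tau) (eta w))%:E =
   \int[P]_w (pairsum (dker tau delta) (eta w))%:E)%E.
Proof.
move=> td; apply/eqP; rewrite eq_le; apply/andP; split; last first.
  apply: ge0_le_integral => //.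
  - by move=> w _; rewrite lee_fin; apply: pairsum_ge0; exact: dker_ge0.
  - by apply/measurable_EFinP; exact: measurable_dpair.
  - by apply/measurable_EFinP; exact: measurable_cpair.
  - by move=> w _; rewrite lee_fin; apply: pairsum_le; exact: dker_le_cker.
have fd := double_fin_num cW delta0 td.
have le n : (\int[P]_w (pairsum (cker tau) (eta w))%:E <=
    (t ^+ 2 * (fine (double W (dker tau delta)) +
       volume W * (kval d tau (delta_ n) - kval d tau delta)))%:E)%E.
  apply: (@le_trans _ _ (\int[P]_w (pairsum (dker tau (delta_ n)) (eta w))%:E)%E).
    apply: ge0_le_integral => //.
    - by move=> w _; rewrite lee_fin; apply: pairsum_ge0; exact: cker_ge0.
    - by apply/measurable_EFinP; exact: measurable_cpair.
    - by apply/measurable_EFinP; exact: measurable_dpair.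
    - by move=> w _; rewrite lee_fin; apply: pairsum_le => x y; exact: cker_le_dker.
  rewrite expectation_dpair [leRHS]EFinM; apply: lee_wpmul2l.
    by rewrite lee_fin exprn_ge0// ltW.
  by rewrite EFinD fineK//; exact: double_increment.
rewrite expectation_dpair -(fineK fd) -EFinM.
have cv : (t ^+ 2 * (fine (double W (dker tau delta)) +
       volume W * (kval d tau (delta_ n) - kval d tau delta))) @[n --> \oo] -->
    t ^+ 2 * (fine (double W (dker tau delta)) +
       volume W * (kval d tau delta - kval d tau delta)).
  apply: cvgMl_tmp; apply: cvgD; first exact: cvg_cst.
  apply: cvgMl_tmp; apply: cvgB; last exact: cvg_cst.
  apply: cvgMl_tmp.
  have cp : {for delta, continuous (fun r : R => r `^ (tau + d%:R))}.
    apply: differentiable_continuous; apply/derivable1_diffP/derivable_powR.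
    by rewrite in_itv/= delta0.
  exact: (cvg_comp _ _ delta_cvg cp).
rewrite subrr mulr0 addr0 in cv.
have cvE : (t ^+ 2 * (fine (double W (dker tau delta)) +
    volume W * (kval d tau (delta_ n) - kval d tau delta)))%:E @[n --> \oo] -->
    (t ^+ 2 * fine (double W (dker tau delta)))%:E.
  by apply: cvg_EFin; [exact: nearW|exact: cv].
by apply: (cvge_to_ge cvE); exact: nearW.
Qed.

Lemma cpair_ae tau : - d%:R < tau ->
  ae_eq P setT (fun w => (pairsum (cker tau) (eta w))%:E)
    (fun w => (pairsum (dker tau delta) (eta w))%:E).
Proof.
move=> td; have fd := double_fin_num cW delta0 td.
pose Z w := ((pairsum (cker tau) (eta w))%:E - (pairsum (dker tau delta) (eta w))%:E)%E.
have mc : measurable_fun setT (fun w => (pairsum (cker tau) (eta w))%:E).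
  by apply/measurable_EFinP; exact: measurable_cpair.
have md : measurable_fun setT (fun w => (pairsum (dker tau delta) (eta w))%:E).
  by apply/measurable_EFinP; exact: measurable_dpair.
have mZ : measurable_fun setT Z by exact: emeasurable_funB.
have Z0 w : (0 <= Z w)%E.
  by rewrite /Z -EFinB lee_fin subr_ge0; apply: pairsum_le; exact: dker_le_cker.
have IZ : (\int[P]_w Z w = 0)%E.
  have h : (\int[P]_w (pairsum (cker tau) (eta w))%:E =
      \int[P]_w (pairsum (dker tau delta) (eta w))%:E + \int[P]_w Z w)%E.
    rewrite -ge0_integralD//.
      by apply: eq_integral => w _; rewrite /Z -EFinB -EFinD; congr EFin; ring.
    by move=> w _; rewrite lee_fin; apply: pairsum_ge0; exact: dker_ge0.
  move: h; rewrite expectation_cpair// expectation_dpair -(fineK fd) -EFinM.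
  have [fz|] := boolP ((\int[P]_w Z w)%E \is a fin_num).
    rewrite -(fineK fz) -EFinD => -[] h; congr EFin; lra.
  rewrite ge0_fin_numE ?integral_ge0// -leNgt leye_eq => /eqP ->.
  by rewrite addey.
have /(ae_eq_integral_abs P measurableT mZ) : (\int[P]_(w in setT) `|Z w| = 0)%E.
  by rewrite -[RHS]IZ; apply: eq_integral => w _; rewrite gee0_abs.
apply: filterS => w /= h _; have := h I.
rewrite /Z -EFinB => -[] /eqP; rewrite subr_eq0 => /eqP ->.
by [].
Qed.

Definition length_at tau w := length_power delta tau (eta w).

Lemma length_at_ge0 tau w : 0 <= length_at tau w.
Proof. by rewrite /length_at length_powerE mulr_ge0 ?invr_ge0//; apply: pairsum_ge0; exact: cker_ge0. Qed.

Lemma measurable_length_at tau : measurable_fun setT (length_at tau).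
Proof.
rewrite /length_at; under eq_fun do rewrite length_powerE.
by apply: measurable_funM; [exact: measurable_cst|exact: measurable_cpair].
Qed.

Lemma expectation_length_at tau : - d%:R < tau ->
  (\int[P]_w (length_at tau w)%:E = (2^-1 * t ^+ 2 * fine (double W (dker tau delta)))%:E)%E.
Proof.
move=> td; have fd := double_fin_num cW delta0 td.
rewrite /length_at; under eq_integral do rewrite length_powerE EFinM.
rewrite ge0_integralZl ?lee_fin ?invr_ge0//.
- by rewrite expectation_cpair// expectation_dpair -{1}(fineK fd) -!EFinM mulrA.
- by apply/measurable_EFinP; exact: measurable_cpair.
- by move=> w _; rewrite lee_fin; apply: pairsum_ge0; exact: cker_ge0.
Qed.

Lemma expectation_length_atM tau1 tau2 : - d%:R < tau1 -> - d%:R < tau2 -> - d%:R < tau1 + tau2 ->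
  (\int[P]_w (length_at tau1 w * length_at tau2 w)%:E =
    ((2^-1 * t ^+ 2 * fine (double W (dker tau1 delta))) *
     (2^-1 * t ^+ 2 * fine (double W (dker tau2 delta)))
    + t ^+ 3 * fine (marginal_product W delta tau1 tau2)
    + 2^-1 * t ^+ 2 * fine (double W (dker (tau1 + tau2) delta)))%:E)%E.
Proof.
move=> td1 td2 td12.
have fd1 := double_fin_num cW delta0 td1; have fd2 := double_fin_num cW delta0 td2.
have fd12 := double_fin_num cW delta0 td12.
have fm := marginal_product_fin_num cW delta0 td1 td2.
transitivity (\int[P]_w ((4^-1)%:E *
    (pairsum (dker tau1 delta) (eta w) * pairsum (dker tau2 delta) (eta w))%:E))%E.
  apply: ge0_ae_eq_integral => //.
  - by apply/measurable_EFinP; apply: measurable_funM; exact: measurable_length_at.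
  - apply: measurable_funeM; apply/measurable_EFinP.
    by apply: measurable_funM; exact: measurable_dpair.
  - by move=> w _; rewrite lee_fin mulr_ge0// length_at_ge0.
  - move=> w _; rewrite mule_ge0// lee_fin mulr_ge0//; apply: pairsum_ge0; exact: dker_ge0.
  have := cpair_ae td1; have := cpair_ae td2.
  apply: filterS2 => w h2 h1 _ /=.
  have [e1] := h1 I; have [e2] := h2 I.
  by rewrite /length_at !length_powerE e1 e2 -EFinM; congr EFin; field.
rewrite ge0_integralZl ?lee_fin ?invr_ge0//; last 2 first.
- by apply/measurable_EFinP; apply: measurable_funM; exact: measurable_dpair.
- by move=> w _; rewrite lee_fin mulr_ge0//; apply: pairsum_ge0; exact: dker_ge0.
rewrite (expectation_pairsumM cW t0 etaP (dker_ge0 tau1 delta) (dker_ge0 tau2 delta)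
  (dkerxx tau1 delta) (dkerxx tau2 delta) (dkerC tau1 delta) (dkerC tau2 delta)
  (@lsc_dker R d tau1 delta) (@lsc_dker R d tau2 delta)); last 2 first.
- by exists (kval d tau1 delta) => x; exact: marginal_kval.
- by exists (kval d tau2 delta) => x; exact: marginal_kval.
rewrite (_ : (fun x y => dker tau1 delta x y * dker tau2 delta x y) =
  dker (tau1 + tau2) delta); last first.
  by apply/funext => x; apply/funext => y; exact: kerM.
rewrite -/(marginal_product W delta tau1 tau2).
move: fd1 fd2 fd12 fm; case: (double W (dker tau1 delta)) => [a| |]//.
case: (double W (dker tau2 delta)) => [b| |]//.
case: (double W (dker (tau1 + tau2) delta)) => [c| |]//.
case: (marginal_product W delta tau1 tau2) => [e| |]// _ _ _ _.
rewrite [LHS]/= [RHS]/=; congr EFin; by field.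
Qed.

Let ge0_Lfun1 (X : Omega -> R) e : (forall w, 0 <= X w) -> measurable_fun setT X ->
  (\int[P]_w (X w)%:E = e%:E)%E -> X \in Lfun P 1.
Proof.
move=> X0 mX Xe; apply/Lfun1_integrable; apply/integrableP.
split; first exact/measurable_EFinP.
under eq_integral do rewrite /= (ger0_norm (X0 _)).
by rewrite Xe ltry.
Qed.

Lemma Lfun1_length_at tau : - d%:R < tau -> length_at tau \in Lfun P 1.
Proof.
move=> td.
exact: ge0_Lfun1 (length_at_ge0 tau) (measurable_length_at tau) (expectation_length_at td).
Qed.

Lemma Lfun1_length_atM tau1 tau2 : - d%:R < tau1 -> - d%:R < tau2 -> - d%:R < tau1 + tau2 ->
  length_at tau1 * length_at tau2 \in Lfun P 1.
Proof.
move=> td1 td2 td12; apply: ge0_Lfun1 (expectation_length_atM td1 td2 td12).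
  by move=> w; rewrite mulr_ge0 ?length_at_ge0.
by apply: measurable_funM; exact: measurable_length_at.
Qed.

Lemma covariance_length_at tau1 tau2 : - d%:R < tau1 -> - d%:R < tau2 -> - d%:R < tau1 + tau2 ->
  covariance P (length_at tau1) (length_at tau2) =
    (t ^+ 3 * fine (marginal_product W delta tau1 tau2)
    + 2^-1 * t ^+ 2 * fine (double W (dker (tau1 + tau2) delta)))%:E.
Proof.
move=> td1 td2 td12.
have E tau : - d%:R < tau ->
    'E_P[length_at tau]%E = (2^-1 * t ^+ 2 * fine (double W (dker tau delta)))%:E.
  by move=> td; rewrite unlock; exact: expectation_length_at.
have E12 : ('E_P[length_at tau1 * length_at tau2] = \int[P]_w (length_at tau1 w * length_at tau2 w)%:E)%E.
  by rewrite unlock; apply: eq_integral.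
have cancel (a b e c : R) : ((a * b + e + c)%:E - a%:E * b%:E = (e + c)%:E)%E.
  by rewrite -EFinM -EFinB; congr EFin; ring.
rewrite covarianceE ?Lfun1_length_at ?Lfun1_length_atM// E12 (E _ td1) (E _ td2).
rewrite (expectation_length_atM td1 td2 td12).
exact: cancel.
Qed.

(** Up to the factor [volume W], the scale is the covariance in which the kernel
    is integrated over the whole space instead of [W]. *)
Lemma cov_scaleE tau1 tau2 : - d%:R < tau1 -> - d%:R < tau2 -> - d%:R < tau1 + tau2 ->
  cov_scale d t delta tau1 tau2 = t ^+ 3 * (kval d tau1 delta * kval d tau2 delta)
    + 2^-1 * t ^+ 2 * kval d (tau1 + tau2) delta.
Proof.
move=> td1 td2 td12; rewrite /cov_scale addrC; congr (_ + _).
  rewrite /sigma2 /kval (_ : tau1 + tau2 + 2 * d%:R = (tau1 + d%:R) + (tau2 + d%:R)); last ring.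
  rewrite powRD; last by rewrite (gt_eqF delta0) implybT.
  have a1 : 0 < tau1 + d%:R by lra.
  have a2 : 0 < tau2 + d%:R by lra.
  by field; rewrite !gt_eqF.
rewrite /sigma1 gt_eqF// gtr0_norm; last lra.
rewrite /kval; have a1 : 0 < tau1 + tau2 + d%:R by lra.
by field; rewrite gt_eqF.
Qed.

(** Integrating over [W] instead of the whole space loses in the mean at most
    [beta] times the integral of each kernel: once in the term of order [t ^+ 2],
    and twice in the term of order [t ^+ 3], which has two kernels. *)
Lemma covariance_bounds (beta : R) tau1 tau2 : 0 <= beta ->
  (forall u : 'rV[R]_d, u != 0 -> enorm u < delta -> mes (exits W u) <= beta) ->
  - d%:R < tau1 -> - d%:R < tau2 -> - d%:R < tau1 + tau2 ->
  exists2 c, covariance P (length_at tau1) (length_at tau2) = c%:E &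
    (volume W - 2 * beta) * cov_scale d t delta tau1 tau2 <= c <=
      volume W * cov_scale d t delta tau1 tau2.
Proof.
move=> b0 hb td1 td2 td12.
have fd12 := double_fin_num cW delta0 td12.
have fm := marginal_product_fin_num cW delta0 td1 td2.
eexists; first exact: covariance_length_at.
have := marginal_product_le cW delta0 td1 td2.
have := marginal_product_ge cW delta0 b0 hb td1 td2.
have := double_le cW delta0 td12.
have := double_ge cW delta0 b0 hb td12.
rewrite -(fineK fm) -(fineK fd12) !lee_fin !fineK//.
rewrite cov_scaleE//; set B := fine _; set A := fine _.
set k12 := kval _ (tau1 + tau2) _; set k1 := kval _ tau1 _; set k2 := kval _ tau2 _.
move=> B1 B2 A1 A2.
have t3 : 0 < t ^+ 3 by rewrite exprn_gt0.
have t2 : 0 < 2^-1 * t ^+ 2 by rewrite mulr_gt0// exprn_gt0.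
have k12_0 : 0 <= k12 by exact: kval_ge0.
have B1' : (volume W - 2 * beta) * k12 <= B.
  apply: le_trans B1; apply: ler_wpM2r => //; lra.
have := ler_wpM2l (ltW t3) A1; have := ler_wpM2l (ltW t3) A2.
have := ler_wpM2l (ltW t2) B1'; have := ler_wpM2l (ltW t2) B2.
by move=> *; apply/andP; split; lra.
Qed.

End covariance_formula.

(** * The scale and the normalisation *)

Section scale.
Context (R : realType) (d : nat).
Hypothesis d0 : (1 <= d)%N.
Hypothesis kappa0 : 0 < kappa R d.
Implicit Types (t delta tau s : R).

Let dR : 1 <= d%:R :> R. Proof. by rewrite ler1n. Qed.

Lemma sigma1_gt0 tau1 tau2 : 0 < sigma1 d tau1 tau2 :> R.
Proof.
have dk : 0 < d%:R * kappa R d by rewrite mulr_gt0// (lt_le_trans ltr01).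
rewrite /sigma1; case: ifPn => h; first by rewrite divr_gt0.
rewrite divr_gt0// mulr_gt0// normr_gt0.
by apply: contra h; rewrite addr_eq0.
Qed.

Lemma sigma2_ge0 tau1 tau2 : - d%:R < tau1 -> - d%:R < tau2 -> 0 <= sigma2 d tau1 tau2 :> R.
Proof.
move=> td1 td2; rewrite /sigma2 divr_ge0//.
  by rewrite mulr_ge0// sqr_ge0.
by rewrite mulr_ge0//; lra.
Qed.

(** The scale and the normalisation only depend on the mean number
    [s = t * delta ^+ d] of points in a ball up to the common factor
    [t ^+ 2 * delta `^ (tau1 + tau2 + d)]. *)
Lemma cov_scale_ratio t delta tau1 tau2 : 0 < t -> 0 < delta ->
  cov_scale d t delta tau1 tau2 = t ^+ 2 * delta `^ (tau1 + tau2 + d%:R) *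
    (sigma1 d tau1 tau2 + sigma2 d tau1 tau2 * (t * delta ^+ d)).
Proof.
move=> t0 delta0; rewrite /cov_scale.
rewrite (_ : tau1 + tau2 + 2 * d%:R = (tau1 + tau2 + d%:R) + d%:R); last ring.
rewrite [delta `^ (tau1 + tau2 + d%:R + d%:R)]powRD; last first.
  by rewrite (gt_eqF delta0) implybT.
rewrite (powR_mulrn d (ltW delta0)).
move: (sigma1 _ _ _) (sigma2 _ _ _) (delta `^ _) (delta ^+ d) => a b x y; ring.
Qed.

(** Both entries of the maximum have the factor [t * delta `^ (tau + d / 2)]; the
    other factors are 1 and the square root of [t * delta ^+ d]. *)
Lemma norm_constM t delta tau1 tau2 : 0 < t -> 0 < delta ->
  norm_const d t delta tau1 * norm_const d t delta tau2 =
    t ^+ 2 * delta `^ (tau1 + tau2 + d%:R) * Num.max 1 (t * delta ^+ d).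
Proof.
move=> t0 delta0; pose q := t `^ 2^-1 * delta `^ (d%:R / 2).
have powD a b : delta `^ (a + b) = delta `^ a * delta `^ b.
  by rewrite powRD// (gt_eqF delta0) implybT.
have powt a b : t `^ (a + b) = t `^ a * t `^ b.
  by rewrite powRD// (gt_eqF t0) implybT.
have q0 : 0 < q by rewrite mulr_gt0// powR_gt0.
have q2 : q ^+ 2 = t * delta ^+ d.
  have tE : t = t `^ 2^-1 * t `^ 2^-1.
    by rewrite -powt -[LHS](powRr1 (ltW t0)); congr (_ `^ _); field.
  have dE : delta ^+ d = delta `^ (d%:R / 2) * delta `^ (d%:R / 2).
    by rewrite -powD -(powR_mulrn d (ltW delta0)); congr (_ `^ _); field.
  by rewrite [in RHS]tE dE /q; ring.
have ncE tau : norm_const d t delta tau =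
    t * delta `^ (tau + d%:R / 2) * Num.max 1 q.
  rewrite maxr_pMr; last by rewrite mulr_ge0 ?powR_ge0// ltW.
  rewrite mulr1 /norm_const; congr Num.max; rewrite /q.
  rewrite (_ : 3 / 2 = 1 + 2^-1 :> R); last by field.
  rewrite (_ : tau + d%:R = (tau + d%:R / 2) + d%:R / 2); last by field.
  by rewrite powt powD (powRr1 (ltW t0)); ring.
have maxE : Num.max 1 q * Num.max 1 q = Num.max 1 (t * delta ^+ d).
  rewrite -q2; have [q1|q1] := leP q 1.
    by rewrite max_l// ?mulr1 // exprn_ile1// ltW.
  by rewrite max_r ?expr2// -expr2 exprn_ege1// ltW.
rewrite !ncE -maxE.
rewrite (_ : tau1 + tau2 + d%:R = (tau1 + d%:R / 2) + (tau2 + d%:R / 2)); last by field.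
by rewrite !powD; ring.
Qed.

(** The limit behaviour of the normalised covariance is that of this function, whose
    argument is [s = t * delta ^+ d]. *)
Definition cov_ratio tau1 tau2 s : R :=
  (sigma1 d tau1 tau2 + sigma2 d tau1 tau2 * s) / Num.max 1 s.

Lemma cov_scale_norm t delta tau1 tau2 : 0 < t -> 0 < delta ->
  (norm_const d t delta tau1)^-1 * (norm_const d t delta tau2)^-1
    * cov_scale d t delta tau1 tau2 = cov_ratio tau1 tau2 (t * delta ^+ d).
Proof.
move=> t0 delta0; rewrite -invfM norm_constM// cov_scale_ratio// /cov_ratio.
have x0 : 0 < t ^+ 2 * delta `^ (tau1 + tau2 + d%:R).
  by rewrite mulr_gt0 ?exprn_gt0 ?powR_gt0.
have y0 : 0 < Num.max 1 (t * delta ^+ d) by rewrite lt_max ltr01.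
by field; rewrite !gt_eqF ?exprn_gt0 ?powR_gt0.
Qed.

Lemma cov_scale_gt0 t delta tau1 tau2 : - d%:R < tau1 -> - d%:R < tau2 ->
  0 < t -> 0 < delta -> 0 < cov_scale d t delta tau1 tau2.
Proof.
move=> td1 td2 t0 delta0; rewrite cov_scale_ratio// mulr_gt0//.
  by rewrite mulr_gt0 ?exprn_gt0 ?powR_gt0.
rewrite ltr_pwDl ?sigma1_gt0// mulr_ge0 ?sigma2_ge0//.
by rewrite mulr_ge0 ?exprn_ge0// ltW.
Qed.

Section limits.
Variables (T : Type) (F : set_system T) (FF : ProperFilter F) (s : T -> R).

Lemma cov_ratio_cvg tau1 tau2 c : s x @[x --> F] --> c ->
  cov_ratio tau1 tau2 (s x) @[x --> F] --> cov_ratio tau1 tau2 c.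
Proof.
move=> sc; rewrite /cov_ratio; apply: cvgM.
  by apply: cvgD; [exact: cvg_cst|exact: cvgMl_tmp].
apply: cvgV; first by rewrite gt_eqF// lt_max ltr01.
rewrite (_ : (fun x => Num.max 1 (s x)) = (fun x => (1 + s x + `|1 - s x|) / 2)).
  rewrite maxr_absE; apply: cvgMr_tmp; apply: cvgD.
    by apply: cvgD => //; exact: cvg_cst.
  by apply: cvg_norm; apply: cvgB => //; exact: cvg_cst.
by apply/funext => x; rewrite maxr_absE.
Qed.

Lemma cov_ratio_cvgy tau1 tau2 : s x @[x --> F] --> +oo%R ->
  cov_ratio tau1 tau2 (s x) @[x --> F] --> sigma2 d tau1 tau2.
Proof.
move=> sy; have s1 : \forall x \near F, 1 < s x by exact: (cvgryPgt _).1.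
have sV : (s x)^-1 @[x --> F] --> (0 : R).
  by apply/gtr0_cvgV0 => //; apply: filterS s1 => x; exact: lt_trans.
have : sigma1 d tau1 tau2 * (s x)^-1 + sigma2 d tau1 tau2 @[x --> F] -->
    sigma1 d tau1 tau2 * 0 + sigma2 d tau1 tau2.
  by apply: cvgD; [exact: cvgMl_tmp|exact: cvg_cst].
rewrite mulr0 add0r; apply: cvg_trans; apply: near_eq_cvg.
apply: filterS s1 => x x1; rewrite /cov_ratio max_r ?(ltW x1)//.
by field; rewrite gt_eqF// (lt_trans ltr01).
Qed.

End limits.

Lemma cov_ratio_le1 tau1 tau2 c : c <= 1 ->
  cov_ratio tau1 tau2 c = sigma1 d tau1 tau2 + c * sigma2 d tau1 tau2.
Proof. by move=> c1; rewrite /cov_ratio max_l// divr1 [c * _]mulrC. Qed.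

Lemma cov_ratio_gt1 tau1 tau2 c : 1 < c ->
  cov_ratio tau1 tau2 c = c^-1 * sigma1 d tau1 tau2 + sigma2 d tau1 tau2.
Proof.
move=> c1; rewrite /cov_ratio max_r ?(ltW c1)//.
by field; rewrite gt_eqF// (lt_trans ltr01).
Qed.

End scale.

Lemma kappa_gt0 (R : realType) (d : nat) (W : set 'rV[R]_d) :
  compact W -> 0 < volume W -> 0 < kappa R d.
Proof.
move=> cW W0; have [r r0 Wr] := compact_cube cW.
have Wb : W `<=` oball (Num.sqrt (d%:R * r ^+ 2) + 1).
  move=> x /Wr xr; rewrite /oball /= (@le_lt_trans _ _ (Num.sqrt (d%:R * r ^+ 2))) ?ltrDl//.
  rewrite ler_wsqrtr// (_ : d%:R * r ^+ 2 = \sum_(i < d) r ^+ 2); last first.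
    by rewrite sumr_const card_ord mulr_natl.
  apply: ler_sum => i _; have := xr i; rewrite -real_normK ?num_real// => h.
  by rewrite lerXn2r ?nnegrE// ltW.
have s0 : 0 < Num.sqrt (d%:R * r ^+ 2) + 1 by rewrite ltr_wpDl.
have bW := compact_borel cW.
rewrite lt0r -lee_fin kappaE measure_ge0 andbT; apply/eqP => k0.
have : (vm R d W <= vm R d (oball (Num.sqrt (d%:R * r ^+ 2) + 1)))%E.
  by apply: le_measure; rewrite ?inE//; exact: borel_oball.
by rewrite vm_oball// -kappaE k0 mule0 -volumeE// lee_fin leNgt W0.
Qed.

(** * Bounds and asymptotics of the covariance *)

Lemma covariance_standardize (R : realType) (disp : measure_display)
    (Omega : measurableType disp) (P : probability Omega R) (X Y : Omega -> R) (a b : R) :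
  X \in Lfun P 1 -> Y \in Lfun P 1 -> X * Y \in Lfun P 1 ->
  covariance P (fun w => (X w - fine 'E_P[X]%E) / a)
    (fun w => (Y w - fine 'E_P[Y]%E) / b) = ((a^-1 * b^-1)%:E * covariance P X Y)%E.
Proof.
move=> X1 Y1 XY1; set e := fine _; set f := fine 'E_P[Y]%E.
have cL (c : R) : cst c \in Lfun P 1 by exact: Lfun_cst.
have centred (Z : Omega -> R) c : Z \in Lfun P 1 ->
    ('E_P[fun w => ((Z w - fine 'E_P[Z]) / c)%R] = 0)%E.
  move=> Z1; rewrite (_ : (fun w => _) = (c^-1 \o* (Z \- cst (fine 'E_P[Z]%E)))%R).
    have ZB : (Z \- cst (fine 'E_P[Z]%E))%R \in Lfun P 1 by exact: rpredB.
    rewrite expectationZl// expectationB// expectation_cst.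
    by rewrite fineK ?subee ?mule0// expectation_fin_num.
  by apply/funext => w /=; rewrite mulrC.
rewrite unlock !centred// -/e -/f.
rewrite (_ : ((fun w => (X w - e) / a) \- cst (fine 0%E))%R * _ =
    ((a^-1 * b^-1) \o* ((X \- cst e) * (Y \- cst f)))%R); last first.
  by apply/funext => w; rewrite /= !fctE /= !subr0; ring.
rewrite expectationZl//.
rewrite (_ : (X \- cst e) * (Y \- cst f) =
  ((X \* Y) \- (f \o* X) \- (e \o* Y) \+ cst (e * f))%R); last first.
  by apply/funext => w; rewrite /= !fctE /=; ring.
by rewrite rpredD//= ?rpredB ?Lfun_scale// Lfun_cst.
Qed.

Section consequences.
Context (R : realType) (d : nat).
Hypothesis d0 : (1 <= d)%N.
Variable W : set 'rV[R]_d.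
Hypothesis cW : compact W.
Hypothesis vW : cvx W.
Hypothesis W0 : 0 < volume W.
Context (disp : measure_display) (Omega : measurableType disp) (P : probability Omega R).

Lemma surface_area_ge0 : (0 <= surface_area W)%E.
Proof.
pose u : 'rV[R]_d := const_mx 1.
have u0 : u != 0.
  by apply/eqP => /rowP/(_ (Ordinal d0)); rewrite !mxE => /eqP; rewrite oner_eq0.
have := exits_surface cW vW u0 W0.
have e0 : 0 < enorm u by rewrite enorm_gt0.
case: (surface_area W) => [s| |]//; last by rewrite gt0_muleNy ?lte_fin// leeNy_eq.
rewrite -EFinM !lee_fin => h.
by rewrite -(pmulr_rge0 _ e0) (le_trans _ h)// mulr_ge0// mes_ge0.
Qed.

(** If the surface area [s] is finite, [exits_surface] allows [beta = delta * s / 2]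
    in [covariance_bounds]. Otherwise only the lower bound says something, and
    [beta = mes W] gives it. *)
Lemma covariance_deficit (t : R) eta (delta tau1 tau2 : R) : 0 < t -> poisson_process P W t eta ->
  0 < delta -> - d%:R < tau1 -> - d%:R < tau2 -> - d%:R < tau1 + tau2 ->
  (0 <= (volume W)%:E - covariance P (length_at eta delta tau1) (length_at eta delta tau2)
        * ((cov_scale d t delta tau1 tau2)^-1)%:E
     <= delta%:E * surface_area W)%E.
Proof.
move=> t0 etaP delta0 td1 td2 td12.
have sc0 := cov_scale_gt0 d0 (kappa_gt0 cW W0) td1 td2 t0 delta0.
have := surface_area_ge0.
have := fun u u0 => @exits_surface R d W cW vW u u0 W0.
case: (surface_area W) => [s| |] // hs s0.
  have s0' : 0 <= s by rewrite -lee_fin.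
  have b0 : 0 <= delta * s / 2 by rewrite divr_ge0// mulr_ge0// ltW.
  have hb u : u != 0 -> enorm u < delta -> mes (exits W u) <= delta * s / 2.
    move=> u0 ud; have := hs u u0; rewrite -EFinM lee_fin => h.
    have := ler_wpM2r s0' (ltW ud); lra.
  have [c -> /andP[c1 c2]] := covariance_bounds cW t0 etaP delta0 b0 hb td1 td2 td12.
  rewrite -!EFinM -EFinB !lee_fin subr_ge0 ler_pdivrMr// c2 /=.
  have : volume W - 2 * (delta * s / 2) <= c / cov_scale d t delta tau1 tau2.
    by rewrite ler_pdivlMr.
  lra.
rewrite gt0_muley ?lte_fin// leey andbT.
have hb u : u != 0 -> enorm u < delta -> mes (exits W u) <= mes W.
  move=> _ _; apply: mes_le; [exact: (finb_exits cW u).1|exact: finb_compact|].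
  by move=> x [].
have [c -> /andP[_ c2]] := covariance_bounds cW t0 etaP delta0 (mes_ge0 W) hb td1 td2 td12.
by rewrite -EFinM -EFinB lee_fin subr_ge0 ler_pdivrMr.
Qed.

Section asymptotics.
Variable eta : R -> Omega -> {fset 'rV[R]_d}.
Hypothesis etaP : forall t : R, 0 < t -> poisson_process P W t (eta t).
Variable delta : R -> R.
Hypothesis delta_gt0 : forall t : R, 0 < t -> 0 < delta t.
Hypothesis delta_cvg : delta t @[t --> +oo%R] --> (0 : R).

(** By [mes_exits_lipschitz], [beta = C * delta t] is allowed in
    [covariance_bounds] as soon as [delta t < 1]. *)
Lemma covariance_asymptotics (tau1 tau2 : R) :
  - d%:R < tau1 -> - d%:R < tau2 -> - d%:R < tau1 + tau2 ->
  exists2 k, 0 < k & \forall t \near +oo%R,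
    exists2 r, `|r| <= k * delta t &
      covariance P (length_at (eta t) (delta t) tau1) (length_at (eta t) (delta t) tau2) =
        (cov_scale d t (delta t) tau1 tau2 * volume W * (1 + r))%:E.
Proof.
move=> td1 td2 td12; have [C C0 hC] := mes_exits_lipschitz cW vW.
exists (2 * C / volume W); first by rewrite divr_gt0// mulr_gt0.
have d1 : \forall t \near +oo%R, delta t < 1 by exact: (cvgr_lt _ delta_cvg).
near=> t.
have t0 : 0 < t by near: t; exact: nbhs_pinfty_gt.
have dt0 := delta_gt0 t0.
have dt1 : delta t < 1 by near: t.
have b0 : 0 <= C * delta t by rewrite mulr_ge0// ltW.
have hb (u : 'rV[R]_d) : u != 0 -> enorm u < delta t -> mes (exits W u) <= C * delta t.
  move=> u0 ud; apply: (le_trans (hC u _)); last by rewrite ler_wpM2l// ltW.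
  by rewrite enorm_gt0 u0 (ltW (lt_trans ud dt1)).
have sc0 := cov_scale_gt0 d0 (kappa_gt0 cW W0) td1 td2 t0 dt0.
have [c -> /andP[c1 c2]] := covariance_bounds cW t0 (etaP t0) dt0 b0 hb td1 td2 td12.
set sc := cov_scale _ _ _ _ _ in sc0 c1 c2 *.
have sV0 : 0 < sc * volume W by rewrite mulr_gt0.
exists (c / (sc * volume W) - 1); last by congr EFin; field; rewrite !gt_eqF.
have c1' : 1 - 2 * C / volume W * delta t <= c / (sc * volume W).
  rewrite ler_pdivlMr// [leLHS](_ : _ = (volume W - 2 * (C * delta t)) * sc)//.
  by field; rewrite gt_eqF.
have c2' : c / (sc * volume W) <= 1 by rewrite ler_pdivrMr// mul1r mulrC.
have k0 : 0 <= 2 * C / volume W * delta t.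
  by rewrite mulr_ge0 ?divr_ge0 ?mulr_ge0 ?(ltW C0) ?(ltW W0) ?(ltW dt0).
by rewrite ler_norml; apply/andP; split; lra.
Unshelve. all: by end_near. Qed.

(** The normalised covariance is [volume W * cov_ratio * (1 + r)], where [r] is of
    the order of [delta t]. *)
Lemma covariance_normalized_cvg (tau1 tau2 l : R) :
  - d%:R < tau1 -> - d%:R < tau2 -> - d%:R < tau1 + tau2 ->
  cov_ratio d tau1 tau2 (t * delta t ^+ d) @[t --> +oo%R] --> l ->
  covariance P
    (fun w => (length_at (eta t) (delta t) tau1 w - fine ('E_P[length_at (eta t) (delta t) tau1])%E)
              / norm_const d t (delta t) tau1)
    (fun w => (length_at (eta t) (delta t) tau2 w - fine ('E_P[length_at (eta t) (delta t) tau2])%E)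
              / norm_const d t (delta t) tau2) @[t --> +oo%R] --> (volume W * l)%:E.
Proof.
move=> td1 td2 td12 cvl; have kp := kappa_gt0 cW W0.
have [k k0 hk] := covariance_asymptotics td1 td2 td12.
pose rel t r := `|r| <= k * delta t /\
      covariance P (length_at (eta t) (delta t) tau1) (length_at (eta t) (delta t) tau2) =
        (cov_scale d t (delta t) tau1 tau2 * volume W * (1 + r))%:E.
pose r t : R := xget 0 (rel t).
have rP : \forall t \near +oo%R, rel t (r t).
  apply: filterS hk => t [x x1 x2]; rewrite /r; case: xgetP => [//|nx].
  by have := nx x; case.
have r_cvg : r t @[t --> +oo%R] --> (0 : R).
  apply/norm_cvg0P; have kd : k * delta t @[t --> +oo%R] --> (0 : R).
    by rewrite -[0](mulr0 k); exact: cvgMl_tmp.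
  apply: (squeeze_cvgr _ (cvg_cst 0) kd).
  by apply: filterS rP => t [rt _]; rewrite normr_ge0.
have : volume W * cov_ratio d tau1 tau2 (t * delta t ^+ d) * (1 + r t) @[t --> +oo%R]
    --> volume W * l * (1 + 0).
  by apply: cvgM; [exact: cvgMl_tmp|apply: cvgD => //; exact: cvg_cst].
rewrite addr0 mulr1 => cv.
have : (volume W * cov_ratio d tau1 tau2 (t * delta t ^+ d) * (1 + r t))%:E @[t --> +oo%R]
    --> (volume W * l)%:E.
  by apply: cvg_EFin; [exact: nearW|exact: cv].
apply: cvg_trans; apply: near_eq_cvg; near=> t.
have t0 : 0 < t by near: t; exact: nbhs_pinfty_gt.
have dt0 := delta_gt0 t0.
have [_ ct] : rel t (r t) by near: t.
have tP := etaP t0.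
have I1 := Lfun1_length_at cW t0 tP dt0 td1; have I2 := Lfun1_length_at cW t0 tP dt0 td2.
rewrite (covariance_standardize _ _ I1 I2 (Lfun1_length_atM cW t0 tP dt0 td1 td2 td12)).
rewrite ct -cov_scale_norm// -EFinM; congr EFin; ring.
Unshelve. all: by end_near. Qed.

End asymptotics.
End consequences.

Theorem theorem3p3 (R : realType) (d : nat) (d_ge1 : (1 <= d)%N)
    (W : set 'rV[R]_d) (W_compact : compact W) (W_convex : convex_set W)
    (W_pos : 0 < volume W)
    (disp : measure_display) (Omega : measurableType disp)
    (P : probability Omega R)
    (eta : R -> Omega -> {fset 'rV[R]_d})
    (eta_poisson : forall t : R, 0 < t -> poisson_process P W t (eta t))
    (delta : R -> R) (delta_pos : forall t : R, 0 < t -> 0 < delta t)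
    (delta_cvg0 : delta t @[t --> +oo%R] --> (0 : R)) :
  let L := fun (tau t : R) (w : Omega) =>
    length_power (delta t) tau (eta t w) in
  [/\ forall tau1 tau2 : R, - d%:R < tau1 -> - d%:R < tau2 ->
        - d%:R < tau1 + tau2 ->
        forall t : R, 0 < t ->
          (0 <= (volume W)%:E
                - covariance P (L tau1 t) (L tau2 t)
                  * ((cov_scale d t (delta t) tau1 tau2)^-1)%:E
             <= (delta t)%:E * surface_area W)%E,
      forall tau1 : R, - (d%:R / 2) < tau1 ->
        exists2 r : R -> R,
          exists2 k : R, 0 < k &
            \forall t \near +oo%R, `|r t| <= k * `|delta t|
          &
          \forall t \near +oo%R,
            'V_P[L tau1 t]%E =
              (cov_scale d t (delta t) tau1 tau1 * volume W * (1 + r t))%:E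
    & forall (m : nat) (tau : 'I_m -> R),
        (forall i, - (d%:R / 2) < tau i) ->
        let Lt := fun (t : R) (i : 'I_m) (w : Omega) =>
          (L (tau i) t w - fine ('E_P[L (tau i) t])%E)
          / norm_const d t (delta t) (tau i) in
        [/\ t * delta t ^+ d @[t --> +oo%R] --> (0 : R) ->
              asymptotic_cov_mx P Lt (Sigma1 W tau),
            forall c : R, 0 < c -> c <= 1 ->
              t * delta t ^+ d @[t --> +oo%R] --> c ->
              asymptotic_cov_mx P Lt (Sigma1 W tau + c *: Sigma2 W tau),
            forall c : R, 1 < c ->
              t * delta t ^+ d @[t --> +oo%R] --> c ->
              asymptotic_cov_mx P Lt (c^-1 *: Sigma1 W tau + Sigma2 W tau)
          & t * delta t ^+ d @[t --> +oo%R] --> +oo%R ->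
              asymptotic_cov_mx P Lt (Sigma2 W tau)]].
Proof.
have vW := convex_set_cvx W_convex.
have dR : 1 <= d%:R :> R by rewrite ler1n.
move=> L; split.
- move=> tau1 tau2 td1 td2 td12 t t0.
  exact: (@covariance_deficit R d d_ge1 W W_compact vW W_pos _ _ P t _ _ _ _ t0
    (eta_poisson t t0) (delta_pos t t0) td1 td2 td12).
- move=> tau td.
  have td1 : - d%:R < tau by lra.
  have td2 : - d%:R < tau + tau by lra.
  have [k k0 hk] := covariance_asymptotics d_ge1 W_compact vW W_pos eta_poisson
    delta_pos delta_cvg0 td1 td1 td2.
  pose rel t r := `|r| <= k * delta t /\
    'V_P[L tau t]%E = (cov_scale d t (delta t) tau tau * volume W * (1 + r))%:E.
  have rP : \forall t \near +oo%R, rel t (xget 0 (rel t)).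
    apply: filterS hk => t [x x1 x2]; case: xgetP => [//|nx].
    by have := nx x; case.
  exists (fun t => xget 0 (rel t)).
    exists k => //; apply: filterS rP => t [+ _] => /le_trans; apply.
    by rewrite ler_wpM2l ?ler_norm// ltW.
  by apply: filterS rP => t [].
- move=> m tau td Lt.
  have td1 i : - d%:R < tau i by have := td i; lra.
  have td2 i j : - d%:R < tau i + tau j by have := td i; have := td j; lra.
  have key i j l := @covariance_normalized_cvg R d d_ge1 W W_compact vW W_pos _ _ P
    eta eta_poisson delta delta_pos delta_cvg0 _ _ l (td1 i) (td1 j) (td2 i j).
  split.
  + move=> s0 i j; rewrite !mxE; apply: key.
    rewrite -[sigma1 _ _ _]addr0 -(mul0r (sigma2 d (tau i) (tau j))) -cov_ratio_le1//.
    exact: cov_ratio_cvg.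
  + move=> c c0 c1 sc i j; rewrite !mxE.
    rewrite (_ : _ + _ = volume W * (sigma1 d (tau i) (tau j) +
      c * sigma2 d (tau i) (tau j))); last ring.
    by apply: key; rewrite -cov_ratio_le1//; exact: cov_ratio_cvg.
  + move=> c c1 sc i j; rewrite !mxE.
    rewrite (_ : _ + _ = volume W * (c^-1 * sigma1 d (tau i) (tau j) +
      sigma2 d (tau i) (tau j))); last ring.
    by apply: key; rewrite -cov_ratio_gt1//; exact: cov_ratio_cvg.
  + move=> sy i j; rewrite !mxE; apply: key; exact: cov_ratio_cvgy.
Qed.
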